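(* Let $\mathsf U$ be a unitary monoidal category. Consider the strict 2-category whose 0-cells are tensored dagger $\mathsf U$-categories, 1-cells are dagger $\mathsf U$-functors and 2-cells are $\mathsf U$-natural transformations, and the strict 2-category whose 0-cells are tensored dagger (right) $\mathsf U$-module categories, 1-cells are dagger $\mathsf U$-module functors and 2-cells are $\mathsf U$-module natural transformations. There is a strict locally isomorphic 2-equivalence between these two strict 2-categories.
   Context: Conventions. Composition in ordinary categories is written in diagrammatic order: for $f:a\to b$, $g:b\to c$ the composite is $f\circ g:a\to c$. Tensor symbols, associators and unitors of monoidal categories are suppressed; juxtaposition of morphisms is tensor product. If categories are $\mathbb C$-linear, daggers and conjugations are required to be anti-linear. 2-equivalence. A strict 2-functor is a strict locally isomorphic 2-equivalence if every 0-cell of the target is equivalent to one in its image and all its functors on hom categories are isomorphisms of categories. Unitary monoidal category. A dagger category has an involutive identity-on-objects contravariant $\dagger$; $u$ is unitary if $u^{-1}=u^\dagger$. A monoidal dagger category is a monoidal category with a dagger such that $\otimes$ is a dagger functor and the coherence isomorphisms are unitary. It is rigid if every object $v$ has a dual $v^*$ with $\mathrm{ev}_v:vv^*\to 1$, $\mathrm{coev}_v:1\to v^*v$ satisfying the zig-zag equations (and every object is isomorphic to a dual). A unitary dual functor is a choice of duals such that $f\mapsto f^*=(\mathrm{coev}_u\,\mathrm{id}_{v^*})\circ(\mathrm{id}_{u^*}f\,\mathrm{id}_{v^*})\circ(\mathrm{id}_{u^*}\mathrm{ev}_v)$ (for $f:u\to v$) satisfies $(f^* )^\dagger=(f^\dagger)^*$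 and $\nu_{u,v}=(\mathrm{coev}_{vu}\mathrm{id}_{u^*v^*})\circ(\mathrm{id}_{(vu)^*v}\mathrm{ev}_u\mathrm{id}_{v^*})\circ(\mathrm{id}_{(vu)^*}\mathrm{ev}_v):u^*v^*\to(vu)^*$ is unitary. A unitary monoidal category is a rigid monoidal dagger category with a unitary dual functor. It has conjugation $\overline v=v^*$, $\overline f=(f^\dagger)^*$, with $r=\mathrm{coev}_1:1\to\overline 1$, $\nu_{u,v}:\overline u\,\overline v\to\overline{vu}$ and $\varphi_u=(\mathrm{id}_u\mathrm{ev}_{\overline u}^\dagger)\circ(\mathrm{ev}_u\mathrm{id}_{\overline{\overline u}}):u\to\overline{\overline u}$. Enriched categories. A $\mathsf U$-category $\mathcal A$ has hom objects $\mathcal A(a\to b)\in\mathsf U$, identities $j_a:1\to\mathcal A(a\to a)$ and compositions $-\circ_{\mathcal A}-:\mathcal A(a\to b)\mathcal A(b\to c)\to\mathcal A(a\to c)$, unital and associative. A $\mathsf U$-functor $\mathcal F:\mathcal A\to\mathcal B$ is a map on objects with morphisms $\mathcal F_{a\to b}:\mathcal A(a\to b)\to\mathcal B(\mathcal F(a)\to\mathcal F(b))$ compatible with compositions and identities. A $\mathsf U$-natural transformation $\theta:\mathcal F\Rightarrow\mathcal G$ is a family $\theta_a:1\to\mathcal B(\mathcal F(a)\to\mathcal G(a))$ with $(\theta_a\,\mathcal G_{a\to b})\circ(-\circ_{\mathcal B}-)=(\mathcal F_{a\to b}\,\theta_b)\circ(-\circ_{\mathcal B}-)$. The underlying category $\mathsf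 A$ has the same objects, $\mathsf A(a\to b)=\mathsf U(1\to\mathcal A(a\to b))$, composition $f\circ g=(fg)\circ(-\circ_{\mathcal A}-)$, identities $j_a$; the underlying functor is $\mathsf F(f)=f\circ\mathcal F_{a\to b}$. The self-enrichment $\mathcal U$ has the objects of $\mathsf U$, $\mathcal U(u\to v)=u^*v$, composition $\mathrm{id}_{u^*}\mathrm{ev}_v\mathrm{id}_w$, $j_v=\mathrm{coev}_v$; $\mathsf U$ is identified with its underlying category by $(f:u\to v)\mapsto\mathrm{coev}_u\circ(\mathrm{id}_{u^*}f)$. Tensored $\mathsf U$-categories. The representable $\mathsf U$-functor $\mathcal A(a\to-):\mathcal A\to\mathcal U$ is $b\mapsto\mathcal A(a\to b)$ with $\mathcal A(a\to-)_{b\to c}=(\mathrm{coev}_{\mathcal A(a\to b)}\mathrm{id})\circ(\mathrm{id}\,(-\circ_{\mathcal A}-))$. A left $\mathsf U$-adjoint of $\mathcal R:\mathcal B\to\mathcal C$ is a $\mathsf U$-functor $\mathcal L:\mathcal C\to\mathcal B$ with isomorphisms $\Psi_{c,d}:\mathcal B(\mathcal L(c)\to d)\to\mathcal C(c\to\mathcal R(d))$ such that $(-\circ_{\mathcal C}-)\circ\Psi_{c,d}^{-1}=(\mathcal L_{c\to c'}\Psi_{c',d}^{-1})\circ(-\circ_{\mathcal B}-)$ on $\mathcal C(c\to c')\mathcal C(c'\to\mathcal R(d))$ and $(-\circ_{\mathcal B}-)\circ\Psi_{c,d'}=(\Psi_{c,d}\mathcal R_{d\to d'})\circ(-\circ_{\mathcal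 C}-)$ on $\mathcal B(\mathcal L(c)\to d)\mathcal B(d\to d')$. $\mathcal A$ is tensored if each $\mathcal A(a\to-)$ has a left $\mathsf U$-adjoint, denoted $a\lhd-:\mathcal U\to\mathcal A$. It induces an adjunction $\mathsf A(a\lhd u\to b)\cong\mathsf U(u\to\mathcal A(a\to b))$; corresponding morphisms are called mates. Let $\rho_a\in\mathsf A(a\lhd 1\to a)$ be the mate of $j_a$. Dagger $\mathsf U$-categories. A weak dagger $\mathsf U$-category is a $\mathsf U$-category $\mathcal A$ with isomorphisms $\kappa_{a\to b}:\overline{\mathcal A(b\to a)}\to\mathcal A(a\to b)$ such that ($\kappa$1) $\varphi_{\mathcal A(a\to b)}\circ\overline{\kappa_{b\to a}}\circ\kappa_{a\to b}=\mathrm{id}$; ($\kappa$2) $(\kappa_{a\to b}\kappa_{b\to c})\circ(-\circ_{\mathcal A}-)=\nu_{\mathcal A(b\to a),\mathcal A(c\to b)}\circ\overline{(-\circ_{\mathcal A}-)}\circ\kappa_{a\to c}$ on $\overline{\mathcal A(b\to a)}\,\overline{\mathcal A(c\to b)}$. Then $\mathsf A$ has a dagger: for $f\in\mathsf A(a\to b)$, $f^\dagger=r\circ\overline f\circ\kappa_{b\to a}$. A $\mathsf U$-functor $\mathcal F$ between weak dagger $\mathsf U$-categories is dagger if $\kappa^{\mathcal A}_{a\to b}\circ\mathcal F_{a\to b}=\overline{\mathcal F_{b\to a}}\circ\kappa^{\mathcal B}_{\mathcal F(a)\to\mathcal F(b)}$. The self-enrichment $\mathcal U$ has $\kappa^{\mathcal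 U}_{u\to v}=\nu_{u,\overline v}^{-1}\circ(\mathrm{id}_{\overline u}\varphi_v^{-1}):\overline{\overline v u}\to\overline u v$. A (tensored) dagger $\mathsf U$-category is a tensored weak dagger $\mathsf U$-category such that ($\kappa$3) each $\rho_a$ is unitary in $\mathsf A$, and ($\kappa$4) each left $\mathsf U$-adjoint $a\lhd-:\mathcal U\to\mathcal A$ of $\mathcal A(a\to-)$ is a dagger $\mathsf U$-functor. Module categories. A right $\mathsf U$-module category is a category $\mathsf M$ with a functor $-\lhd-:\mathsf M\times\mathsf U\to\mathsf M$ and natural isomorphisms $\alpha_{m,u,v}:m\lhd uv\to m\lhd u\lhd v$, $\rho_m:m\lhd 1\to m$ satisfying the pentagon and triangle axioms. It is dagger if $\mathsf M$ is a dagger category, $\lhd$ is a dagger functor and $\alpha,\rho$ are unitary; it is tensored if every $m\lhd-:\mathsf U\to\mathsf M$ has a right adjoint. A module functor $(\mathsf F,\omega)$ is a functor with natural isomorphisms $\omega_{m,u}:\mathsf F(m)\lhd u\to\mathsf F(m\lhd u)$ compatible with $\alpha$ and $\rho$; it is dagger if $\mathsf F(f^\dagger)=\mathsf F(f)^\dagger$ and all $\omega_{m,u}$ are unitary. A module natural transformation $\theta:\mathsf F\Rightarrow\mathsf G$ is a natural transformation with $\omega^{\mathsf F}_{m,u}\circ\theta_{m\lhd u}=(\theta_m\lhd\mathrm{id}_u)\circ\omega^{\mathsf G}_{m,u}$. *)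

(* Defs.v *)
From Corelib Require Import ssreflect.
From Stdlib Require Import FunctionalExtensionality ProofIrrelevance.

Set Implicit Arguments.
Unset Strict Implicit.
Unset Printing Implicit Defensive.

Declare Scope cat_scope.
Delimit Scope cat_scope with cat.
Local Open Scope cat_scope.

(* Composition is in diagrammatic order throughout: [f ;; g] is first [f], then
   [g].  Equality of objects and of morphisms is Leibniz equality. *)
Record category := Category {
  ob :> Type;
  hom : ob -> ob -> Type;
  idm : forall a, hom a a;
  comp : forall a b c, hom a b -> hom b c -> hom a c;
  comp1m : forall a b (f : hom a b), comp (idm a) f = f;
  compm1 : forall a b (f : hom a b), comp f (idm b) = f;
  compA : forall a b c d (f : hom a b) (g : hom b c) (h : hom c d),
    comp f (comp g h) = comp (comp f g) h
}.

Arguments idm {c} a : rename.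

Notation "f ;; g" := (comp f g) (at level 50, left associativity) : cat_scope.

Definition inverse (C : category) (a b : C) (f : hom a b) (g : hom b a) : Prop :=
  f ;; g = idm a /\ g ;; f = idm b.

Record iso (C : category) (a b : C) := Iso {
  iso_hom :> hom a b;
  iso_inv : hom b a;
  isoK : iso_hom ;; iso_inv = idm a;
  isoVK : iso_inv ;; iso_hom = idm b
}.

Notation "i ^-1" := (iso_inv i) (at level 30, format "i ^-1") : cat_scope.

Definition isomorphic (C : category) (a b : C) : Prop := inhabited (iso a b).

Record functor (C D : category) := Functor {
  fob :> C -> D;
  fmap : forall a b, hom a b -> hom (fob a) (fob b);
  fmap1 : forall a, fmap (idm a) = idm (fob a);
  fmapM : forall a b c (f : hom a b) (g : hom b c),
    fmap (f ;; g) = fmap f ;; fmap g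
}.

Arguments fmap {C D} f {a b} : rename.

Definition hcast (C : category) (a a' b b' : C) (ea : a = a') (eb : b = b')
    (f : hom a b) : hom a' b' :=
  match ea in _ = x, eb in _ = y return hom x y with eq_refl, eq_refl => f end.

Lemma hcast_id (C : category) (a b : C) (ea : a = a) (eb : b = b) (f : hom a b) :
  hcast ea eb f = f.
Proof. by rewrite (proof_irrelevance _ ea eq_refl) (proof_irrelevance _ eb eq_refl). Qed.

Lemma functor_ext (C D : category) (F G : functor C D)
    (E : forall a, F a = G a) :
  (forall a b (f : hom a b), hcast (E a) (E b) (fmap F f) = fmap G f) -> F = G.
Proof.
case: F E => Fo Fm F1 FM; case: G => Go Gm G1 GM /= E H.
have e : Fo = Go by apply: functional_extensionality.
case: Go / e Gm G1 GM E H => Gm G1 GM E H.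
have e : Fm = Gm.
  extensionality a; extensionality b; extensionality f.
  by rewrite -H hcast_id.
case: Gm / e G1 GM H => G1 GM _.
by rewrite (proof_irrelevance _ F1 G1) (proof_irrelevance _ FM GM).
Qed.

Local Ltac functor_refl :=
  unshelve eapply functor_ext; [intros; exact eq_refl | by []].

Lemma functor_eq_hom (C D : category) (F G : functor C D) : F = G ->
  forall a b (f : hom a b) (ea : F a = G a) (eb : F b = G b),
  hcast ea eb (fmap F f) = fmap G f.
Proof. move=> e; case: G / e => *; exact: hcast_id. Qed.

Definition functor_id (C : category) : functor C C :=
  @Functor C C (fun a => a) (fun a b f => f)
    (fun a => eq_refl) (fun a b c f g => eq_refl).

Lemma functor_comp_id (C D E : category) (F : functor C D) (G : functor D E) a :
  fmap G (fmap F (idm a)) = idm (G (F a)).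
Proof. by rewrite !fmap1. Qed.

Lemma functor_comp_comp (C D E : category) (F : functor C D) (G : functor D E)
    a b c (f : hom a b) (g : hom b c) :
  fmap G (fmap F (f ;; g)) = fmap G (fmap F f) ;; fmap G (fmap F g).
Proof. by rewrite !fmapM. Qed.

Definition functor_comp (C D E : category) (F : functor C D) (G : functor D E) :
    functor C E :=
  @Functor C E (fun a => G (F a)) (fun a b f => fmap G (fmap F f))
    (functor_comp_id F G) (functor_comp_comp F G).

Definition prod_cat (C D : category) : category.
Proof.
refine (@Category (C * D)%type
  (fun x y => (hom (fst x) (fst y) * hom (snd x) (snd y))%type)
  (fun x => (idm (fst x), idm (snd x)))
  (fun x y z f g => (fst f ;; fst g, snd f ;; snd g)) _ _ _).
- by move=> x y [f g] /=; rewrite !comp1m.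
- by move=> x y [f g] /=; rewrite !compm1.
- by move=> x y z t f g h /=; rewrite !compA.
Defined.

Definition prod_functor (C C' D D' : category) (F : functor C D) (G : functor C' D') :
    functor (prod_cat C C') (prod_cat D D').
Proof.
refine (@Functor (prod_cat C C') (prod_cat D D')
  (fun x => (F (fst x), G (snd x)))
  (fun x y f => (fmap F (fst f), fmap G (snd f))) _ _).
- by move=> x /=; rewrite !fmap1.
- by move=> x y z f g /=; rewrite !fmapM.
Defined.

Definition prod_assoc (C D E : category) :
    functor (prod_cat (prod_cat C D) E) (prod_cat C (prod_cat D E)) :=
  @Functor (prod_cat (prod_cat C D) E) (prod_cat C (prod_cat D E))
    (fun x => (fst (fst x), (snd (fst x), snd x)))
    (fun x y f => (fst (fst f), (snd (fst f), snd f)))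
    (fun x => eq_refl) (fun x y z f g => eq_refl).

Definition pair_left (C D : category) (c : C) : functor D (prod_cat C D).
Proof.
refine (@Functor D (prod_cat C D) (fun d => (c, d)) (fun d d' f => (idm c, f)) _ _).
- by [].
- by move=> x y z f g /=; rewrite comp1m.
Defined.

Definition pair_right (C D : category) (d : D) : functor C (prod_cat C D).
Proof.
refine (@Functor C (prod_cat C D) (fun c => (c, d)) (fun c c' f => (f, idm d)) _ _).
- by [].
- by move=> x y z f g /=; rewrite comp1m.
Defined.

Definition is_iso_of_categories (C D : category) (F : functor C D) : Prop :=
  exists G : functor D C,
    functor_comp F G = functor_id C /\ functor_comp G F = functor_id D.

Definition has_right_adjoint (C D : category) (L : functor C D) : Prop :=
  exists (R : functor D C)
         (mate : forall c d, hom (L c) d -> hom c (R d))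
         (mateV : forall c d, hom c (R d) -> hom (L c) d),
    (forall c d (f : hom (L c) d), mateV c d (mate c d f) = f) /\
    (forall c d (g : hom c (R d)), mate c d (mateV c d g) = g) /\
    (forall c c' d d' (f : hom c' c) (h : hom (L c) d) (g : hom d d'),
       mate c' d' (fmap L f ;; h ;; g) = f ;; mate c d h ;; fmap R g).

(* Strict 2-categories are categories enriched in [Cat]: the strict associativity and
   unit laws are Leibniz equalities of functors between categories of cells. *)
Record strict2cat := Strict2Cat {
  cell0 :> Type;
  cells : cell0 -> cell0 -> category;
  id1 : forall a, cells a a;
  comp2 : forall a b c, functor (prod_cat (cells a b) (cells b c)) (cells a c);
  comp2_1l : forall a b,
    functor_comp (pair_left _ (id1 a)) (comp2 a a b) = functor_id (cells a b);
  comp2_1r : forall a b,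
    functor_comp (pair_right _ (id1 b)) (comp2 a b b) = functor_id (cells a b);
  comp2A : forall a b c d,
    functor_comp (prod_functor (comp2 a b c) (functor_id (cells c d))) (comp2 a c d)
    = functor_comp (prod_assoc (cells a b) (cells b c) (cells c d))
        (functor_comp (prod_functor (functor_id (cells a b)) (comp2 b c d))
           (comp2 a b d))
}.

Arguments comp2 {s} a b c : rename.

Record strict2functor (C D : strict2cat) := Strict2Functor {
  f2ob :> C -> D;
  f2cells : forall a b : C, functor (cells a b) (cells (f2ob a) (f2ob b));
  f2_id1 : forall a, f2cells a a (id1 a) = id1 (f2ob a);
  f2_comp2 : forall a b c,
    functor_comp (comp2 a b c) (f2cells a c)
    = functor_comp (prod_functor (f2cells a b) (f2cells b c))
        (comp2 (f2ob a) (f2ob b) (f2ob c))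
}.

Arguments f2cells {C D} F a b : rename.

Definition equivalent_cells (C : strict2cat) (a b : C) : Prop :=
  exists (f : cells a b) (g : cells b a),
    isomorphic (comp2 a b a (f, g)) (id1 a) /\
    isomorphic (comp2 b a b (g, f)) (id1 b).

Definition is_strict_locally_isomorphic_2equivalence (C D : strict2cat)
    (F : strict2functor C D) : Prop :=
  (forall d : D, exists c : C, equivalent_cells d (F c)) /\
  (forall a b : C, is_iso_of_categories (f2cells F a b)).

Definition full_subcat (C : category) (P : C -> Prop) : category :=
  @Category {a : C | P a} (fun x y => hom (proj1_sig x) (proj1_sig y))
    (fun x => idm (proj1_sig x)) (fun x y z f g => f ;; g)
    (fun x y f => comp1m f) (fun x y f => compm1 f)
    (fun x y z t f g h => compA f g h).

Definition full_incl (C : category) (P : C -> Prop) : functor (full_subcat P) C :=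
  @Functor (full_subcat P) C (fun x => proj1_sig x) (fun x y f => f)
    (fun x => eq_refl) (fun x y z f g => eq_refl).

Definition full_lift (B C : category) (P : C -> Prop) (F : functor B C)
    (PF : forall b, P (F b)) : functor B (full_subcat P) :=
  @Functor B (full_subcat P) (fun b => exist _ (F b) (PF b)) (fun a b f => fmap F f)
    (fun a => fmap1 F a) (fun a b c f g => fmapM F f g).

Lemma full_incl_mono (B C : category) (P : C -> Prop)
    (F G : functor B (full_subcat P)) :
  functor_comp F (full_incl P) = functor_comp G (full_incl P) -> F = G.
Proof.
move=> e.
have E a : F a = G a.
  have := f_equal (fun K : functor B C => K a) e => /=.
  case: (F a) (G a) => [x px] [y py] /= exy.
  case: y / exy py => py; by rewrite (proof_irrelevance _ px py).
apply: (functor_ext (E := E)) => a b f.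
have hE x y (ex ey : full_subcat P) (p : x = ex) (q : y = ey) (h : hom x y) :
    hcast p q h = hcast (f_equal (@proj1_sig _ _) p) (f_equal (@proj1_sig _ _) q) h
                    :> hom (proj1_sig ex) (proj1_sig ey).
  by case: ex / p; case: ey / q.
rewrite hE; exact: (functor_eq_hom e).
Qed.

Section Sub2Cat.
(* The locally full sub-2-category of [C] with 0-cells indexed by [X] and with the
   1-cells satisfying [P]; [X] may carry more data than the 0-cells of [C]. *)
Context (C : strict2cat) (X : Type) (i : X -> C).
Context (P : forall x y, cells (i x) (i y) -> Prop).
Context (P1 : forall x, P (id1 (i x))).
Context (Pcomp : forall x y z (f : cells (i x) (i y)) (g : cells (i y) (i z)),
  P f -> P g -> P (comp2 _ _ _ (f, g))).

Definition sub_cells (x y : X) : category := full_subcat (P (x := x) (y := y)).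

Definition sub_id1 (x : X) : sub_cells x x := exist _ (id1 (i x)) (P1 x).

Definition sub_comp2 (x y z : X) :
    functor (prod_cat (sub_cells x y) (sub_cells y z)) (sub_cells x z) :=
  @full_lift (prod_cat (sub_cells x y) (sub_cells y z)) _ (P (x := x) (y := z))
    (functor_comp (prod_functor (full_incl _) (full_incl _))
                  (comp2 (i x) (i y) (i z)))
    (fun fg => Pcomp (proj2_sig (fst fg)) (proj2_sig (snd fg))).

Definition sub2cat : strict2cat.
Proof.
refine (@Strict2Cat X sub_cells sub_id1 sub_comp2 _ _ _).
- move=> x y; apply: full_incl_mono.
  transitivity (functor_comp (full_incl (P (x := x) (y := y)))
    (functor_comp (pair_left _ (id1 (i x))) (comp2 (i x) (i x) (i y)))).
    by functor_refl.
  by rewrite comp2_1l; functor_refl.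
- move=> x y; apply: full_incl_mono.
  transitivity (functor_comp (full_incl (P (x := x) (y := y)))
    (functor_comp (pair_right _ (id1 (i y))) (comp2 (i x) (i y) (i y)))).
    by functor_refl.
  by rewrite comp2_1r; functor_refl.
- move=> x y z t; apply: full_incl_mono.
  transitivity (functor_comp
    (prod_functor (prod_functor (full_incl (P (x := x) (y := y)))
                                (full_incl (P (x := y) (y := z))))
                  (full_incl (P (x := z) (y := t))))
    (functor_comp (prod_functor (comp2 (i x) (i y) (i z)) (functor_id _))
                  (comp2 (i x) (i z) (i t)))).
    by functor_refl.
  by rewrite comp2A; functor_refl.
Defined.
End Sub2Cat.

(* Monoidal categories need not be strict; formulas which suppress associators and
   unitors on paper are written below with these inserted. *)
Record monoidal_category := MonoidalCategory {
  mcat :> category;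
  one : mcat;
  tens : mcat -> mcat -> mcat;
  tensm : forall a b c d : mcat, hom a b -> hom c d -> hom (tens a c) (tens b d);
  tensm1 : forall a b, tensm (idm a) (idm b) = idm (tens a b);
  tensmM : forall a b c a' b' c' (f : hom a b) (g : hom b c)
      (f' : hom a' b') (g' : hom b' c'),
    tensm (f ;; g) (f' ;; g') = tensm f f' ;; tensm g g';
  asc : forall a b c, iso (tens (tens a b) c) (tens a (tens b c));
  lun : forall a, iso (tens one a) a;
  run : forall a, iso (tens a one) a;
  asc_nat : forall a b c a' b' c' (f : hom a a') (g : hom b b') (h : hom c c'),
    tensm (tensm f g) h ;; asc a' b' c' = asc a b c ;; tensm f (tensm g h);
  lun_nat : forall a b (f : hom a b), tensm (idm one) f ;; lun b = lun a ;; f;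
  run_nat : forall a b (f : hom a b), tensm f (idm one) ;; run b = run a ;; f;
  pentagon : forall a b c d,
    tensm (asc a b c) (idm d) ;; asc a (tens b c) d ;; tensm (idm a) (asc b c d)
    = asc (tens a b) c d ;; asc a b (tens c d);
  triangle : forall a b,
    asc a one b ;; tensm (idm a) (lun b) = tensm (run a) (idm b)
}.

Arguments one {m} : rename.

Notation "a ⊗ b" := (tens a b) (at level 40, left associativity) : cat_scope.
Notation "f ⊠ g" := (tensm f g) (at level 40, left associativity) : cat_scope.

Lemma compK (C : category) (a b c : C) (f : hom a b) (i : iso b c) : f ;; i ;; i^-1 = f.
Proof. by rewrite -compA isoK compm1. Qed.

Lemma compVK (C : category) (a b c : C) (f : hom a b) (i : iso c b) : f ;; i^-1 ;; i = f.
Proof. by rewrite -compA isoVK compm1. Qed.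

Lemma compKl (C : category) (a b c : C) (i : iso a b) (f : hom a c) : i ;; (i^-1 ;; f) = f.
Proof. by rewrite compA isoK comp1m. Qed.

Lemma compVKl (C : category) (a b c : C) (i : iso b a) (f : hom a c) : i^-1 ;; (i ;; f) = f.
Proof. by rewrite compA isoVK comp1m. Qed.

Lemma iso_epi (C : category) (a b c : C) (i : iso a b) (f g : hom b c) :
  i ;; f = i ;; g -> f = g.
Proof. by move=> e; rewrite -(compVKl i f) e compVKl. Qed.

Lemma iso_mono (C : category) (a b c : C) (i : iso b c) (f g : hom a b) :
  f ;; i = g ;; i -> f = g.
Proof. by move=> e; rewrite -(compK f i) e compK. Qed.

Lemma iso_ext (C : category) (a b : C) (i j : iso a b) :
  iso_hom i = iso_hom j -> i = j.
Proof.
case: i => f g H K; case: j => f' g' H' K' /= e; case: f' / e H' K' => H' K'.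
have e : g = g' by rewrite -(comp1m g) -K' -compA H compm1.
case: g' / e H' K' => H' K'.
by rewrite (proof_irrelevance _ H H') (proof_irrelevance _ K K').
Qed.

Definition iso_trans (C : category) (a b c : C) (i : iso a b) (j : iso b c) : iso a c.
Proof.
refine (@Iso C a c (i ;; j) (j^-1 ;; i^-1) _ _).
- by rewrite compA compK isoK.
- by rewrite compA compVK isoVK.
Defined.

Definition iso_map (C D : category) (F : functor C D) (a b : C) (i : iso a b) :
  iso (F a) (F b).
Proof.
refine (@Iso D (F a) (F b) (fmap F i) (fmap F (i^-1)) _ _).
- by rewrite -fmapM isoK fmap1.
- by rewrite -fmapM isoVK fmap1.
Defined.

Definition iso_sym (C : category) (a b : C) (i : iso a b) : iso b a :=
  @Iso C b a (i^-1) i (isoVK i) (isoK i).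

Section MonoidalLemmas.
Context (V : monoidal_category).
Implicit Types a b c d : V.

Lemma tensMl a b c d (f : hom b c) (g : hom c d) :
  idm a ⊠ (f ;; g) = (idm a ⊠ f) ;; (idm a ⊠ g).
Proof. by rewrite -tensmM comp1m. Qed.

Lemma tensMr a b c d (f : hom b c) (g : hom c d) :
  (f ;; g) ⊠ idm a = (f ⊠ idm a) ;; (g ⊠ idm a).
Proof. by rewrite -tensmM comp1m. Qed.

Lemma tens_lr a b c d (f : hom a b) (g : hom c d) :
  (f ⊠ idm c) ;; (idm b ⊠ g) = f ⊠ g.
Proof. by rewrite -tensmM comp1m compm1. Qed.

Lemma tens_rl a b c d (f : hom a b) (g : hom c d) :
  (idm a ⊠ g) ;; (f ⊠ idm d) = f ⊠ g.
Proof. by rewrite -tensmM comp1m compm1. Qed.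

Lemma ascV_nat a b c a' b' c' (f : hom a a') (g : hom b b') (h : hom c c') :
  (f ⊠ (g ⊠ h)) ;; (asc a' b' c')^-1 = (asc a b c)^-1 ;; (f ⊠ g ⊠ h).
Proof. by apply: (iso_epi (i := asc a b c)); rewrite compA -asc_nat compK compKl. Qed.

Lemma lunV_nat a b (f : hom a b) : (lun a)^-1 ;; (idm one ⊠ f) = f ;; (lun b)^-1.
Proof. by apply: (iso_epi (i := lun a)); rewrite compKl compA -lun_nat compK. Qed.

Lemma runV_nat a b (f : hom a b) : (run a)^-1 ;; (f ⊠ idm one) = f ;; (run b)^-1.
Proof. by apply: (iso_epi (i := run a)); rewrite compKl compA -run_nat compK. Qed.

Lemma one_tens_inj a b (f g : hom a b) : idm one ⊠ f = idm one ⊠ g -> f = g.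
Proof. by move=> e; apply: (iso_epi (i := lun a)); rewrite -!lun_nat e. Qed.

Lemma tens_one_inj a b (f g : hom a b) : f ⊠ idm one = g ⊠ idm one -> f = g.
Proof. by move=> e; apply: (iso_epi (i := run a)); rewrite -!run_nat e. Qed.

Definition tens_iso a b c d (i : iso a b) (j : iso c d) : iso (a ⊗ c) (b ⊗ d).
Proof.
refine (@Iso V (a ⊗ c) (b ⊗ d) (i ⊠ j) (i^-1 ⊠ j^-1) _ _).
- by rewrite -tensmM !isoK tensm1.
- by rewrite -tensmM !isoVK tensm1.
Defined.

Definition idiso (C : category) (a : C) : iso a a :=
  @Iso C a a (idm a) (idm a) (comp1m _) (comp1m _).

Lemma asc_lun a b : asc one a b ;; lun (a ⊗ b) = lun a ⊠ idm b.
Proof.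
apply: one_tens_inj.
apply: (iso_epi (i := asc one (one ⊗ a) b)).
apply: (iso_epi (i := tens_iso (asc one one a) (idiso b))) => /=.
rewrite tensMl !compA pentagon -compA triangle -tensm1 -asc_nat.
by rewrite -triangle tensMr -!compA asc_nat.
Qed.

Lemma asc_run a b : asc a b one ;; (idm a ⊠ run b) = run (a ⊗ b).
Proof.
apply: tens_one_inj.
apply: (iso_mono (i := asc a b one)).
rewrite tensMr -compA asc_nat -triangle tensMl !compA pentagon -compA.
by rewrite -asc_nat compA tensm1 triangle.
Qed.

Lemma lun_one : lun one = run one :> hom (one ⊗ one) (one : V).
Proof.
apply: tens_one_inj; rewrite -asc_lun -triangle; congr (_ ;; _).
by apply: (iso_mono (i := lun one)); rewrite lun_nat.
Qed.

Lemma lunV_one : (lun one)^-1 = (run one)^-1 :> hom (one : V) (one ⊗ one).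
Proof. by rewrite (iso_ext lun_one). Qed.
End MonoidalLemmas.

Record dagger (C : category) := Dagger {
  dag :> forall a b : C, hom a b -> hom b a;
  dag_idm : forall a, dag (idm a) = idm a;
  dag_comp : forall a b c (f : hom a b) (g : hom b c), dag (f ;; g) = dag g ;; dag f;
  dagK : forall a b (f : hom a b), dag (dag f) = f
}.

Definition unitary (C : category) (dg : dagger C) (a b : C) (f : hom a b) : Prop :=
  inverse f (dg a b f).

Record monoidal_dagger_category := MonoidalDaggerCategory {
  mdcat :> monoidal_category;
  mddag : dagger mdcat;
  mddag_tens : forall (a b c d : mdcat) (f : hom a b) (g : hom c d),
    mddag _ _ (f ⊠ g) = mddag _ _ f ⊠ mddag _ _ g;
  asc_unitary : forall a b c, unitary mddag (asc a b c);
  lun_unitary : forall a, unitary mddag (lun a);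
  run_unitary : forall a, unitary mddag (run a)
}.

Notation "f ^†" := (mddag _ _ _ f) (at level 3, left associativity, format "f ^†") : cat_scope.

Definition is_dual (V : monoidal_category) (v d : V)
    (ev : hom (v ⊗ d) one) (coev : hom one (d ⊗ v)) : Prop :=
  (run v)^-1 ;; (idm v ⊠ coev) ;; (asc v d v)^-1 ;; (ev ⊠ idm v) ;; lun v = idm v /\
  (lun d)^-1 ;; (coev ⊠ idm d) ;; asc d v d ;; (idm d ⊠ ev) ;; run d = idm d.

(* The second clause: every object is isomorphic to a dual. *)
Definition rigid (V : monoidal_category) : Prop :=
  (forall v : V, exists d ev coev, is_dual (v := v) (d := d) ev coev) /\
  (forall d : V, exists v d' ev coev,
     is_dual (v := v) (d := d') ev coev /\ isomorphic d' d).

Record dual_choice (V : monoidal_category) := DualChoice {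
  dual :> V -> V;
  ev : forall v, hom (v ⊗ dual v) one;
  coev : forall v, hom one (dual v ⊗ v);
  dualP : forall v, is_dual (ev v) (coev v)
}.

(* [(coev_u id) ;; (id f id) ;; (id ev_v) : v^* -> u^*] for [f : u -> v] *)
Definition dualm (V : monoidal_category) (D : dual_choice V) (u v : V) (f : hom u v) :
    hom (D v) (D u) :=
  (lun (D v))^-1 ;; (coev D u ⊠ idm (D v)) ;; (idm (D u) ⊠ f ⊠ idm (D v)) ;;
  asc (D u) v (D v) ;; (idm (D u) ⊠ ev D v) ;; run (D u).

(* [(coev_{vu} id) ;; (id ev_u id) ;; (id ev_v) : u^* v^* -> (vu)^*], where both
   evaluations are performed under [id_{(vu)^*}]. *)
Definition dual_nu (V : monoidal_category) (D : dual_choice V) (u v : V) :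
    hom (D u ⊗ D v) (D (v ⊗ u)) :=
  (lun (D u ⊗ D v))^-1 ;; (coev D (v ⊗ u) ⊠ idm (D u ⊗ D v)) ;;
  asc (D (v ⊗ u)) (v ⊗ u) (D u ⊗ D v) ;;
  (idm (D (v ⊗ u)) ⊠
    (asc v u (D u ⊗ D v) ;;
     (idm v ⊠ ((asc u (D u) (D v))^-1 ;; (ev D u ⊠ idm (D v)) ;; lun (D v))) ;;
     ev D v)) ;;
  run (D (v ⊗ u)).

Record unitary_monoidal_category := UnitaryMonoidalCategory {
  umc :> monoidal_dagger_category;
  umc_rigid : rigid umc;
  umc_dual : dual_choice umc;
  umc_dual_dag : forall (u v : umc) (f : hom u v),
    (dualm umc_dual f)^† = dualm umc_dual (f^†);
  umc_nu_unitary : forall u v : umc, unitary (mddag umc) (dual_nu umc_dual u v)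
}.

Section Conjugation.
Context (U : unitary_monoidal_category).
Implicit Types u v : U.

Definition conj u : U := umc_dual U u.
Definition conjm u v (f : hom u v) : hom (conj u) (conj v) := dualm (umc_dual U) (f^†).
Definition uev u : hom (u ⊗ conj u) one := ev (umc_dual U) u.
Definition ucoev u : hom one (conj u ⊗ u) := coev (umc_dual U) u.
Definition conj_r : hom one (conj one) := ucoev one ;; run (conj one).
Definition nu u v : hom (conj u ⊗ conj v) (conj (v ⊗ u)) := dual_nu (umc_dual U) u v.
(* the inverse of [nu u v], by unitarity *)
Definition nuV u v : hom (conj (v ⊗ u)) (conj u ⊗ conj v) := (nu u v)^†.

Definition phi u : hom u (conj (conj u)) :=
  (run u)^-1 ;; (idm u ⊠ (uev (conj u))^†) ;; (asc u (conj u) (conj (conj u)))^-1 ;;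
  (uev u ⊠ idm (conj (conj u))) ;; lun (conj (conj u)).

(* the inverse of [phi u], see [phiK] and [phiVK] *)
Definition phiV u : hom (conj (conj u)) u :=
  (run (conj (conj u)))^-1 ;; (idm (conj (conj u)) ⊠ ucoev u) ;;
  (asc (conj (conj u)) (conj u) u)^-1 ;; ((ucoev (conj u))^† ⊠ idm u) ;; lun u.
End Conjugation.

Section DualLemmas.
Context (V : monoidal_category).
Implicit Types u v w d x y : V.

Definition evc v d (e : hom (v ⊗ d) one) y : hom (v ⊗ (d ⊗ y)) y :=
  (asc v d y)^-1 ;; (e ⊠ idm y) ;; lun y.

Definition cur v d (c : hom one (d ⊗ v)) y z (k : hom (v ⊗ y) z) : hom y (d ⊗ z) :=
  (lun y)^-1 ;; (c ⊠ idm y) ;; asc d v y ;; (idm d ⊠ k).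

Lemma evc_nat v d (e : hom (v ⊗ d) one) y z (f : hom y z) :
  (idm v ⊠ (idm d ⊠ f)) ;; evc e z = evc e y ;; f.
Proof.
rewrite /evc !compA ascV_nat tensm1 -!compA; congr (_ ;; _).
by rewrite compA tens_rl -lun_nat compA tens_lr.
Qed.

Lemma evc_tens v d (e : hom (v ⊗ d) one) y z :
  asc v (d ⊗ y) z ;; (idm v ⊠ asc d y z) ;; evc e (y ⊗ z) = evc e y ⊠ idm z.
Proof.
apply: (iso_epi (i := tens_iso (asc v d y) (idiso z))) => /=.
rewrite -tensMr /evc !compA isoK comp1m pentagon compK tensMr -asc_lun compA.
by rewrite asc_nat tensm1.
Qed.

Lemma zigzag1 v d (e : hom (v ⊗ d) one) c : is_dual e c ->
  (idm v ⊠ c) ;; evc e v = run v.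
Proof.
case=> H _; apply: (iso_epi (i := iso_sym (run v))) => /=.
by rewrite isoVK -[RHS]H /evc !compA.
Qed.

Lemma zigzag2 v d (e : hom (v ⊗ d) one) c y : is_dual e c ->
  (c ⊠ idm (d ⊗ y)) ;; asc d v (d ⊗ y) ;; (idm d ⊠ evc e y) = lun (d ⊗ y).
Proof.
case=> _ H.
have {}H : (c ⊠ idm d) ;; asc d v d ;; (idm d ⊠ e) ;; run d = lun d.
  by apply: (iso_epi (i := iso_sym (lun d))); rewrite /= isoVK -[RHS]H !compA.
apply: (iso_epi (i := asc one d y)).
rewrite asc_lun -H !tensMr !compA -tensm1 -asc_nat.
rewrite -[_ ;; asc (d ⊗ v) d y ;; _]compA -pentagon /evc -!compA; congr (_ ;; _).
congr (_ ;; _); rewrite -tensMl !compA isoK comp1m tensMl compA -asc_nat.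
by rewrite -compA triangle.
Qed.

Lemma curK v d (e : hom (v ⊗ d) one) c y z (k : hom (v ⊗ y) z) : is_dual e c ->
  (idm v ⊠ cur c k) ;; evc e z = k.
Proof.
move=> D.
have A : (idm v ⊠ asc d v y) ;; evc e (v ⊗ y) = (asc v (d ⊗ v) y)^-1 ;; (evc e v ⊠ idm y).
  by apply: (iso_epi (i := asc v (d ⊗ v) y)); rewrite compKl compA evc_tens.
rewrite /cur tensMl -compA evc_nat compA -[RHS]comp1m; congr (_ ;; _).
rewrite !tensMl -compA A compA -[_ ;; _ ;; _^-1]compA ascV_nat.
rewrite -!compA -tensMr (zigzag1 D) -triangle compVKl -tensMl isoVK.
exact: tensm1.
Qed.

Lemma uncurK v d (e : hom (v ⊗ d) one) c y z (h : hom y (d ⊗ z)) : is_dual e c ->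
  cur c ((idm v ⊠ h) ;; evc e z) = h.
Proof.
move=> D.
have A : (c ⊠ idm y) ;; asc d v y ;; (idm d ⊠ (idm v ⊠ h)) =
    (idm one ⊠ h) ;; ((c ⊠ idm (d ⊗ z)) ;; asc d v (d ⊗ z)).
  by rewrite -compA -asc_nat tensm1 !compA tens_lr tens_rl.
rewrite /cur tensMl compA -[_ ;; asc d v y]compA -[_ ;; (idm d ⊠ (idm v ⊠ h))]compA A.
by rewrite [(lun y)^-1 ;; _]compA lunV_nat -!compA [(c ⊠ _) ;; _]compA (zigzag2 _ D) isoVK compm1.
Qed.

Lemma evc_one v d (e : hom (v ⊗ d) one) : (idm v ⊠ (run d)^-1) ;; evc e one = e.
Proof.
apply: (iso_epi (i := tens_iso (idiso v) (run d))) => /=.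
rewrite compA -tensMl isoK tensm1 comp1m.
apply: (iso_epi (i := asc v d one)).
by rewrite /evc !compA isoK comp1m asc_run lun_one run_nat.
Qed.

Lemma evc_run v d (e : hom (v ⊗ d) one) : (idm v ⊠ run d) ;; e = evc e one.
Proof. by rewrite -[X in _ ;; X]evc_one compA -tensMl isoK tensm1 comp1m. Qed.

Lemma uncur_inj v d (e : hom (v ⊗ d) one) c y z (h h' : hom y (d ⊗ z)) : is_dual e c ->
  (idm v ⊠ h) ;; evc e z = (idm v ⊠ h') ;; evc e z -> h = h'.
Proof. by move=> D E; rewrite -(uncurK h D) E uncurK. Qed.

Lemma dual_inj v d (e : hom (v ⊗ d) one) c x (h h' : hom x d) : is_dual e c ->
  (idm v ⊠ h) ;; e = (idm v ⊠ h') ;; e -> h = h'.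
Proof.
move=> D E; apply: (iso_mono (i := iso_sym (run d))) => /=.
by apply: (uncur_inj D); rewrite !tensMl -!compA evc_one.
Qed.

Lemma predual_inj v d (e : hom (v ⊗ d) one) c x (k k' : hom x v) : is_dual e c ->
  (k ⊠ idm d) ;; e = (k' ⊠ idm d) ;; e -> k = k'.
Proof.
move=> D.
have H (l : hom x v) : l = (run x)^-1 ;; (idm x ⊠ c) ;; (asc x d v)^-1 ;;
    (((l ⊠ idm d) ;; e) ⊠ idm v) ;; lun v.
  rewrite tensMr compA -[_ ;; (asc x d v)^-1 ;; _]compA -ascV_nat tensm1.
  rewrite compA -[_ ;; (l ⊠ _)]compA tens_rl -tens_lr compA runV_nat -!compA.
  by rewrite -[LHS]compm1 -{1}(proj1 D) !compA.
by move=> E; rewrite (H k) E -H.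
Qed.

Lemma dualm_spec (D : dual_choice V) u v (f : hom u v) :
  (idm u ⊠ dualm D f) ;; ev D u = (f ⊠ idm (D v)) ;; ev D v.
Proof.
have -> : dualm D f = cur (coev D u) ((f ⊠ idm (D v)) ;; ev D v) ;; run (D u).
  rewrite /dualm /cur tensMl !compA -[in RHS](compA _ (asc _ _ _)) -asc_nat.
  by rewrite !compA.
by rewrite tensMl -compA evc_run (curK _ (dualP D u)).
Qed.

Lemma dualm1 (D : dual_choice V) u : dualm D (idm u) = idm (D u).
Proof. by apply: (dual_inj (dualP D u)); rewrite dualm_spec. Qed.

Lemma dualmM (D : dual_choice V) u v w (f : hom u v) (g : hom v w) :
  dualm D (f ;; g) = dualm D g ;; dualm D f.
Proof.
apply: (dual_inj (dualP D u)).
rewrite dualm_spec tensMr tensMl -!compA dualm_spec -dualm_spec !compA.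
by rewrite tens_lr tens_rl.
Qed.

Definition predual_map v d (e : hom (v ⊗ d) one) v' (c' : hom one (d ⊗ v')) : hom v v' :=
  (run v)^-1 ;; (idm v ⊠ c') ;; evc e v'.

Lemma predual_map_spec v d (e : hom (v ⊗ d) one) v' (e' : hom (v' ⊗ d) one) c' :
  is_dual e' c' -> (predual_map e c' ⊠ idm d) ;; e' = e.
Proof.
move=> D.
have H : (c' ⊠ idm d) ;; asc d v' d ;; (idm d ⊠ e') = lun d ;; (run d)^-1.
  by apply: (iso_mono (i := run d)); apply: (iso_epi (i := iso_sym (lun d)));
    case: D => _ D; rewrite compVK /= isoVK -[RHS]D !compA.
rewrite /predual_map; move: (evc_tens e v' d) (evc_nat e e') (evc_one e).
move: (evc e v') (evc e (v' ⊗ d)) (evc e one) => E1 E2 E3 ET EN EO.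
rewrite 2!tensMr -ET -!compA -EN.
rewrite [(idm v ⊠ c' ⊠ _) ;; _]compA asc_nat -!compA.
rewrite [(idm v ⊠ asc _ _ _) ;; _]compA -tensMl.
rewrite [_ ;; (_ ;; E3)]compA -tensMl [(c' ⊠ _) ;; _]compA H tensMl.
rewrite -!compA EO [asc _ _ _ ;; _]compA triangle.
by rewrite compA -tensMr isoVK tensm1 comp1m.
Qed.

Lemma predual_mapK v d (e : hom (v ⊗ d) one) c v' (e' : hom (v' ⊗ d) one) c' :
  is_dual e c -> is_dual e' c' -> predual_map e c' ;; predual_map e' c = idm v.
Proof.
move=> D D'; apply: (predual_inj D).
by rewrite tensMr -compA !predual_map_spec // tensm1 comp1m.
Qed.
End DualLemmas.

Lemma unitary_dag (C : category) (dg : dagger C) (a b : C) (i : iso a b) :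
  unitary dg i -> dg _ _ i = i^-1.
Proof. by case=> H _; rewrite -[LHS](compVKl i) H compm1. Qed.

Section ConjugationLemmas.
Context (U : unitary_monoidal_category).
Implicit Types u v w : U.

Lemma conjm1 u : conjm (idm u) = idm (conj u).
Proof. by rewrite /conjm dag_idm dualm1. Qed.

Lemma conjmM u v w (f : hom u v) (g : hom v w) : conjm (f ;; g) = conjm f ;; conjm g.
Proof. by rewrite /conjm dag_comp dualmM. Qed.

Lemma dag_iso u v (i : iso u v) : unitary (mddag U) i -> (i^-1)^† = i.
Proof. by move=> /unitary_dag <-; rewrite dagK. Qed.

Lemma is_dual_dag u v (e : hom (u ⊗ v) one) c :
  is_dual e c -> is_dual (V := U) (v := v) (d := u) c^† e^†.
Proof.
move=> [H1 H2]; split.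
- move: (f_equal (mddag U _ _) H2).
  rewrite !dag_comp !mddag_tens !dag_idm (unitary_dag (run_unitary _)).
  by rewrite (unitary_dag (asc_unitary _ _ _)) (dag_iso (lun_unitary _)) !compA.
- move: (f_equal (mddag U _ _) H1).
  rewrite !dag_comp !mddag_tens !dag_idm (unitary_dag (lun_unitary _)).
  by rewrite (dag_iso (asc_unitary _ _ _)) (dag_iso (run_unitary _)) !compA.
Qed.

Lemma phiE u : phi u = predual_map (uev u) (uev (conj u))^†.
Proof. by rewrite /phi /predual_map /evc !compA. Qed.

Lemma phiVE u : phiV u = predual_map (ucoev (conj u))^† (ucoev u).
Proof. by rewrite /phiV /predual_map /evc !compA. Qed.

Lemma phiK u : phi u ;; phiV u = idm u.
Proof.
rewrite phiE phiVE; apply: predual_mapK; first exact: dualP.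
apply: is_dual_dag; exact: dualP.
Qed.

Lemma phiVK u : phiV u ;; phi u = idm (conj (conj u)).
Proof.
rewrite phiE phiVE; apply: predual_mapK; last exact: dualP.
apply: is_dual_dag; exact: dualP.
Qed.
End ConjugationLemmas.

(* [ucategory V], [ufunctor] and [unat] are [V]-categories, [V]-functors and [V]-natural
   transformations. *)
Record ucategory (V : monoidal_category) := UCategory {
  uob :> Type;
  uhom : uob -> uob -> V;
  uid : forall a, hom one (uhom a a);
  ucomp : forall a b c, hom (uhom a b ⊗ uhom b c) (uhom a c);
  ucomp_1l : forall a b, (uid a ⊠ idm (uhom a b)) ;; ucomp a a b = lun (uhom a b);
  ucomp_1r : forall a b, (idm (uhom a b) ⊠ uid b) ;; ucomp a b b = run (uhom a b);
  ucompA : forall a b c d,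
    (ucomp a b c ⊠ idm (uhom c d)) ;; ucomp a c d
    = asc (uhom a b) (uhom b c) (uhom c d) ;; (idm (uhom a b) ⊠ ucomp b c d) ;;
      ucomp a b d
}.

Arguments uid {V u} a : rename.
Arguments ucomp {V u} a b c : rename.

Record ufunctor (V : monoidal_category) (A B : ucategory V) := UFunctor {
  ufob :> A -> B;
  ufhom : forall a b, hom (uhom a b) (uhom (ufob a) (ufob b));
  ufhom_id : forall a, uid a ;; ufhom a a = uid (ufob a);
  ufhom_comp : forall a b c,
    ucomp a b c ;; ufhom a c
    = (ufhom a b ⊠ ufhom b c) ;; ucomp (ufob a) (ufob b) (ufob c)
}.

Arguments ufhom {V A B} F a b : rename.

Record unat (V : monoidal_category) (A B : ucategory V) (F G : ufunctor A B) := UNat {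
  ucpt :> forall a, hom one (uhom (F a) (G a));
  unat_nat : forall a b,
    (lun (uhom a b))^-1 ;; (ucpt a ⊠ ufhom G a b) ;; ucomp (F a) (G a) (G b)
    = (run (uhom a b))^-1 ;; (ufhom F a b ⊠ ucpt b) ;; ucomp (F a) (F b) (G b)
}.

Section Underlying.
Context (V : monoidal_category).

Definition upre (A : ucategory V) (a b c : A) (f : hom one (uhom a b)) :
    hom (uhom b c) (uhom a c) :=
  (lun (uhom b c))^-1 ;; (f ⊠ idm (uhom b c)) ;; ucomp a b c.

Definition upost (A : ucategory V) (a b c : A) (g : hom one (uhom b c)) :
    hom (uhom a b) (uhom a c) :=
  (run (uhom a b))^-1 ;; (idm (uhom a b) ⊠ g) ;; ucomp a b c.

Definition ucompose (A : ucategory V) (a b c : A)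
    (f : hom one (uhom a b)) (g : hom one (uhom b c)) : hom one (uhom a c) :=
  (lun one)^-1 ;; (f ⊠ g) ;; ucomp a b c.

Lemma ucompose_pre (A : ucategory V) (a b c : A)
    (f : hom one (uhom a b)) (g : hom one (uhom b c)) : ucompose f g = g ;; upre c f.
Proof. by rewrite /ucompose /upre !compA -lunV_nat -[_ ;; (f ⊠ idm _)]compA tens_rl. Qed.

Lemma ucompose_post (A : ucategory V) (a b c : A)
    (f : hom one (uhom a b)) (g : hom one (uhom b c)) : ucompose f g = f ;; upost a g.
Proof. by rewrite /ucompose /upost !compA lunV_one -runV_nat -[_ ;; (idm _ ⊠ g)]compA tens_lr. Qed.

Lemma runV_asc (a b : V) : (run (a ⊗ b))^-1 ;; asc a b one = idm a ⊠ (run b)^-1.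
Proof.
apply: (iso_epi (i := run (a ⊗ b))); rewrite compKl -asc_run -compA -tensMl.
by rewrite isoK tensm1 compm1.
Qed.

Lemma lunV_asc (a b : V) : (lun (a ⊗ b))^-1 ;; (asc one a b)^-1 = (lun a)^-1 ⊠ idm b.
Proof.
apply: (iso_mono (i := tens_iso (lun a) (idiso b))) => /=.
by rewrite -tensMr isoVK tensm1 -asc_lun compA compVK isoVK.
Qed.

Lemma upost_comp (A : ucategory V) (a b c d : A)
    (g : hom one (uhom b c)) (h : hom one (uhom c d)) :
  upost a g ;; upost a h = upost a (ucompose g h).
Proof.
rewrite ucompose_post /upost -!compA; congr (_ ;; _).
rewrite [ucomp a b c ;; _]compA -runV_nat -!compA.
rewrite [(ucomp a b c ⊠ _) ;; _]compA tens_lr -(tens_rl (ucomp a b c) h) -!compA ucompA.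
rewrite [(idm _ ⊠ h) ;; _]compA [(idm _ ⊠ h) ;; _]compA.
rewrite -(tensm1 (uhom a b)) asc_nat -!compA.
rewrite [(run _)^-1 ;; _]compA runV_asc.
by rewrite !compA -!tensMl.
Qed.

Lemma upre_comp (A : ucategory V) (a b c d : A)
    (f : hom one (uhom a b)) (g : hom one (uhom b c)) :
  upre d g ;; upre d f = upre d (ucompose f g).
Proof.
rewrite ucompose_pre /upre -!compA; congr (_ ;; _).
rewrite [ucomp b c d ;; _]compA -lunV_nat -!compA.
rewrite [(_ ⊠ ucomp b c d) ;; _]compA tens_rl -(tens_lr f (ucomp b c d)) -!compA.
have -> : (idm (uhom a b) ⊠ ucomp b c d) ;; ucomp a b d =
    (asc _ _ _)^-1 ;; ((ucomp a b c ⊠ idm (uhom c d)) ;; ucomp a c d).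
  by rewrite ucompA -compA compVKl.
rewrite [(f ⊠ _) ;; _]compA -(tensm1 (uhom b c)) ascV_nat -!compA.
rewrite [(lun _)^-1 ;; _]compA lunV_asc.
by rewrite !compA -!tensMr.
Qed.

Lemma upre_post (A : ucategory V) (a b c d : A)
    (f : hom one (uhom a b)) (h : hom one (uhom c d)) :
  upre c f ;; upost a h = upost b h ;; upre d f.
Proof.
rewrite /upre /upost -!compA.
rewrite [ucomp a b c ;; _]compA -runV_nat -!compA.
rewrite [(ucomp a b c ⊠ _) ;; _]compA tens_lr -(tens_rl (ucomp a b c) h) -!compA ucompA.
rewrite [(idm _ ⊠ h) ;; _]compA [(idm _ ⊠ h) ;; _]compA.
rewrite -(tensm1 (uhom a b)) asc_nat -!compA.
rewrite [(run _)^-1 ;; _]compA runV_asc.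
rewrite [ucomp b c d ;; _]compA -lunV_nat -!compA.
rewrite [(idm one ⊠ ucomp b c d) ;; _]compA tens_rl -(tens_lr f (ucomp b c d)) -!compA.
rewrite [(idm _ ⊠ (run _)^-1) ;; _]compA -tensMl [(f ⊠ idm (uhom b c)) ;; _]compA.
by rewrite tens_lr -tens_rl !compA lunV_nat.
Qed.

Lemma upost_id (A : ucategory V) (a b : A) : upost a (uid b) = idm (uhom a b).
Proof. by rewrite /upost -compA ucomp_1r isoVK. Qed.

Lemma upre_id (A : ucategory V) (a b : A) : upre b (uid a) = idm (uhom a b).
Proof. by rewrite /upre -compA ucomp_1l isoVK. Qed.

Lemma ucomposeA (A : ucategory V) (a b c d : A) (f : hom one (uhom a b))
    (g : hom one (uhom b c)) (h : hom one (uhom c d)) :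
  ucompose f (ucompose g h) = ucompose (ucompose f g) h.
Proof. by rewrite !ucompose_post -compA upost_comp ucompose_post. Qed.

Lemma ucompose1l (A : ucategory V) (a b : A) (f : hom one (uhom a b)) :
  ucompose (uid a) f = f.
Proof. by rewrite ucompose_pre upre_id compm1. Qed.

Lemma ucompose1r (A : ucategory V) (a b : A) (f : hom one (uhom a b)) :
  ucompose f (uid b) = f.
Proof. by rewrite ucompose_post upost_id compm1. Qed.

Definition underlying (A : ucategory V) : category :=
  @Category A (fun a b => hom one (uhom a b)) uid (@ucompose A)
    (@ucompose1l A) (@ucompose1r A) (@ucomposeA A).

Lemma upost_fun (A B : ucategory V) (F : ufunctor A B) (a b c : A)
    (g : hom one (uhom b c)) :
  upost a g ;; ufhom F a c = ufhom F a b ;; upost (F a) (g ;; ufhom F b c).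
Proof.
rewrite /upost -compA ufhom_comp compA [in RHS]compA [in RHS]compA -runV_nat.
by rewrite -!compA ![_ ;; (_ ;; ucomp _ _ _)]compA -!tensmM comp1m compm1 comp1m.
Qed.

Lemma upre_fun (A B : ucategory V) (F : ufunctor A B) (a b c : A)
    (f : hom one (uhom a b)) :
  upre c f ;; ufhom F a c = ufhom F b c ;; upre (F c) (f ;; ufhom F a b).
Proof.
rewrite /upre -compA ufhom_comp compA [in RHS]compA [in RHS]compA -lunV_nat.
by rewrite -!compA ![_ ;; (_ ;; ucomp _ _ _)]compA -!tensmM comp1m compm1 comp1m.
Qed.

Lemma ucompose_fun (A B : ucategory V) (F : ufunctor A B) (a b c : A)
    (f : hom one (uhom a b)) (g : hom one (uhom b c)) :
  ucompose f g ;; ufhom F a c = ucompose (f ;; ufhom F a b) (g ;; ufhom F b c).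
Proof. by rewrite !ucompose_post -compA upost_fun compA. Qed.

End Underlying.

Section UCat2.
Context (V : monoidal_category).
Implicit Types A B C D : ucategory V.

Lemma unatE A B (F G : ufunctor A B) (t : forall a, hom one (uhom (F a) (G a))) a b :
  (lun (uhom a b))^-1 ;; (t a ⊠ ufhom G a b) ;; ucomp (F a) (G a) (G b)
    = (run (uhom a b))^-1 ;; (ufhom F a b ⊠ t b) ;; ucomp (F a) (F b) (G b) <->
  ufhom G a b ;; upre (G b) (t a) = ufhom F a b ;; upost (F a) (t b).
Proof.
rewrite /upre /upost !compA -lunV_nat -runV_nat.
by rewrite -[_ ;; (t a ⊠ idm _)]compA -[_ ;; (idm _ ⊠ t b)]compA tens_rl tens_lr.
Qed.

Lemma unat_post A B (F G : ufunctor A B) (t : unat F G) a b :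
  ufhom G a b ;; upre (G b) (t a) = ufhom F a b ;; upost (F a) (t b).
Proof. by apply/(unatE t a b); apply: unat_nat. Qed.

Lemma unat_square A B (F G : ufunctor A B) (t : unat F G) a b (f : hom one (uhom a b)) :
  ucompose (f ;; ufhom F a b) (t b) = ucompose (t a) (f ;; ufhom G a b).
Proof. by rewrite ucompose_post ucompose_pre -!(compA f) unat_post. Qed.

Lemma unat_ext A B (F G : ufunctor A B) (s t : unat F G) : (forall a, s a = t a) -> s = t.
Proof.
case: s t => [s Hs] [t Ht] /= e.
have {}e : s = t by apply: functional_extensionality_dep.
by case: t / e Ht => Ht; rewrite (proof_irrelevance _ Hs Ht).
Qed.

Definition unat_id A B (F : ufunctor A B) : unat F F.
Proof.
refine (@UNat V A B F F (fun a => uid (F a)) _).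
by move=> a b; apply/(unatE (F := F) (G := F) (fun a => uid (F a))); rewrite upre_id upost_id.
Defined.

Definition unat_comp A B (F G H : ufunctor A B) (s : unat F G) (t : unat G H) : unat F H.
Proof.
refine (@UNat V A B F H (fun a => ucompose (s a) (t a)) _).
move=> a b; apply/(unatE (F := F) (G := H) (fun a => ucompose (s a) (t a))).
by rewrite -upre_comp compA unat_post -compA -upre_post compA unat_post -compA upost_comp.
Defined.

Definition ufun_cat A B : category.
Proof.
refine (@Category (ufunctor A B) (@unat V A B) (@unat_id A B) (@unat_comp A B) _ _ _).
- by move=> F G t; apply: unat_ext => a; apply: (@ucompose1l V B).
- by move=> F G t; apply: unat_ext => a; apply: (@ucompose1r V B).
- by move=> F G H K r s t; apply: unat_ext => a; apply: (@ucomposeA V B).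
Defined.

Definition ufunctor_id A : ufunctor A A.
Proof.
refine (@UFunctor V A A (fun a => a) (fun a b => idm (uhom a b)) _ _).
- by move=> a; rewrite compm1.
- by move=> a b c; rewrite compm1 tensm1 comp1m.
Defined.

Definition ufunctor_comp A B C (F : ufunctor A B) (G : ufunctor B C) : ufunctor A C.
Proof.
refine (@UFunctor V A C (fun a => G (F a)) (fun a b => ufhom F a b ;; ufhom G _ _) _ _).
- by move=> a; rewrite compA !ufhom_id.
- by move=> a b c; rewrite compA ufhom_comp -compA ufhom_comp compA tensmM.
Defined.

Definition unat_hcomp A B C (F F' : ufunctor A B) (G G' : ufunctor B C)
    (s : unat F F') (t : unat G G') : unat (ufunctor_comp F G) (ufunctor_comp F' G').
Proof.
refine (@UNat V A C (ufunctor_comp F G) (ufunctor_comp F' G')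
  (fun a => ucompose (s a ;; ufhom G (F a) (F' a)) (t (F' a))) _).
move=> a b.
apply/(unatE (F := ufunctor_comp F G) (G := ufunctor_comp F' G')
  (fun a => ucompose (s a ;; ufhom G (F a) (F' a)) (t (F' a)))) => /=.
rewrite -upre_comp compA -[ufhom F' a b ;; _ ;; _]compA unat_post.
rewrite -[LHS]compA -[_ ;; _ ;; upre _ _]compA -upre_post.
rewrite [ufhom G _ _ ;; _]compA -upre_fun.
rewrite [ufhom F' a b ;; _]compA [ufhom F' a b ;; _]compA unat_post.
rewrite -[_ ;; _ ;; ufhom G _ _]compA upost_fun -upost_comp.
by rewrite [ufhom F a b ;; _]compA -compA.
Defined.

Definition ucomp2 A B C : functor (prod_cat (ufun_cat A B) (ufun_cat B C)) (ufun_cat A C).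
Proof.
refine (@Functor (prod_cat (ufun_cat A B) (ufun_cat B C)) (ufun_cat A C)
  (fun FG => ufunctor_comp (fst FG) (snd FG))
  (fun FG FG' st => unat_hcomp (fst st) (snd st)) _ _).
- move=> [F G]; apply: unat_ext => a /=.
  by rewrite ufhom_id; apply: (@ucompose1l V C).
- move=> [F G] [F' G'] [F'' G''] [s t] [s' t']; apply: unat_ext => a /=.
  rewrite ucompose_fun -!ucomposeA; congr (ucompose _ _).
  by rewrite !ucomposeA unat_square.
Defined.

Lemma ufunctor_ext A B (F G : ufunctor A B) (E : forall a, F a = G a) :
  (forall a b, ufhom F a b =
     match eq_sym (E a) in _ = x, eq_sym (E b) in _ = y
     return hom (uhom a b) (uhom x y) with eq_refl, eq_refl => ufhom G a b end) ->
  F = G.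
Proof.
case: F E => Fo Fm F1 FM; case: G => Go Gm G1 GM /= E H.
have e : Fo = Go by apply: functional_extensionality.
case: Go / e Gm G1 GM E H => Gm G1 GM E H.
have e : Fm = Gm.
  extensionality a; extensionality b; rewrite H.
  by rewrite (proof_irrelevance _ (E a) eq_refl) (proof_irrelevance _ (E b) eq_refl).
case: Gm / e G1 GM H => G1 GM _.
by rewrite (proof_irrelevance _ F1 G1) (proof_irrelevance _ FM GM).
Qed.

Lemma hcast_unat A B (F F' G G' : ufunctor A B) (e : F = F') (e' : G = G')
    (t : unat F G) a :
  (hcast (C := ufun_cat A B) e e' t : unat F' G') a =
  hcast (C := underlying B) (f_equal (fun K : ufunctor A B => K a) e)
    (f_equal (fun K : ufunctor A B => K a) e') (t a).
Proof. by case: F' / e; case: G' / e'. Qed.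

Lemma ufunctor_comp1l A B (F : ufunctor A B) : ufunctor_comp (ufunctor_id A) F = F.
Proof.
unshelve eapply ufunctor_ext; first by [].
by move=> a b /=; rewrite comp1m.
Qed.

Lemma ufunctor_comp1r A B (F : ufunctor A B) : ufunctor_comp F (ufunctor_id B) = F.
Proof.
unshelve eapply ufunctor_ext; first by [].
by move=> a b /=; rewrite compm1.
Qed.

Lemma ufunctor_compA A B C D (F : ufunctor A B) (G : ufunctor B C) (H : ufunctor C D) :
  ufunctor_comp (ufunctor_comp F G) H = ufunctor_comp F (ufunctor_comp G H).
Proof.
unshelve eapply ufunctor_ext; first by [].
by move=> a b /=; rewrite compA.
Qed.

Definition ucat2 : strict2cat.
Proof.
refine (@Strict2Cat (ucategory V) ufun_cat ufunctor_id ucomp2 _ _ _).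
- move=> A B; unshelve eapply functor_ext; first exact: ufunctor_comp1l.
  move=> F G t; apply: unat_ext => a; rewrite hcast_unat.
  etransitivity; first exact: (@hcast_id (underlying B) (F a) (G a)).
  by rewrite /= ufhom_id; apply: ucompose1l.
- move=> A B; unshelve eapply functor_ext; first exact: ufunctor_comp1r.
  move=> F G t; apply: unat_ext => a; rewrite hcast_unat.
  etransitivity; first exact: (@hcast_id (underlying B) (F a) (G a)).
  by rewrite /= compm1; apply: ucompose1r.
- move=> A B C D; unshelve eapply functor_ext.
    by move=> [[F G] H]; apply: ufunctor_compA.
  move=> [[F G] H] [[F' G'] H'] [[r s] t]; apply: unat_ext => a; rewrite hcast_unat.
  etransitivity; first exact: (@hcast_id (underlying D) (H (G (F a))) (H' (G' (F' a)))).
  by rewrite /= ucompose_fun -!ucomposeA compA.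
Defined.
End UCat2.

Section SelfEnrichment.
Context (V : monoidal_category) (D : dual_choice V).

(* [id_{u^*} ev_v id_w] *)
Definition self_comp (u v w : V) : hom ((D u ⊗ v) ⊗ (D v ⊗ w)) (D u ⊗ w) :=
  asc (D u) v (D v ⊗ w) ;;
  (idm (D u) ⊠ ((asc v (D v) w)^-1 ;; (ev D v ⊠ idm w) ;; lun w)).

Lemma self_compE u v w :
  self_comp u v w = asc (D u) v (D v ⊗ w) ;; (idm (D u) ⊠ evc (ev D v) w).
Proof. by []. Qed.

Lemma self_compA u v w x :
  (self_comp u v w ⊠ idm (D w ⊗ x)) ;; self_comp u w x =
  asc (D u ⊗ v) (D v ⊗ w) (D w ⊗ x) ;; (idm (D u ⊗ v) ⊠ self_comp v w x) ;;
  self_comp u v x.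
Proof.
rewrite !self_compE tensMr tensMl !compA.
have := evc_tens (ev D v) w (D w ⊗ x); have := evc_nat (ev D v) (evc (ev D w) x).
move: (evc (ev D v)) (evc (ev D w)) => E E' EN ET.
rewrite -[_ ;; _ ;; asc (D u) w _]compA asc_nat compA -[_ ;; _ ;; (idm _ ⊠ E' _)]compA.
rewrite -tensMl -ET -[(_ ;; E _) ;; _]compA -EN.
rewrite -[_ ;; _ ;; asc (D u) v _]compA -(tensm1 (D u) v) asc_nat compA.
rewrite compA -[_ ;; _ ;; asc (D u) v _]compA asc_nat compA -pentagon.
by rewrite !tensMl !compA.
Qed.

Lemma self_comp_1l u v : (coev D u ⊠ idm (D u ⊗ v)) ;; self_comp u u v = lun (D u ⊗ v).
Proof. by rewrite self_compE compA (zigzag2 _ (dualP D u)). Qed.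

Lemma self_comp_1r u v : (idm (D u ⊗ v) ⊠ coev D v) ;; self_comp u v v = run (D u ⊗ v).
Proof.
rewrite self_compE compA -tensm1 asc_nat -compA -tensMl (zigzag1 (dualP D v)).
exact: asc_run.
Qed.

Definition self_enrichment : ucategory V :=
  @UCategory V V (fun u v => D u ⊗ v) (fun v => coev D v) self_comp
    self_comp_1l self_comp_1r self_compA.

Section Representable.
Context (A : ucategory V) (a : A).

Definition rep_hom (b c : A) : hom (uhom b c) (D (uhom a b) ⊗ uhom a c) :=
  (lun (uhom b c))^-1 ;; (coev D (uhom a b) ⊠ idm (uhom b c)) ;;
  asc (D (uhom a b)) (uhom a b) (uhom b c) ;; (idm (D (uhom a b)) ⊠ ucomp a b c).

Lemma rep_homE b c : rep_hom b c = cur (coev D (uhom a b)) (ucomp a b c).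
Proof. by []. Qed.

Lemma rep_hom_id b : uid b ;; rep_hom b b = coev D (uhom a b).
Proof.
rewrite /rep_hom !compA -lunV_nat -[_ ;; _ ;; (coev D _ ⊠ _)]compA tens_rl -tens_lr.
rewrite -(tensm1 (D _)) -!compA [(_ ⊠ uid b) ;; _]compA asc_nat -!compA -tensMl ucomp_1r.
by rewrite asc_run run_nat compA lunV_one isoVK comp1m.
Qed.

Lemma rep_hom_comp b c d :
  ucomp b c d ;; rep_hom b d
  = (rep_hom b c ⊠ rep_hom c d) ;;
    self_comp (uhom a b) (uhom a c) (uhom a d).
Proof.
apply: (uncur_inj (dualP D (uhom a b))).
rewrite tensMl -compA rep_homE (curK _ (dualP D _)).
have := evc_tens (ev D (uhom a b)) (uhom a c) (D (uhom a c) ⊗ uhom a d).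
have := evc_nat (ev D (uhom a b)) (evc (ev D (uhom a c)) (uhom a d)).
have := curK (ucomp a b c) (dualP D (uhom a b)).
have := curK (ucomp a c d) (dualP D (uhom a c)).
rewrite -!rep_homE self_compE.
move: (evc (ev D (uhom a b))) (evc (ev D (uhom a c))) => E E' H1 H2 EN ET.
apply: (iso_epi (i := asc _ _ _)).
rewrite !compA -ucompA 2!tensMl -!compA [asc (uhom a b) _ _ ;; _]compA -asc_nat EN.
rewrite -!compA ![asc (uhom a b) _ _ ;; _]compA [_ ;; (E _ ;; _)]compA ET.
by rewrite [RHS]compA -tensmM H2 compm1 -(tens_lr (ucomp a b c) (rep_hom c d)) -compA H1.
Qed.

Definition representable : ufunctor A self_enrichment :=
  @UFunctor V A self_enrichment (fun b => uhom a b) rep_hom rep_hom_id rep_hom_comp.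
End Representable.
End SelfEnrichment.

(* The (chosen) left adjoint together with the isomorphisms
   [Psi_{c,d} : B(L c -> d) -> C(c -> R d)]. *)
Record left_uadjoint (V : monoidal_category) (B C : ucategory V) (R : ufunctor B C) :=
  LeftUAdjoint {
    ladj :> ufunctor C B;
    ladj_iso : forall (c : C) (d : B), iso (uhom (ladj c) d) (uhom c (R d));
    ladj_natl : forall (c c' : C) (d : B),
      ucomp c c' (R d) ;; (ladj_iso c d)^-1
      = (ufhom ladj c c' ⊠ (ladj_iso c' d)^-1) ;; ucomp (ladj c) (ladj c') d;
    ladj_natr : forall (c : C) (d d' : B),
      ucomp (ladj c) d d' ;; ladj_iso c d'
      = (ladj_iso c d ⊠ ufhom R d d') ;; ucomp c (R d) (R d')
  }.

Definition tensoring (V : monoidal_category) (D : dual_choice V) (A : ucategory V) :=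
  forall a : A, left_uadjoint (representable D a).

Section Mates.
Context (V : monoidal_category) (D : dual_choice V) (A : ucategory V).
Context (T : tensoring D A).

(* The morphism [a <| u -> b] of the underlying category with mate [g]; the factor
   [coev_u ;; (id_{u^*} g)] is [g] as a morphism of the self-enrichment. *)
Definition tensored_mate (a b : A) (u : V) (g : hom u (uhom a b)) :
    hom one (uhom (T a u) b) :=
  coev D u ;; (idm (D u) ⊠ g) ;; (ladj_iso (T a) u b)^-1.

(* [rho_a : a <| 1 -> a] *)
Definition tensored_rho (a : A) : hom one (uhom (T a one) a) := tensored_mate (uid a).
End Mates.

Section DaggerEnriched.
Context (U : unitary_monoidal_category).

Definition self : ucategory U := self_enrichment (umc_dual U).

Definition self_kappa (u v : self) : hom (conj (uhom v u)) (uhom u v) :=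
  nuV u (conj v) ;; (idm (conj u) ⊠ phiV v).

Record weak_dagger_ucategory := WeakDaggerUCategory {
  wdu :> ucategory U;
  kappa : forall a b : wdu, iso (conj (uhom b a)) (uhom a b);
  kappa1 : forall a b : wdu,
    phi (uhom a b) ;; conjm (kappa b a) ;; kappa a b = idm (uhom a b);
  kappa2 : forall a b c : wdu,
    (kappa a b ⊠ kappa b c) ;; ucomp a b c
    = nu (uhom b a) (uhom c b) ;; conjm (ucomp c b a) ;; kappa a c
}.

Definition weak_dag (A : weak_dagger_ucategory) (a b : A)
    (f : hom one (uhom a b)) : hom one (uhom b a) :=
  conj_r U ;; conjm f ;; kappa b a.

Definition preserves_kappa (A B : ucategory U)
    (kA : forall a b : A, hom (conj (uhom b a)) (uhom a b))
    (kB : forall a b : B, hom (conj (uhom b a)) (uhom a b)) (F : ufunctor A B) : Prop :=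
  forall a b : A, kA a b ;; ufhom F a b = conjm (ufhom F b a) ;; kB (F a) (F b).

Definition dagger_ufunctor (A B : weak_dagger_ucategory) (F : ufunctor A B) : Prop :=
  preserves_kappa (fun a b => kappa a b) (fun a b => kappa a b) F.

(* The tensoring is part of the data: the last two axioms are about the chosen left
   adjoints. *)
Record dagger_ucategory := DaggerUCategory {
  du :> weak_dagger_ucategory;
  du_tens : tensoring (umc_dual U) du;
  kappa3 : forall a : du,
    inverse (C := underlying du) (tensored_rho du_tens a)
      (weak_dag (tensored_rho du_tens a));
  kappa4 : forall a : du,
    preserves_kappa (A := self) self_kappa (fun b c => kappa b c) (du_tens a)
}.

Lemma dagger_ufunctor_id (A : weak_dagger_ucategory) :
  dagger_ufunctor (A := A) (B := A) (ufunctor_id A).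
Proof. by move=> a b /=; rewrite conjm1 compm1 comp1m. Qed.

Lemma dagger_ufunctor_comp (A B C : weak_dagger_ucategory)
    (F : ufunctor A B) (G : ufunctor B C) :
  dagger_ufunctor F -> dagger_ufunctor G -> dagger_ufunctor (A := A) (B := C) (ufunctor_comp F G).
Proof. by move=> HF HG a b /=; rewrite conjmM compA HF -compA HG compA. Qed.

Definition dagger_ucat2 : strict2cat :=
  sub2cat (C := ucat2 U) (X := dagger_ucategory) (i := fun A => du A : ucategory U)
    (P := fun A B F => dagger_ufunctor (A := A) (B := B) F)
    (fun A => @dagger_ufunctor_id A)
    (fun A B C F G => @dagger_ufunctor_comp A B C F G).
End DaggerEnriched.

Record module_category (V : monoidal_category) := ModuleCategory {
  modcat :> category;
  act : modcat -> V -> modcat;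
  actm : forall (m n : modcat) (u v : V), hom m n -> hom u v -> hom (act m u) (act n v);
  actm1 : forall m u, actm (idm m) (idm u) = idm (act m u);
  actmM : forall (m n p : modcat) (u v w : V)
      (f : hom m n) (g : hom n p) (h : hom u v) (k : hom v w),
    actm (f ;; g) (h ;; k) = actm f h ;; actm g k;
  act_asc : forall m u v, iso (act m (u ⊗ v)) (act (act m u) v);
  act_run : forall m, iso (act m one) m;
  act_asc_nat : forall (m m' : modcat) (u u' v v' : V)
      (f : hom m m') (g : hom u u') (h : hom v v'),
    actm f (g ⊠ h) ;; act_asc m' u' v' = act_asc m u v ;; actm (actm f g) h;
  act_run_nat : forall (m n : modcat) (f : hom m n),
    actm f (idm one) ;; act_run n = act_run m ;; f;
  act_pentagon : forall m u v w,
    act_asc m (u ⊗ v) w ;; actm (act_asc m u v) (idm w)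
    = actm (idm m) (asc u v w) ;; act_asc m u (v ⊗ w) ;; act_asc (act m u) v w;
  act_triangle : forall m v,
    act_asc m one v ;; actm (act_run m) (idm v) = actm (idm m) (lun v)
}.

Record module_functor (V : monoidal_category) (M N : module_category V) :=
  ModuleFunctor {
    mfun :> functor M N;
    omega : forall (m : M) (u : V), iso (act (mfun m) u) (mfun (act m u));
    omega_nat : forall (m n : M) (u v : V) (f : hom m n) (g : hom u v),
      actm (fmap mfun f) g ;; omega n v = omega m u ;; fmap mfun (actm f g);
    omega_asc : forall (m : M) (u v : V),
      omega m (u ⊗ v) ;; fmap mfun (act_asc m u v)
      = act_asc (mfun m) u v ;; actm (omega m u) (idm v) ;; omega (act m u) v;
    omega_run : forall m : M,
      omega m one ;; fmap mfun (act_run m) = act_run (mfun m)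
  }.

Arguments omega {V M N} F m u : rename.

Record module_nat (V : monoidal_category) (M N : module_category V)
    (F G : module_functor M N) := ModuleNat {
  mcpt :> forall m : M, hom (F m) (G m);
  mcpt_nat : forall (m n : M) (f : hom m n),
    fmap F f ;; mcpt n = mcpt m ;; fmap G f;
  mcpt_act : forall (m : M) (u : V),
    omega F m u ;; mcpt (act m u) = actm (mcpt m) (idm u) ;; omega G m u
}.

Section ModCat2.
Context (V : monoidal_category).
Implicit Types M N P Q : module_category V.

Lemma module_nat_ext M N (F G : module_functor M N) (s t : module_nat F G) :
  (forall m, s m = t m) -> s = t.
Proof.
case: s t => [s Hs Ks] [t Ht Kt] /= e.
have {}e : s = t by apply: functional_extensionality_dep.
case: t / e Ht Kt => Ht Kt.
by rewrite (proof_irrelevance _ Hs Ht) (proof_irrelevance _ Ks Kt).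
Qed.

Definition module_nat_id M N (F : module_functor M N) : module_nat F F.
Proof.
refine (@ModuleNat V M N F F (fun m => idm (F m)) _ _).
- by move=> m n f; rewrite comp1m compm1.
- by move=> m u; rewrite actm1 comp1m compm1.
Defined.

Definition module_nat_comp M N (F G H : module_functor M N)
    (s : module_nat F G) (t : module_nat G H) : module_nat F H.
Proof.
refine (@ModuleNat V M N F H (fun m => s m ;; t m) _ _).
- by move=> m n f; rewrite compA mcpt_nat -compA mcpt_nat compA.
- move=> m u; rewrite compA mcpt_act -compA mcpt_act compA -actmM.
  by rewrite comp1m.
Defined.

Definition modfun_cat M N : category.
Proof.
refine (@Category (module_functor M N) (@module_nat V M N)
  (@module_nat_id M N) (@module_nat_comp M N) _ _ _).
- by move=> F G t; apply: module_nat_ext => m; apply: comp1m.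
- by move=> F G t; apply: module_nat_ext => m; apply: compm1.
- by move=> F G H K r s t; apply: module_nat_ext => m; apply: compA.
Defined.

Definition module_functor_id M : module_functor M M.
Proof.
refine (@ModuleFunctor V M M (functor_id M) (fun m u => idiso (act m u)) _ _ _).
- by move=> m n u v f g /=; rewrite comp1m compm1.
- by move=> m u v /=; rewrite actm1 comp1m !compm1.
- by move=> m /=; rewrite comp1m.
Defined.

Definition module_functor_comp M N P (F : module_functor M N) (G : module_functor N P) :
    module_functor M P.
Proof.
refine (@ModuleFunctor V M P (functor_comp F G)
  (fun m u => iso_trans (omega G (F m) u) (iso_map G (omega F m u))) _ _ _).
- move=> m n u v f g /=.
  by rewrite compA omega_nat -compA -fmapM omega_nat fmapM compA.
- move=> m u v /=.
  rewrite -compA -fmapM omega_asc !fmapM !compA omega_asc.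
  have -> : actm (omega G (F m) u ;; fmap G (omega F m u)) (idm v) =
      actm (omega G (F m) u) (idm v) ;; actm (fmap G (omega F m u)) (idm v).
    by rewrite -actmM comp1m.
  by rewrite -[_ ;; _ ;; fmap G (actm _ _)]compA -omega_nat !compA.
- by move=> m /=; rewrite -compA -fmapM !omega_run.
Defined.

Definition module_nat_hcomp M N P (F F' : module_functor M N) (G G' : module_functor N P)
    (s : module_nat F F') (t : module_nat G G') :
  module_nat (module_functor_comp F G) (module_functor_comp F' G').
Proof.
refine (@ModuleNat V M P (module_functor_comp F G) (module_functor_comp F' G')
  (fun m => fmap G (s m) ;; t (F' m)) _ _).
- move=> m n f /=.
  by rewrite compA -fmapM (mcpt_nat s) fmapM -compA (mcpt_nat t) compA.
- move=> m u /=.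
  rewrite !compA -[_ ;; fmap G _ ;; fmap G _]compA -fmapM mcpt_act fmapM compA.
  rewrite -omega_nat -compA mcpt_nat -!compA [omega G _ _ ;; _]compA mcpt_act.
  by rewrite !compA -actmM comp1m.
Defined.

Definition modcomp2 M N P :
  functor (prod_cat (modfun_cat M N) (modfun_cat N P)) (modfun_cat M P).
Proof.
refine (@Functor (prod_cat (modfun_cat M N) (modfun_cat N P)) (modfun_cat M P)
  (fun FG => module_functor_comp (fst FG) (snd FG))
  (fun FG FG' st => module_nat_hcomp (fst st) (snd st)) _ _).
- by move=> [F G]; apply: module_nat_ext => m /=; rewrite fmap1 comp1m.
- move=> [F G] [F' G'] [F'' G''] [s t] [s' t']; apply: module_nat_ext => m /=.
  rewrite fmapM -!compA; congr (_ ;; _).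
  by rewrite !compA mcpt_nat.
Defined.

Lemma module_functor_ext M N (F G : module_functor M N) (E : mfun F = mfun G) :
  (forall m u,
    hcast (f_equal (fun K : functor M N => act (K m) u) E)
      (f_equal (fun K : functor M N => K (act m u)) E) (omega F m u) = omega G m u) ->
  F = G.
Proof.
case: F E => F w H1 H2 H3; case: G => G w' H1' H2' H3' /= E.
case: G / E w' H1' H2' H3' => w' H1' H2' H3' H.
have e : w = w'.
  extensionality m; extensionality u.
  by apply: iso_ext; rewrite -H.
case: w' / e H1' H2' H3' H => H1' H2' H3' _.
by rewrite (proof_irrelevance _ H1 H1') (proof_irrelevance _ H2 H2')
  (proof_irrelevance _ H3 H3').
Qed.

Lemma module_functor_comp1l M N (F : module_functor M N) :
  module_functor_comp (module_functor_id M) F = F.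
Proof.
unshelve eapply module_functor_ext; first by functor_refl.
move=> m u; etransitivity; first exact: (@hcast_id N (act (F m) u) (F (act m u))).
by rewrite /= fmap1 compm1.
Qed.

Lemma module_functor_comp1r M N (F : module_functor M N) :
  module_functor_comp F (module_functor_id N) = F.
Proof.
unshelve eapply module_functor_ext; first by functor_refl.
move=> m u; etransitivity; first exact: (@hcast_id N (act (F m) u) (F (act m u))).
by rewrite /= comp1m.
Qed.

Lemma module_functor_compA M N P Q (F : module_functor M N) (G : module_functor N P)
    (H : module_functor P Q) :
  module_functor_comp (module_functor_comp F G) H
  = module_functor_comp F (module_functor_comp G H).
Proof.
unshelve eapply module_functor_ext; first by functor_refl.
move=> m u; etransitivity.
  exact: (@hcast_id Q (act (H (G (F m))) u) (H (G (F (act m u))))).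
by rewrite /= fmapM compA.
Qed.

Lemma hcast_module_nat M N (F F' G G' : module_functor M N) (e : F = F') (e' : G = G')
    (t : module_nat F G) m :
  (hcast (C := modfun_cat M N) e e' t : module_nat F' G') m =
  hcast (f_equal (fun K : module_functor M N => K m) e)
    (f_equal (fun K : module_functor M N => K m) e') (t m).
Proof. by case: F' / e; case: G' / e'. Qed.

Definition modcat2 : strict2cat.
Proof.
refine (@Strict2Cat (module_category V) modfun_cat module_functor_id modcomp2 _ _ _).
- move=> M N; unshelve eapply functor_ext; first exact: module_functor_comp1l.
  move=> F G t; apply: module_nat_ext => m; rewrite hcast_module_nat.
  etransitivity; first exact: (@hcast_id N (F m) (G m)).
  by rewrite /= fmap1 comp1m.
- move=> M N; unshelve eapply functor_ext; first exact: module_functor_comp1r.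
  move=> F G t; apply: module_nat_ext => m; rewrite hcast_module_nat.
  etransitivity; first exact: (@hcast_id N (F m) (G m)).
  by rewrite /= compm1.
- move=> M N P Q; unshelve eapply functor_ext.
    by move=> [[F G] H]; apply: module_functor_compA.
  move=> [[F G] H] [[F' G'] H'] [[r s] t]; apply: module_nat_ext => m.
  rewrite hcast_module_nat.
  etransitivity; first exact: (@hcast_id Q (H (G (F m))) (H' (G' (F' m)))).
  by rewrite /= fmapM compA.
Defined.
End ModCat2.

Definition act_functor (V : monoidal_category) (M : module_category V) (m : M) :
    functor V M.
Proof.
refine (@Functor V M (fun u => act m u) (fun u v g => actm (idm m) g) _ _).
- by move=> u; rewrite actm1.
- by move=> u v w f g; rewrite -actmM comp1m.
Defined.

Section DaggerModules.
Context (U : unitary_monoidal_category).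

(* No axiom involves the right adjoints of the functors [m <| -], so their existence is
   required as a mere property. *)
Record dagger_modcat := DaggerModcat {
  dm :> module_category U;
  dm_dag : dagger dm;
  dm_act : forall (m n : dm) (u v : U) (f : hom m n) (g : hom u v),
    dm_dag _ _ (actm f g) = actm (dm_dag _ _ f) (g^†);
  dm_asc_unitary : forall m u v, unitary dm_dag (act_asc m u v);
  dm_run_unitary : forall m, unitary dm_dag (act_run m);
  dm_tensored : forall m : dm, has_right_adjoint (act_functor m)
}.

Definition dagger_module_functor (M N : dagger_modcat) (F : module_functor M N) : Prop :=
  (forall (m n : M) (f : hom m n),
     fmap F (dm_dag M _ _ f) = dm_dag N _ _ (fmap F f)) /\
  (forall (m : M) (u : U), unitary (dm_dag N) (omega F m u)).

Lemma unitary_comp (C : category) (dg : dagger C) (a b c : C) (f : hom a b) (g : hom b c) :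
  unitary dg f -> unitary dg g -> unitary dg (f ;; g).
Proof.
move=> [H1 H2] [K1 K2]; split; rewrite dag_comp compA.
- by rewrite -[f ;; g ;; _]compA K1 compm1.
- by rewrite -[_ ;; _ ;; f]compA H2 compm1.
Qed.

Lemma dagger_module_functor_id (M : dagger_modcat) :
  dagger_module_functor (M := M) (N := M) (module_functor_id M).
Proof. by split=> // m u; split=> /=; rewrite dag_idm comp1m. Qed.

Lemma dagger_module_functor_comp (M N P : dagger_modcat)
    (F : module_functor M N) (G : module_functor N P) :
  dagger_module_functor F -> dagger_module_functor G ->
  dagger_module_functor (M := M) (N := P) (module_functor_comp F G).
Proof.
move=> [HF KF] [HG KG]; split=> [m n f | m u] /=; first by rewrite HF HG.
apply: unitary_comp => //; case: (KF m u) => H1 H2.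
by split; rewrite -HG -fmapM ?H1 ?H2 fmap1.
Qed.

Definition dagger_modcat2 : strict2cat :=
  sub2cat (C := modcat2 U) (X := dagger_modcat) (i := fun M => dm M : module_category U)
    (P := fun M N F => dagger_module_functor (M := M) (N := N) F)
    (fun M => @dagger_module_functor_id M)
    (fun M N P F G => @dagger_module_functor_comp M N P F G).
End DaggerModules.

(* Main.v *)
From Corelib Require Import ssreflect.
From Stdlib Require Import FunctionalExtensionality ProofIrrelevance IndefiniteDescription.
Require Import Defs.

(** A tensored U-category is a U-category whose objects can be shifted.  Call a morphism
    [u -> A(a, b)] a graded element of [A(a, b)] of degree [u]; graded elements multiply
    through the composition of [A], and degrees multiply by the tensor product.  A shift
    of [a] by [u] is an object [p] with graded elements [eta] of [A(a, p)] of degree [u]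
    and [zeta] of [A(p, a)] of degree [u^*] that are inverse to each other up to
    evaluation and coevaluation.  The unit of the adjunction between [a <| -] and
    [A(a, -)] makes [a <| u] such a shift, its isomorphisms are multiplication by [eta]
    and by [zeta], and its functor on homs is [zeta * eta] ([ladj_isoE], [ladj_isoVE],
    [ladj_homE]).  Conversely a choice of shifts is a tensoring ([tensoring_of_shifts]).

    As shifts are defined by equations, every U-functor preserves them, and two shifts of
    [a] by [u] are isomorphic by a unique isomorphism compatible with [eta]
    ([shift_iso]).  All the structure of the module category of [A] comes from this:
    [a <| (u v)] and [(a <| u) <| v] are shifts of [a] by [u v], [a <| 1] and [a] are
    shifts of [a] by [1], and [F a <| u] and [F (a <| u)] are shifts of [F a] by [u].
    Hence [alpha], [rho] and [omega] are comparisons of shifts, and their axioms are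
    checked after multiplication by [eta], which is injective ([shift_module],
    [shift_modfun]).  In particular the structure of a module functor is invertible
    because [u] has a dual.

    Conversely, a graded element of degree [u] is the same as a morphism
    [a <| u -> b] of the underlying category, and a module functor acts on those; the
    action on the identity of [A(a, b)], a graded element of degree [A(a, b)], is a
    U-functor ([shift_ufun]).  The two constructions are mutually inverse, and a family
    of morphisms is U-natural exactly when it is natural and compatible with the
    [omega] ([shift_forwardK], [shift_backwardK]).

    The conjugate of a graded element composed with [kappa] is its graded dagger
    ([gdag]).  The axioms on the tensoring, that [rho] is unitary and that the functors
    [a <| -] are dagger, hold if and only if [zeta] is the graded dagger of [eta] for
    every shift ([kappa34_of_dagger_shifts], [dagger_shifts_of_kappa34]).  Comparisons
    of such dagger shifts are unitary ([shift_iso_unitary]), so that [alpha], [rho] and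
    [omega] are unitary, and the bijection on 1-cells restricts to dagger functors
    ([shift_modfun_dagger], [shift_ufun_dagger]).

    For essential surjectivity, let [M] be a tensored dagger module category.  The right
    adjoints of the functors [m <| -] are the hom objects of a U-category in which
    [m <| u] is a shift of [m] by [u] ([enriched_module], [enriched_shift]).  The graded
    dagger of [f : n <| u -> m] is the dagger of [f], shifted by [u^*] and followed by
    the evaluation [n <| u <| u^* -> n] ([act_dag]).  It is an involution because [phi]
    is unitary, and it reverses products because [alpha] is unitary and [nu] is defined
    by nested evaluations ([act_dagK], [act_dag_mul]).  The unitarity of [phi] and of
    [r : 1 -> 1^*] are consequences of the unitarity of [nu] and of the compatibility
    of duals with daggers ([conj_r_dag], [phi_dag]). *)

Set Implicit Arguments.
Unset Strict Implicit.
Unset Printing Implicit Defensive.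
Local Open Scope cat_scope.

(** * Rewriting in chains of compositions *)

Section Rechain.
Context (C : category).
Implicit Types a b c d e : C.

(** Compositions are nested to the left, so that two consecutive factors are in general
    not a subterm; these lemmas rewrite them in place. *)
Lemma chain2 a b c d (x : hom a b) (f : hom b c) (g : hom c d) k :
  f ;; g = k -> x ;; f ;; g = x ;; k.
Proof. by move=> <-; rewrite compA. Qed.

Lemma chain2V a b c d (x : hom a b) (f : hom b c) (g : hom c d) k :
  k = f ;; g -> x ;; f ;; g = x ;; k.
Proof. by move=> ->; rewrite compA. Qed.

Lemma chain3 a b c d e (x : hom a b) (f : hom b c) (g : hom c d) (h : hom d e) k :
  f ;; g ;; h = k -> x ;; f ;; g ;; h = x ;; k.
Proof. by move=> <-; rewrite !compA. Qed.
End Rechain.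

Section Merge.
Context (V : monoidal_category).
Implicit Types a b c d e : V.

Lemma tens_r1 a b c d e (f : hom a b) (g : hom c d) (h : hom d e) :
  (f ⊠ g) ;; (idm b ⊠ h) = f ⊠ (g ;; h).
Proof. by rewrite -tensmM compm1. Qed.

Lemma tens_l1 a b c d e (f : hom a b) (g : hom c d) (h : hom b e) :
  (f ⊠ g) ;; (h ⊠ idm d) = (f ;; h) ⊠ g.
Proof. by rewrite -tensmM compm1. Qed.

Lemma tens_1l a b c d e (f : hom a b) (g : hom c d) (h : hom e a) :
  (h ⊠ idm c) ;; (f ⊠ g) = (h ;; f) ⊠ g.
Proof. by rewrite -tensmM comp1m. Qed.
End Merge.

(** * Duals and conjugation in a unitary monoidal category *)

Section NuDual.
Context (V : monoidal_category) (D : dual_choice V).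
Implicit Types u v w x y : V.

(** Morphisms into a dual are determined by their evaluation, and this one evaluates by
    pairing the inner factors first. *)
Lemma dual_nu_spec u v :
  (idm (v ⊗ u) ⊠ dual_nu D u v) ;; ev D (v ⊗ u)
  = asc v u (D u ⊗ D v) ;; (idm v ⊠ evc (ev D u) (D v)) ;; ev D v.
Proof.
have -> : dual_nu D u v = cur (coev D (v ⊗ u))
    (asc v u (D u ⊗ D v) ;; (idm v ⊠ evc (ev D u) (D v)) ;; ev D v) ;; run (D (v ⊗ u)).
  by [].
by rewrite tensMl -compA evc_run (curK _ (dualP D _)).
Qed.

Lemma evc_dualm u v y y' (h : hom u v) (k : hom y y') :
  (idm u ⊠ (dualm D h ⊠ k)) ;; evc (ev D u) y' = (h ⊠ idm _) ;; evc (ev D v) y ;; k.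
Proof.
rewrite -(tens_lr (dualm D h)) tensMl -compA evc_nat compA; congr (_ ;; k).
rewrite /evc !compA ascV_nat (chain2V _ (tensMr _ _ _)) dualm_spec.
by rewrite tensMr compA -ascV_nat tensm1.
Qed.

Lemma coev_nat u v (g : hom v u) :
  coev D v ;; (idm (D v) ⊠ g) = coev D u ;; (dualm D g ⊠ idm u).
Proof.
apply: (uncur_inj (dualP D v)).
rewrite (tensMl _ (coev D v)) (tensMl _ (coev D u)) -!compA evc_nat evc_dualm compm1.
rewrite [LHS]compA (zigzag1 (dualP D v)) [RHS]compA tens_rl -tens_lr -compA.
by rewrite (zigzag1 (dualP D u)) run_nat.
Qed.
End NuDual.

Lemma conj_r_spec (U : unitary_monoidal_category) :
  (idm one ⊠ conj_r U) ;; ev (umc_dual U) one = lun one.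
Proof.
rewrite /conj_r tensMl -compA evc_run (zigzag1 (dualP _ one)).
by rewrite lun_one.
Qed.

Lemma nu_spec (U : unitary_monoidal_category) (u v : U) :
  (idm (v ⊗ u) ⊠ nu u v) ;; ev (umc_dual U) (v ⊗ u)
  = asc v u (conj u ⊗ conj v) ;; (idm v ⊠ evc (ev (umc_dual U) u) (conj v)) ;;
    ev (umc_dual U) v.
Proof. exact: dual_nu_spec. Qed.

Section ConjugationTheory.
Context (U : unitary_monoidal_category).
Notation D := (umc_dual U).
Notation r := (conj_r U).
Implicit Types u v w : U.

Definition conj_rV : hom (conj (one : U)) one := (lun (conj one))^-1 ;; ev D one.

Lemma conj_rK : r ;; conj_rV = idm one.
Proof. by rewrite /conj_rV compA -lunV_nat -compA conj_r_spec isoVK. Qed.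

Lemma conj_rVK : conj_rV ;; r = idm (conj one).
Proof.
apply: (dual_inj (dualP D one)); rewrite tensMl -compA conj_r_spec.
by rewrite lun_nat /conj_rV compKl tensm1 comp1m.
Qed.

Definition conj_r_iso : iso (one : U) (conj one) := Iso conj_rK conj_rVK.

Lemma nuK u v : nu u v ;; nuV u v = idm _.
Proof. exact: (proj1 (umc_nu_unitary u v)). Qed.
Lemma nuVK u v : nuV u v ;; nu u v = idm _.
Proof. exact: (proj2 (umc_nu_unitary u v)). Qed.

(** The lemmas on [nu] compare morphisms into a dual by evaluating them. *)
Lemma nu_nat u u' v v' (f : hom u u') (g : hom v v') :
  (conjm f ⊠ conjm g) ;; nu u' v' = nu u v ;; conjm (g ⊠ f).
Proof.
apply: (dual_inj (dualP D _)).
rewrite (tensMl _ _ (nu u' v')) (tensMl _ (nu u v)) -[LHS]compA nu_spec.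
rewrite /conjm mddag_tens (chain2 _ (dualm_spec _ _)).
transitivity (g^† ⊠ f^† ⊠ idm (D u ⊗ D v) ;; ((idm (v ⊗ u) ⊠ nu u v) ;; ev D (v ⊗ u)));
  last by rewrite !compA tens_lr tens_rl.
rewrite nu_spec !compA -tensm1 !asc_nat.
rewrite (chain2V _ (tensMl _ _ _)) evc_dualm.
rewrite (tensMl _ _ (dualm D g^†)) compA (chain2 _ (dualm_spec _ _)).
rewrite !compA (chain2 _ (tens_rl _ _)) [in RHS](chain2 _ (tens_r1 _ _ _)).
by rewrite /evc !compA.
Qed.

Lemma nu_conj_r_l u : (r ⊠ idm (D u)) ;; nu one u = lun (D u) ;; dualm D (run u).
Proof.
apply: (dual_inj (dualP D _)).
rewrite (tensMl _ _ (nu one u)) (tensMl _ (iso_hom (lun _))) -!compA dualm_spec nu_spec.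
rewrite [in LHS]compA [in LHS]compA -(tensm1 u) asc_nat (chain2V _ (tensMl _ _ _)).
have -> : (idm one ⊠ (r ⊠ idm (D u))) ;; evc (ev D one) (conj u) = lun _ ;; lun (D u).
  rewrite /evc !compA ascV_nat (chain2V _ (tensMr _ _ _)) conj_r_spec -asc_lun compVKl.
  by [].
rewrite tensMl compA triangle.
by rewrite tensm1 tens_lr compA tens_rl.
Qed.

Lemma nu_conj_r_r u : (idm (D u) ⊠ r) ;; nu u one = run (D u) ;; dualm D (lun u).
Proof.
apply: (dual_inj (dualP D _)).
rewrite (tensMl _ _ (nu u one)) (tensMl _ (iso_hom (run _))) -!compA dualm_spec nu_spec.
rewrite [in LHS]compA [in LHS]compA -(tensm1 one u) asc_nat (chain2V _ (tensMl _ _ _)).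
rewrite evc_nat tensMl -!compA conj_r_spec lun_nat [LHS]compA asc_lun -evc_run.
by rewrite tensm1 [LHS]compA tens_lr [RHS]compA tens_rl.
Qed.

Lemma dualm_unitary u v (f : hom u v) : unitary (mddag U) f -> unitary (mddag U) (dualm D f).
Proof.
by move=> [H K]; split; rewrite umc_dual_dag -dualmM ?H ?K dualm1.
Qed.

Lemma nuV_unitary u v : unitary (mddag U) (nuV u v).
Proof. by split; rewrite /nuV dagK; [exact: nuVK | exact: nuK]. Qed.

(** Up to the unitary [nu one one] and unit constraints, [r] tensored with the identity
    of [1^*] is unitary; as [1^*] is isomorphic to [1] by [r], it can be cancelled. *)
Lemma conj_r_dag : r^† = conj_rV.
Proof.
have H : unitary (mddag U) (idm (conj (one : U)) ⊠ r).
  have -> : idm (conj (one : U)) ⊠ r = run (D one) ;; dualm D (lun one) ;; nuV one one.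
    by rewrite -nu_conj_r_r -compA nuK compm1.
  apply: unitary_comp; last exact: nuV_unitary.
  by apply: unitary_comp; [exact: run_unitary | apply: dualm_unitary; exact: lun_unitary].
have {}H : r ;; r^† = idm one.
  apply: one_tens_inj; apply: (iso_epi (i := tens_iso (iso_sym conj_r_iso) (idiso one))).
  case: H; rewrite mddag_tens dag_idm tens_r1 => H _.
  rewrite /=; etransitivity; first exact: tens_lr.
  by rewrite -tens_rl H !tensm1 comp1m compm1.
by rewrite -[LHS]comp1m -conj_rVK -compA H compm1.
Qed.

(** The dagger of a coevaluation is an evaluation, and [phi u] compares the two objects
    [u] and [u^**] with dual [u^*]. *)
Lemma phi_coev_dag u : (phi u ⊠ idm (conj u)) ;; (coev D (conj u))^† = ev D u.
Proof.
rewrite phiE; apply: predual_map_spec.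
exact: is_dual_dag (dualP D (conj u)).
Qed.

Lemma phi_dagE u :
  (phi u)^† = (lun _)^-1 ;; ((ev D u)^† ⊠ idm _) ;; asc u (conj u) (conj (conj u)) ;;
    (idm u ⊠ ev D (conj u)) ;; run u.
Proof.
rewrite /phi !dag_comp !mddag_tens !dag_idm dagK (unitary_dag (lun_unitary _)).
by rewrite (dag_iso (asc_unitary _ _ _)) (dag_iso (run_unitary _)) !compA.
Qed.

(** The dagger of the right side is computed with the compatibility of duals and daggers;
    through this formula that compatibility bears on [phi], in [phi_dag_ev]. *)
Lemma coev_conj u : coev D (conj u) ;; nu (conj u) u = r ;; dualm D (ev D u).
Proof.
apply: (dual_inj (dualP D _)).
rewrite (tensMl _ (coev D (conj u))) (tensMl _ r) -!compA dualm_spec nu_spec.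
rewrite [in LHS]compA [in LHS]compA -(tensm1 u) asc_nat (chain2V _ (tensMl _ _ _)).
rewrite (zigzag1 (dualP D (conj u))) asc_run tensm1.
rewrite [RHS]compA tens_rl -tens_lr -[RHS]compA conj_r_spec.
by rewrite lun_one run_nat.
Qed.

Lemma phi_dag_evc u y :
  ((ev D u)^† ⊠ idm (conj (conj u) ⊗ y)) ;; asc u (conj u) (conj (conj u) ⊗ y) ;;
    (idm u ⊠ evc (ev D (conj u)) y)
  = lun _ ;; ((phi u)^† ⊠ idm y).
Proof.
apply: (iso_epi (i := asc one (conj (conj u)) y)).
rewrite [RHS]compA asc_lun -tensMr phi_dagE !compA isoK comp1m.
rewrite -tensm1 -asc_nat -[_ ;; asc _ _ _ ;; asc _ _ _]compA -pentagon.
rewrite /evc -[asc (conj u) _ _ ^-1 ;; _ ;; _]compA (tensMl u (asc _ _ _ ^-1)) !compA.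
rewrite -[_ ;; _ ;; (idm u ⊠ asc _ _ _ ^-1)]compA -tensMl isoK tensm1 compm1.
rewrite tensMl !compA -[_ ;; asc _ _ _ ;; (idm u ⊠ _)]compA -asc_nat !compA.
by rewrite -compA triangle -!tensMr.
Qed.

Lemma phi_dag_ev u : ((phi u)^† ⊠ idm (conj u)) ;; ev D u = (coev D (conj u))^†.
Proof.
have H : nu (conj u) u ;; dualm D (ev D u)^† = ((phi u)^† ⊠ idm (conj u)) ;; ev D u ;; r.
  apply: (dual_inj (dualP D _)).
  rewrite (tensMl _ (nu (conj u) u)) (tensMl _ _ r) -!compA dualm_spec conj_r_spec.
  rewrite lun_nat [RHS]compA -phi_dag_evc [LHS]compA tens_rl -tens_lr.
  by rewrite -[LHS]compA nu_spec !compA.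
have -> : coev D (conj u) = r ;; dualm D (ev D u) ;; nuV (conj u) u.
  by rewrite -coev_conj -compA nuK compm1.
rewrite (dag_comp _ _ (nuV _ _)) (dag_comp _ r) umc_dual_dag /nuV dagK conj_r_dag.
by rewrite compA H -compA conj_rK compm1.
Qed.

(** Unitarity of [phi]: [phi u] carries the dagger of the coevaluation of [u^*] to the
    evaluation of [u], and its dagger carries the latter to the former, so that the
    composite of the two preserves the evaluation of [u] and is the identity. *)
Lemma phi_dag u : (phi u)^† = phiV u.
Proof.
have H : phi u ;; (phi u)^† = idm u.
  apply: (predual_inj (dualP D u)).
  by rewrite tensMr -compA phi_dag_ev phi_coev_dag tensm1 comp1m.
by rewrite -[LHS]comp1m -phiVK -compA H compm1.
Qed.

Lemma phiV_dag u : (phiV u)^† = phi u.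
Proof. by rewrite -phi_dag dagK. Qed.

Lemma phi_ev_conj u : (idm (conj u) ⊠ phi u) ;; ev D (conj u) = (coev D u)^†.
Proof.
have -> : phi u = cur (coev D (conj u)) (coev D u)^† ;; run (conj (conj u)).
  rewrite -phiV_dag /phiV /cur !dag_comp !mddag_tens !dag_idm dagK.
  rewrite (unitary_dag (lun_unitary _)) (dag_iso (asc_unitary _ _ _)).
  by rewrite (dag_iso (run_unitary _)) !compA.
by rewrite tensMl -compA evc_run (curK _ (dualP D (conj u))).
Qed.

Lemma phi_one : phi one = r ;; conjm r.
Proof.
apply: (dual_inj (dualP D (conj one))).
rewrite phi_ev_conj (tensMl _ r) -compA /conjm conj_r_dag dualm_spec.
rewrite compA tens_rl -tens_lr -compA conj_r_spec.
have -> : coev D one = r ;; (run _)^-1 by rewrite /conj_r compK.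
rewrite dag_comp (dag_iso (run_unitary _)) conj_r_dag.
by rewrite lun_one run_nat.
Qed.

Lemma phi_nat u v (f : hom u v) : phi u ;; conjm (conjm f) = f ;; phi v.
Proof.
apply: (dual_inj (dualP D (conj v))).
rewrite (tensMl _ (phi u)) (tensMl _ f) -!compA phi_ev_conj.
rewrite {1}/conjm dualm_spec /conjm umc_dual_dag dagK.
rewrite [LHS]compA tens_rl -tens_lr -compA phi_ev_conj.
have := f_equal (mddag U _ _) (coev_nat D f^†).
by rewrite !dag_comp !mddag_tens !dag_idm umc_dual_dag !dagK => ->.
Qed.
End ConjugationTheory.

(** * Graded elements of a U-category *)

(** The product of graded elements.  Associativity and units hold up to the coherence
    isomorphisms of the degrees. *)
Definition gcomp (V : monoidal_category) (A : ucategory V) (a b c : A) (u v : V)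
    (x : hom u (uhom a b)) (y : hom v (uhom b c)) : hom (u ⊗ v) (uhom a c) :=
  (x ⊠ y) ;; ucomp a b c.

Notation "x ⋆ y" := (gcomp x y) (at level 45, left associativity) : cat_scope.

Section Graded.
Context (V : monoidal_category) (A : ucategory V).
Implicit Types u v w : V.
Implicit Types a b c d : A.

Lemma gcomp_idm a b c : idm (uhom a b) ⋆ idm (uhom b c) = ucomp a b c.
Proof. by rewrite /gcomp tensm1 comp1m. Qed.

Lemma gcomp_nat a b c u v u' v' (h : hom u' u) (k : hom v' v)
    (x : hom u (uhom a b)) (y : hom v (uhom b c)) :
  (h ⊠ k) ;; (x ⋆ y) = (h ;; x) ⋆ (k ;; y).
Proof. by rewrite /gcomp compA -tensmM. Qed.

Lemma gcomp_natl a b c u v u' (h : hom u' u)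
    (x : hom u (uhom a b)) (y : hom v (uhom b c)) :
  (h ⊠ idm v) ;; (x ⋆ y) = (h ;; x) ⋆ y.
Proof. by rewrite gcomp_nat comp1m. Qed.

Lemma gcomp_natr a b c u v v' (k : hom v' v)
    (x : hom u (uhom a b)) (y : hom v (uhom b c)) :
  (idm u ⊠ k) ;; (x ⋆ y) = x ⋆ (k ;; y).
Proof. by rewrite gcomp_nat comp1m. Qed.

Lemma gcompA a b c d u v w
    (x : hom u (uhom a b)) (y : hom v (uhom b c)) (z : hom w (uhom c d)) :
  x ⋆ y ⋆ z = asc u v w ;; (x ⋆ (y ⋆ z)).
Proof.
rewrite /gcomp -tens_l1 -tens_r1 -compA ucompA !compA.
by rewrite asc_nat.
Qed.

Lemma gcomp_asc a b c d u v w
    (x : hom u (uhom a b)) (y : hom v (uhom b c)) (z : hom w (uhom c d)) :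
  x ⋆ (y ⋆ z) = (asc u v w)^-1 ;; (x ⋆ y ⋆ z).
Proof. by rewrite gcompA compVKl. Qed.

Lemma gcomp1l a b u (x : hom u (uhom a b)) : uid a ⋆ x = lun u ;; x.
Proof. by rewrite /gcomp -tens_rl -compA ucomp_1l lun_nat. Qed.

Lemma gcomp1r a b u (x : hom u (uhom a b)) : x ⋆ uid b = run u ;; x.
Proof. by rewrite /gcomp -tens_lr -compA ucomp_1r run_nat. Qed.

(** Underlying morphisms are graded elements of degree [1]; multiplying by them without
    changing the degree is [upost] and [upre]. *)
Lemma gpostE a b c u (x : hom u (uhom a b)) (f : hom one (uhom b c)) :
  x ;; upost a f = (run u)^-1 ;; (x ⋆ f).
Proof. by rewrite /upost /gcomp !compA -runV_nat (chain2 _ (tens_lr _ _)). Qed.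

Lemma gpreE a b c u (f : hom one (uhom a b)) (x : hom u (uhom b c)) :
  x ;; upre c f = (lun u)^-1 ;; (f ⋆ x).
Proof. by rewrite /upre /gcomp !compA -lunV_nat (chain2 _ (tens_rl _ _)). Qed.

Lemma gcomp_post a b c d u v (x : hom u (uhom a b)) (y : hom v (uhom b c))
    (f : hom one (uhom c d)) : x ⋆ y ;; upost a f = x ⋆ (y ;; upost b f).
Proof. by rewrite !gpostE gcompA compA runV_asc gcomp_natr. Qed.

Lemma gcomp_pre a b c d u v (f : hom one (uhom a b)) (x : hom u (uhom b c))
    (y : hom v (uhom c d)) : x ⋆ y ;; upre d f = (x ;; upre c f) ⋆ y.
Proof. by rewrite !gpreE gcomp_asc compA lunV_asc gcomp_natl. Qed.

Lemma gcomp_mid a b c d u v (x : hom u (uhom a b)) (f : hom one (uhom b c))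
    (y : hom v (uhom c d)) : (x ;; upost a f) ⋆ y = x ⋆ (y ;; upre d f).
Proof.
rewrite gpostE gpreE -gcomp_natl -gcomp_natr gcompA compA; congr (_ ;; _).
apply: (iso_mono (i := tens_iso (idiso u) (lun v))) => /=.
rewrite -compA triangle -tensMl isoVK tensm1.
by rewrite -tensMr isoVK tensm1.
Qed.

Lemma gfun (B : ucategory V) (F : ufunctor A B) a b c u v
    (x : hom u (uhom a b)) (y : hom v (uhom b c)) :
  x ⋆ y ;; ufhom F a c = (x ;; ufhom F a b) ⋆ (y ;; ufhom F b c).
Proof. by rewrite /gcomp -compA ufhom_comp compA -tensmM. Qed.

Lemma gfun_post (B : ucategory V) (F : ufunctor A B) a b c u
    (x : hom u (uhom a b)) (f : hom one (uhom b c)) :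
  x ;; upost a f ;; ufhom F a c = x ;; ufhom F a b ;; upost (F a) (f ;; ufhom F b c).
Proof. by rewrite -compA upost_fun compA. Qed.

Lemma gfun_pre (B : ucategory V) (F : ufunctor A B) a b c u
    (f : hom one (uhom a b)) (x : hom u (uhom b c)) :
  x ;; upre c f ;; ufhom F a c = x ;; ufhom F b c ;; upre (F c) (f ;; ufhom F a b).
Proof. by rewrite -compA upre_fun compA. Qed.

Lemma gpost_comp a b c d u (x : hom u (uhom a b)) (f : hom one (uhom b c))
    (g : hom one (uhom c d)) :
  x ;; upost a (ucompose f g) = x ;; upost a f ;; upost a g.
Proof. by rewrite -compA upost_comp. Qed.

Lemma gpre_comp a b c d u (x : hom u (uhom c d)) (f : hom one (uhom a b))
    (g : hom one (uhom b c)) :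
  x ;; upre d (ucompose f g) = x ;; upre d g ;; upre d f.
Proof. by rewrite -compA upre_comp. Qed.

Lemma gpre_post a b c d u (x : hom u (uhom b c)) (f : hom one (uhom a b))
    (g : hom one (uhom c d)) :
  x ;; upre c f ;; upost a g = x ;; upost b g ;; upre d f.
Proof. by rewrite -compA upre_post compA. Qed.
End Graded.

(** * Shifts *)

(** The object [a <| u] with its universal graded element, described by equations in the
    way a dual object is, rather than by a universal property. *)
Record shift (U : unitary_monoidal_category) (A : ucategory U) (a : A) (u : U) := Shift {
  sh_ob :> A;
  sh_in : hom u (uhom a sh_ob);
  sh_out : hom (conj u) (uhom sh_ob a);
  sh_io : sh_in ⋆ sh_out = ev (umc_dual U) u ;; uid a;
  sh_oi : coev (umc_dual U) u ;; (sh_out ⋆ sh_in) = uid sh_ob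
}.

Section Shifts.
Context (U : unitary_monoidal_category).
Notation D := (umc_dual U).
Implicit Types u v w : U.

Section OneCategory.
Context (A : ucategory U).
Implicit Types a b c : A.

Section OneShift.
Context (a : A) (u : U) (s : shift a u).
Notation η := (sh_in s).
Notation ζ := (sh_out s).

Lemma shift_io w b (x : hom w (uhom a b)) : η ⋆ (ζ ⋆ x) = evc (ev D u) w ;; x.
Proof. by rewrite gcomp_asc sh_io -gcomp_natl gcomp1l /evc !compA. Qed.

(** Multiplication by [η] is cancelled by multiplication by [ζ] and the coevaluation. *)
Lemma shift_injl b w (x y : hom w (uhom s b)) : η ⋆ x = η ⋆ y -> x = y.
Proof.
have H (z : hom w (uhom s b)) :
    z = (lun w)^-1 ;; (coev D u ⊠ idm w) ;; asc _ _ _ ;; (ζ ⋆ (η ⋆ z)).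
  by rewrite -compA -gcompA -compA gcomp_natl sh_oi gcomp1l compVKl.
by move=> e; rewrite (H x) e -H.
Qed.

Lemma shift_injr b w (x y : hom w (uhom b s)) : x ⋆ ζ = y ⋆ ζ -> x = y.
Proof.
have H (z : hom w (uhom b s)) :
    z = (run w)^-1 ;; (idm w ⊠ coev D u) ;; (asc _ _ _)^-1 ;; (z ⋆ ζ ⋆ η).
  by rewrite -compA -gcomp_asc -compA gcomp_natr sh_oi gcomp1r compVKl.
by move=> e; rewrite (H x) e -H.
Qed.

Lemma shift_inj b (f g : hom one (uhom s b)) : η ;; upost a f = η ;; upost a g -> f = g.
Proof.
rewrite !gpostE => e; apply: shift_injl.
by apply: (iso_epi (i := iso_sym (run u))).
Qed.

Lemma shift_inj_out b (f g : hom one (uhom b s)) :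
  ζ ;; upre a f = ζ ;; upre a g -> f = g.
Proof.
rewrite !gpreE => e; apply: shift_injr.
by apply: (iso_epi (i := iso_sym (lun (conj u)))).
Qed.

(** The universal property: every graded element of degree [u ⊗ w] factors through [η]. *)
Definition shift_ext b w (k : hom (u ⊗ w) (uhom a b)) : hom w (uhom s b) :=
  cur (coev D u) k ;; (ζ ⋆ idm (uhom a b)).

Lemma shift_extK b w (k : hom (u ⊗ w) (uhom a b)) : η ⋆ shift_ext k = k.
Proof. by rewrite -gcomp_natr shift_io compm1 (curK _ (dualP D u)). Qed.

Definition shift_mate b (g : hom u (uhom a b)) : hom one (uhom s b) :=
  coev D u ;; (ζ ⋆ g).

Lemma shift_mateK b (g : hom u (uhom a b)) : η ;; upost a (shift_mate g) = g.
Proof.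
rewrite gpostE -gcomp_natr shift_io [_ ;; (_ ;; g)]compA (zigzag1 (dualP D u)).
by rewrite compVKl.
Qed.

Lemma shift_mate_post b (f : hom one (uhom s b)) : shift_mate (η ;; upost a f) = f.
Proof. by apply: shift_inj; rewrite shift_mateK. Qed.
End OneShift.

(** The second equation of a shift is between endomorphisms of [p], so it can be tested
    after multiplication by [η], where the first one and the zigzag equation apply. *)
Definition mk_shift a u p (η : hom u (uhom a p)) (ζ : hom (conj u) (uhom p a))
    (io : η ⋆ ζ = ev D u ;; uid a)
    (inj : forall f g : hom one (uhom p p), η ;; upost a f = η ;; upost a g -> f = g) :
  shift a u.
Proof.
refine (@Shift U A a u p η ζ io _); apply: inj.
rewrite upost_id compm1 gpostE -gcomp_natr gcomp_asc io -gcomp_natl gcomp1l.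
rewrite -[RHS](compVKl (run u)) -(zigzag1 (dualP D u)) /evc.
by rewrite !compA.
Defined.

Definition shift_cmp a u (s t : shift a u) : hom one (uhom s t) := shift_mate s (sh_in t).

Lemma shift_cmp_in a u (s t : shift a u) : sh_in s ;; upost a (shift_cmp s t) = sh_in t.
Proof. exact: shift_mateK. Qed.

Lemma shift_cmpK a u (s t : shift a u) :
  ucompose (shift_cmp s t) (shift_cmp t s) = uid s.
Proof. by apply: shift_inj; rewrite gpost_comp !shift_cmp_in upost_id compm1. Qed.

Definition shift_iso a u (s t : shift a u) :
    @iso (underlying A) (sh_ob s) (sh_ob t) :=
  @Iso (underlying A) (sh_ob s) (sh_ob t) (shift_cmp s t) (shift_cmp t s)
    (shift_cmpK s t) (shift_cmpK t s).

(** The comparison is defined from [η]; its inverse is compatible with [ζ]. *)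
Lemma shift_cmp_out a u (s t : shift a u) :
  sh_out s ;; upre a (shift_cmp t s) = sh_out t.
Proof.
apply: (shift_injl (s := t)).
by rewrite -gcomp_mid shift_cmp_in !sh_io.
Qed.

Definition shift_unit a : shift a one.
Proof.
refine (@mk_shift a one a (uid a) (conj_rV U ;; uid a) _ _).
- by rewrite gcomp1l /conj_rV !compA isoK comp1m.
- by move=> f g; rewrite -!ucompose_post !(@ucompose1l U A).
Defined.

(** The dual of [u ⊗ v] is [v^* u^*] up to [nu]. *)
Definition shift_tens a u v (s : shift a u) (t : shift s v) : shift a (u ⊗ v).
Proof.
refine (@mk_shift a (u ⊗ v) t (sh_in s ⋆ sh_in t)
  (nuV v u ;; (sh_out t ⋆ sh_out s)) _ _).
- rewrite -gcomp_natr gcompA shift_io -gcomp_natr sh_io 2!compA.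
  rewrite compA (chain3 _ (eq_sym (nu_spec _ _))) compA -tensMl nuVK tensm1 comp1m.
  by [].
- move=> f g; rewrite !gcomp_post => /(shift_injl (s := s)) e.
  exact: shift_inj e.
Defined.

End OneCategory.

(** U-functors preserve the two equations. *)
Definition shift_fun (A B : ucategory U) (F : ufunctor A B) (a : A) u (s : shift a u) :
  shift (F a) u.
Proof.
refine (@Shift U B (F a) u (F s) (sh_in s ;; ufhom F a s) (sh_out s ;; ufhom F s a) _ _).
- by rewrite -gfun sh_io -compA ufhom_id.
- by rewrite -gfun compA sh_oi ufhom_id.
Defined.
End Shifts.

(** * Tensorings as families of shifts *)

Section TensoringOfShifts.
Context (U : unitary_monoidal_category).
Notation D := (umc_dual U).
Context (A : ucategory U) (S : forall (a : A) (u : U), shift a u).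
Implicit Types a b c : A.
Notation η a u := (sh_in (S a u)).
Notation ζ a u := (sh_out (S a u)).

(** The self-enrichment composes by evaluating, and [η] and [ζ] multiply to an
    evaluation. *)
Lemma shift_chain a u v w b (x : hom w (uhom a b)) :
  (ζ a u ⋆ η a v) ⋆ (ζ a v ⋆ x) = self_comp D u v w ;; (ζ a u ⋆ x).
Proof. by rewrite gcompA shift_io -gcomp_natr self_compE compA. Qed.

Definition shift_ladj a : ufunctor (self_enrichment D) A.
Proof.
refine (@UFunctor U (self_enrichment D) A (fun u => S a u)
  (fun u v => ζ a u ⋆ η a v) _ _).
- by move=> u; rewrite /= sh_oi.
- by move=> u v w; rewrite /= -shift_chain.
Defined.

Definition shift_ladj_iso a u b :
  iso (uhom (shift_ladj a u) b) (conj u ⊗ uhom a b).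
Proof.
refine (@Iso U (uhom (S a u) b) (conj u ⊗ uhom a b)
  (cur (coev D u) (η a u ⋆ idm _)) (ζ a u ⋆ idm _) _ _).
- apply: (shift_injl (s := S a u)).
  exact: (shift_extK (S a u) (η a u ⋆ idm _)).
- apply: (uncur_inj (dualP D u)).
  rewrite (tensMl _ (ζ a u ⋆ _)) -compA (curK _ (dualP D u)) gcomp_natr compm1.
  by rewrite shift_io compm1 tensm1 comp1m.
Defined.

Definition tensoring_of_shifts : tensoring D A.
Proof.
move=> a.
refine (@LeftUAdjoint U A (self_enrichment D) (representable D a) (shift_ladj a)
  (shift_ladj_iso a) _ _).
- by move=> u v b; rewrite /= -shift_chain.
- move=> u b c /=; apply: (uncur_inj (dualP D u)).
  rewrite (tensMl _ (ucomp _ _ _)) -compA (curK _ (dualP D u)) gcomp_natr compm1.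
  apply: (iso_epi (i := asc _ _ _)).
  rewrite -gcomp_idm -gcompA self_compE rep_homE.
  rewrite (tensMl _ (_ ⊠ _)) -[in RHS]compA (tensMl _ (iso_hom (asc _ _ _))).
  rewrite -[_ ;; _ ;; evc _ _]compA evc_nat.
  have := evc_tens (ev D u) (uhom a b) (D (uhom a b) ⊗ uhom a c).
  have := curK (η a u ⋆ idm (uhom (S a u) b)) (dualP D u).
  have := curK (ucomp a b c) (dualP D (uhom a b)).
  move: (cur (coev D u) _) (cur (coev D (uhom a b)) _) (evc (ev D (uhom a b)) _).
  move: (evc (ev D u) (uhom a b)) (evc (ev D u) _) => E1 E2 k1 k2 E3 H2 H1 ET.
  rewrite [RHS]compA -asc_nat -[RHS]compA [X in _ ;; X]compA.
  rewrite [X in _ ;; X]compA ET [RHS]compA -tensmM H1 compm1.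
  by rewrite -tens_lr -compA H2.
Defined.
End TensoringOfShifts.

Section ShiftsOfTensoring.
Context (U : unitary_monoidal_category).
Notation D := (umc_dual U).
Context (A : ucategory U).
Implicit Types a b c : A.

(** The inverse of the identification of [U] with the underlying category of its
    self-enrichment. *)
Definition uncur1 (u z : U) (x : hom one (conj u ⊗ z)) : hom u z :=
  (run u)^-1 ;; (idm u ⊠ x) ;; evc (ev D u) z.

Lemma uncur1K (u z : U) (x : hom one (conj u ⊗ z)) :
  coev D u ;; (idm (conj u) ⊠ uncur1 x) = x.
Proof.
rewrite /uncur1 -compA tensMl -runV_asc compA compA -runV_nat -lunV_one.
by rewrite -[RHS](uncurK x (dualP D u)) /cur.
Qed.

Lemma uncur1_coev (u z : U) (h : hom u z) :
  uncur1 (coev D u ;; (idm (conj u) ⊠ h)) = h.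
Proof.
rewrite /uncur1 tensMl -!compA evc_nat [_ ;; (_ ;; h)]compA (zigzag1 (dualP D u)).
by rewrite compVKl.
Qed.

Lemma self_comp_name (u v w : U) (g : hom v w) :
  (idm (D u ⊗ v) ⊠ (coev D v ;; (idm (D v) ⊠ g))) ;; self_comp D u v w
  = run (D u ⊗ v) ;; (idm (D u) ⊠ g).
Proof.
rewrite tensMl self_compE -(tensm1 (D u) v) !compA (chain2 _ (asc_nat _ _ _)) compA asc_nat.
rewrite (chain2V _ (tensMl _ _ _)) evc_nat -[LHS]compA -tensMl compA (zigzag1 (dualP D v)).
by rewrite tensMl compA asc_run.
Qed.

Section OneObject.
Context (a : A) (L : left_uadjoint (representable D a)).

Definition ladj_in (u : U) : hom u (uhom a (L u)) := uncur1 (uid (L u) ;; ladj_iso L u (L u)).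

Definition ladj_out (u : U) : hom (conj u) (uhom (L u) a) :=
  (run (conj u))^-1 ;; (idm (conj u) ⊠ uid a) ;; (ladj_iso L u a)^-1.

Lemma ladj_inE u : coev D u ;; (idm (conj u) ⊠ ladj_in u) = uid (L u) ;; ladj_iso L u (L u).
Proof. exact: uncur1K. Qed.

(** Naturality in the target determines the isomorphisms by the images of identities. *)
Lemma ladj_isoE u b : ladj_iso L u b = cur (coev D u) (ladj_in u ⋆ idm (uhom (L u) b)) :> hom _ _.
Proof.
have := ladj_natr L u (L u) b => /= H.
rewrite -[LHS](compVKl (lun _)) -ucomp_1l -[_ ;; ucomp _ _ _ ;; _]compA H.
rewrite [X in _ ;; X]compA tens_1l -ladj_inE -tens_1l self_compE -[X in _ ;; X]compA.
rewrite [X in _ ;; (_ ;; X)]compA asc_nat -[X in _ ;; (_ ;; X)]compA -tensMl.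
rewrite -(tens_lr (ladj_in u)) -(compA (ladj_in u ⊠ _)) rep_homE (curK _ (dualP D _)).
by rewrite /cur /gcomp !compA.
Qed.

Lemma ladj_isoVE u b : (ladj_iso L u b)^-1 = ladj_out u ⋆ idm (uhom a b).
Proof.
apply: (iso_mono (i := ladj_iso L u b)); rewrite isoVK.
have := ladj_natr L u a b => /= H.
rewrite /gcomp -[RHS]compA H [RHS]compA tens_1l /ladj_out compVK -tens_1l self_compE.
rewrite -[RHS]compA [X in _ ;; X]compA asc_nat -[X in _ ;; X]compA -tensMl.
rewrite -(tens_lr (uid a)) -(compA (uid a ⊠ _)) rep_homE (curK _ (dualP D _)) ucomp_1l.
by rewrite triangle -tensMr isoVK tensm1.
Qed.

(** The unit and counit of the adjunction make [L u] a shift. *)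
Definition ladj_shift (u : U) : shift a u.
Proof.
refine (@Shift U A a u (L u) (ladj_in u) (ladj_out u) _ _).
- rewrite -[X in _ ⋆ X]compm1 -gcomp_natr.
  have -> : ladj_in u ⋆ idm (uhom (L u) a) = (idm u ⊠ ladj_iso L u a) ;; evc (ev D u) _.
    by rewrite ladj_isoE (curK _ (dualP D u)).
  rewrite compA -tensMl /ladj_out compVK tensMl -compA evc_nat compA evc_one.
  by [].
- rewrite -[X in _ ⋆ X]compm1 -gcomp_natr -ladj_isoVE compA ladj_inE.
  exact: compK.
Defined.

(** Naturality in the source, evaluated at the image of an identity. *)
Lemma ladj_homE u v : ufhom L u v = ladj_out u ⋆ ladj_in v.
Proof.
have := ladj_natl L u v (L v) => /= H.
apply: (iso_epi (i := run _)).
transitivity (ufhom L u v ⋆ uid (L v)); first by rewrite gcomp1r.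
rewrite -(compK (uid (L v)) (ladj_iso L v (L v))) -ladj_inE -gcomp_natr /gcomp -H.
by rewrite compA self_comp_name -compA ladj_isoVE gcomp_natr compm1.
Qed.
End OneObject.

Definition shifts_of_tensoring (T : tensoring D A) (a : A) (u : U) : shift a u :=
  ladj_shift (T a) u.

Lemma tensored_mateE (T : tensoring D A) a b (u : U) (g : hom u (uhom a b)) :
  tensored_mate T g = shift_mate (shifts_of_tensoring T a u) g.
Proof.
by rewrite /tensored_mate ladj_isoVE -compA gcomp_natr compm1.
Qed.

(** The shifts are recovered from the tensoring that they define. *)
Lemma tensoring_of_shifts_in (S : forall a u, shift a u) a u :
  sh_in (shifts_of_tensoring (tensoring_of_shifts S) a u) = sh_in (S a u).
Proof.
rewrite /= /ladj_in -[RHS]uncur1_coev; congr uncur1.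
rewrite /= /cur !compA -lunV_nat (chain2 _ (tens_rl _ _)) -tens_lr.
rewrite compA lunV_one runV_nat -(tensm1 (D u)).
rewrite (chain2 _ (asc_nat _ _ _)) compA (chain2 _ (runV_asc _ _)) -!(compA (coev D u)) -!tensMl.
by rewrite -(compA (_^-1)) gcomp_natr compm1 gcomp1r compVKl.
Qed.

Lemma tensoring_of_shifts_out (S : forall a u, shift a u) a u :
  sh_out (shifts_of_tensoring (tensoring_of_shifts S) a u) = sh_out (S a u).
Proof.
by rewrite /= /ladj_out /= -compA gcomp_natr compm1 gcomp1r compVKl.
Qed.
End ShiftsOfTensoring.

(** * The module category of a U-category with shifts *)

Section ShiftModule.
Context (U : unitary_monoidal_category).
Notation D := (umc_dual U).
Context (A : ucategory U) (S : forall (a : A) (u : U), shift a u).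
Implicit Types a b c : A.
Implicit Types u v w : U.
Notation η a u := (sh_in (S a u)).
Notation ζ a u := (sh_out (S a u)).

(** The unique morphism satisfying [sact_in]; all the constructions of this section are
    characterized by their product with [η], and all the identities are proved by
    computing this product. *)
Definition sact a b u v (f : hom one (uhom a b)) (g : hom u v) :
    hom one (uhom (S a u) (S b v)) :=
  shift_mate (S a u) (g ;; η b v ;; upre (S b v) f).

Lemma sact_in a b u v (f : hom one (uhom a b)) (g : hom u v) :
  η a u ;; upost a (sact f g) = g ;; η b v ;; upre (S b v) f.
Proof. exact: shift_mateK. Qed.

Lemma sact_in_pre a b u (f : hom one (uhom a b)) :
  η a u ;; upost a (sact f (idm u)) = η b u ;; upre (S b u) f.
Proof. by rewrite sact_in comp1m. Qed.

Lemma sact_in_id a u v (g : hom u v) : η a u ;; upost a (sact (uid a) g) = g ;; η a v.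
Proof. by rewrite sact_in upre_id compm1. Qed.

Lemma sact_id a u : sact (uid a) (idm u) = uid (S a u).
Proof. by apply: shift_inj; rewrite sact_in_id upost_id comp1m compm1. Qed.

Definition sasc a u v : @iso (underlying A) (sh_ob (S a (u ⊗ v))) (sh_ob (S (S a u) v)) :=
  shift_iso (S a (u ⊗ v)) (shift_tens (S (S a u) v)).

Lemma sasc_in a u v : η a (u ⊗ v) ;; upost a (sasc a u v) = η a u ⋆ η (S a u) v.
Proof. exact: (shift_cmp_in (S a (u ⊗ v)) (shift_tens (S (S a u) v))). Qed.

Definition srun a : @iso (underlying A) (sh_ob (S a one)) a := shift_iso (S a one) (shift_unit a).

Lemma srun_in a : η a one ;; upost a (srun a) = uid a.
Proof. exact: (shift_cmp_in (S a one) (shift_unit a)). Qed.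

Definition shift_module : module_category U.
Proof.
refine (@ModuleCategory U (underlying A) (fun a u => sh_ob (S a u))
  (fun a b u v f g => sact f g) _ _ sasc srun _ _ _ _) => /=.
- exact: sact_id.
- move=> a b c u v w f g h k; apply: shift_inj.
  rewrite gpost_comp !sact_in gpre_post (chain2 _ (sact_in _ _)) gpre_comp.
  by rewrite (compA h) (compA h).
- move=> a a' u u' v v' f g h; apply: shift_inj.
  rewrite !gpost_comp sact_in gpre_post (chain2 _ (sasc_in _ _ _)) sasc_in.
  rewrite gcomp_post sact_in -gcomp_mid sact_in -gcomp_pre.
  by rewrite gcomp_nat.
- move=> a b f; apply: shift_inj.
  rewrite !gpost_comp sact_in_pre gpre_post !srun_in.
  by rewrite -ucompose_pre -ucompose_post !(@ucompose1l U A) !(@ucompose1r U A).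
- move=> a u v w; apply: shift_inj.
  rewrite !gpost_comp sact_in_id !sasc_in gcomp_post sact_in_pre -gcomp_mid.
  by rewrite sasc_in gcompA (chain2 _ (sasc_in _ _ _)) -compA gcomp_post sasc_in.
- move=> a v; apply: shift_inj.
  by rewrite !gpost_comp sact_in_id !sasc_in gcomp_post sact_in_pre -gcomp_mid srun_in
    gcomp1l.
Defined.

Definition hom_functor a : functor (underlying A) U.
Proof.
refine (@Functor (underlying A) U (fun b => uhom a b) (fun b c f => upost a f) _ _).
- by move=> b /=; rewrite upost_id.
- by move=> b c d f g /=; rewrite upost_comp.
Defined.

(** The universal property of [η] on underlying morphisms is the adjunction. *)
Lemma shift_module_tensored (a : shift_module) : has_right_adjoint (act_functor a).
Proof.
exists (hom_functor a).
exists (fun u b f => η a u ;; upost a f), (fun u b g => shift_mate (S a u) g).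
split; first by move=> u b f; apply: shift_mate_post.
split; first by move=> u b g; apply: shift_mateK.
move=> u v b c f h g /=.
by rewrite !gpost_comp sact_in_id compA.
Qed.
End ShiftModule.

(** * U-functors and module functors *)

Section ShiftFunctors.
Context (U : unitary_monoidal_category).
Context (A B : ucategory U).
Context (SA : forall (a : A) (u : U), shift a u) (SB : forall (b : B) (u : U), shift b u).
Implicit Types a b c : A.
Implicit Types u v w : U.
Notation MA := (shift_module SA).
Notation MB := (shift_module SB).

Section Forward.
Context (F : ufunctor A B).

Definition under_functor : functor (underlying A) (underlying B).
Proof.
refine (@Functor (underlying A) (underlying B) (fun a => F a)
  (fun a b (f : hom one (uhom a b)) => f ;; ufhom F a b) _ _).
- by move=> a /=; rewrite ufhom_id.
- by move=> a b c f g /=; rewrite ucompose_fun.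
Defined.

(** A U-functor maps [a <| u] to another shift of [F a] by [u]. *)
Definition somega a u : @iso (underlying B) (sh_ob (SB (F a) u)) (F (SA a u)) :=
  shift_iso (SB (F a) u) (shift_fun F (SA a u)).

Lemma somega_in a u :
  sh_in (SB (F a) u) ;; upost (F a) (somega a u) = sh_in (SA a u) ;; ufhom F a (SA a u).
Proof. exact: (shift_cmp_in (SB (F a) u) (shift_fun F (SA a u))). Qed.

Definition shift_modfun : module_functor MA MB.
Proof.
refine (@ModuleFunctor U MA MB under_functor somega _ _ _) => /=.
- move=> a b u v f g; apply: shift_inj.
  rewrite !gpost_comp sact_in gpre_post (chain2 _ (somega_in _ _)) somega_in.
  by rewrite -gfun_post sact_in gfun_pre !compA.
- move=> a u v; apply: shift_inj.
  rewrite !gpost_comp somega_in -gfun_post !sasc_in.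
  by rewrite gcomp_post sact_in_pre -gcomp_mid somega_in gcomp_post somega_in gfun.
- move=> a; apply: shift_inj.
  by rewrite !gpost_comp somega_in -gfun_post !srun_in ufhom_id.
Defined.
End Forward.

Section ForwardNat.
Context (F G : ufunctor A B) (t : unat F G).

Definition shift_modnat : module_nat (shift_modfun F) (shift_modfun G).
Proof.
refine (@ModuleNat U MA MB (shift_modfun F) (shift_modfun G) (fun a => t a) _ _) => /=.
- by move=> a b f; rewrite unat_square.
- move=> a u; apply: shift_inj.
  rewrite !gpost_comp sact_in_pre gpre_post !somega_in.
  by rewrite -compA -unat_post compA.
Defined.
End ForwardNat.

Section Backward.
Context (G : module_functor MA MB).

(* [G] with its types and axioms expressed in the U-categories [A] and [B]. *)
Let Go (a : A) : B := mfun G a.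
Let Gm a b (f : hom one (uhom a b)) : hom one (uhom (Go a) (Go b)) :=
  fmap (mfun G) (f : @hom MA a b).
Let w a u : hom one (uhom (SB (Go a) u) (Go (SA a u))) := iso_hom (omega G a u).

Let GmM a b c (f : hom one (uhom a b)) (g : hom one (uhom b c)) :
  Gm (ucompose f g) = ucompose (Gm f) (Gm g).
Proof. exact: (fmapM (mfun G)). Qed.

Let w_nat a b u v (f : hom one (uhom a b)) (g : hom u v) :
  ucompose (sact SB (Gm f) g) (w b v) = ucompose (w a u) (Gm (sact SA f g)).
Proof. exact: (omega_nat G f g). Qed.

Let Gm1 a : Gm (uid a) = uid (Go a).
Proof. exact: (fmap1 (mfun G)). Qed.

Let w_nat1 a u v (g : hom u v) :
  ucompose (sact SB (uid (Go a)) g) (w a v) = ucompose (w a u) (Gm (sact SA (uid a) g)).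
Proof. by rewrite -w_nat Gm1. Qed.

Let w_asc a u v :
  ucompose (w a (tens u v)) (Gm (sasc SA a u v))
  = ucompose (ucompose (sasc SB (Go a) u v) (sact SB (w a u) (idm v))) (w (SA a u) v).
Proof. exact: (omega_asc G a u v). Qed.

Let w_run a : ucompose (w a one) (Gm (srun SA a)) = srun SB (Go a).
Proof. exact: (omega_run G a). Qed.

(** A graded element of degree [u] is a morphism out of [a <| u], on which [G] acts up
    to [omega].  This is natural in [u] and multiplicative, hence given by a U-functor,
    the image of the universal graded element [idm (uhom a b)]. *)
Definition gmap a b u (g : hom u (uhom a b)) : hom u (uhom (Go a) (Go b)) :=
  sh_in (SB (Go a) u) ;; upost (Go a) (ucompose (w a u) (Gm (shift_mate (SA a u) g))).

Lemma gmap_nat a b u v (h : hom v u) (g : hom u (uhom a b)) :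
  gmap (h ;; g) = h ;; gmap g.
Proof.
have E : shift_mate (SA a v) (h ;; g) =
    ucompose (sact SA (uid a) h) (shift_mate (SA a u) g).
  apply: shift_inj.
  by rewrite gpost_comp sact_in_id -[RHS]compA !shift_mateK.
rewrite /gmap E GmM ucomposeA -w_nat1 -!ucomposeA !gpost_comp sact_in_id.
by rewrite !(compA h).
Qed.

(** A product corresponds to transposing one factor after the other, up to the
    associativity of the action; compatibility of [omega] with it concludes. *)
Lemma gmap_mul a b c u v (x : hom u (uhom a b)) (y : hom v (uhom b c)) :
  gmap (x ⋆ y) = gmap x ⋆ gmap y.
Proof.
have E : shift_mate (SA a (u ⊗ v)) (x ⋆ y) =
    ucompose (sasc SA a u v) (ucompose (sact SA (shift_mate (SA a u) x) (idm v))
      (shift_mate (SA b v) y)).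
  apply: shift_inj.
  rewrite !gpost_comp sasc_in gcomp_post sact_in_pre -gcomp_mid !shift_mateK.
  by rewrite gcomp_post shift_mateK.
rewrite /gmap E !GmM !ucomposeA w_asc -!ucomposeA [ucompose (w _ v) _]ucomposeA -w_nat.
rewrite !gpost_comp sasc_in !gcomp_post sact_in_pre gpre_post sact_in_pre !gpre_post.
by rewrite -!gcomp_mid.
Qed.

Lemma gmap_id a : gmap (uid a) = uid (Go a).
Proof. by rewrite /gmap w_run srun_in. Qed.

Lemma gmap_in a u : gmap (sh_in (SA a u)) = sh_in (SB (Go a) u) ;; upost (Go a) (w a u).
Proof.
have E : shift_mate (SA a u) (sh_in (SA a u)) = uid (SA a u).
  by apply: shift_inj; rewrite shift_mateK upost_id compm1.
by rewrite /gmap E Gm1 ucompose1r.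
Qed.

Lemma gmap_one a b (f : hom one (uhom a b)) : gmap f = Gm f.
Proof.
have E : shift_mate (SA a one) f = ucompose (srun SA a) f.
  by apply: shift_inj; rewrite shift_mateK gpost_comp srun_in -ucompose_post ucompose1l.
by rewrite /gmap E GmM ucomposeA w_run gpost_comp srun_in -ucompose_post ucompose1l.
Qed.

Definition shift_ufun : ufunctor A B.
Proof.
refine (@UFunctor U A B Go (fun a b => gmap (idm (uhom a b))) _ _).
- by move=> a; rewrite -gmap_nat compm1 gmap_id.
- by move=> a b c; rewrite -gmap_nat compm1 -gcomp_idm gmap_mul.
Defined.

Lemma shift_ufunE a b u (g : hom u (uhom a b)) : g ;; ufhom shift_ufun a b = gmap g.
Proof. by rewrite /= -gmap_nat compm1. Qed.
End Backward.

Section BackwardNat.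
Context (G H : module_functor MA MB) (t : module_nat G H).

(** Both sides of U-naturality are compared on the universal graded element: [t] is
    compatible with [omega] at its degree and natural with respect to its transpose. *)
Definition shift_unat : unat (shift_ufun G) (shift_ufun H).
Proof.
refine (@UNat U A B (shift_ufun G) (shift_ufun H) (fun a => mcpt t a) _).
move=> a b; apply/(unatE (F := shift_ufun G) (G := shift_ufun H)) => /=.
rewrite /gmap.
set ε := shift_mate _ _.
have N : ucompose (fmap (mfun G) (ε : @hom MA _ _)) (mcpt t b)
    = ucompose (mcpt t (sh_ob (SA a (uhom a b)))) (fmap (mfun H) (ε : @hom MA _ _)).
  exact: (mcpt_nat t (ε : @hom MA _ _)).
have W := mcpt_act t a (uhom a b) : ucompose (iso_hom (omega G a (uhom a b)))
    (mcpt t (sh_ob (SA a (uhom a b)))) =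
  ucompose (sact SB (mcpt t a) (idm (uhom a b))) (iso_hom (omega H a (uhom a b))).
rewrite -[RHS]gpost_comp -ucomposeA N ucomposeA W -!ucomposeA.
by rewrite [in RHS]gpost_comp sact_in_pre gpre_post.
Defined.
End BackwardNat.

Lemma shift_ufunK (F : ufunctor A B) : shift_ufun (shift_modfun F) = F.
Proof.
unshelve eapply ufunctor_ext; first by [].
move=> a b /=.
rewrite /gmap /= gpost_comp somega_in -gfun_post shift_mateK comp1m.
by [].
Qed.

Lemma shift_modfunK (G : module_functor MA MB) : shift_modfun (shift_ufun G) = G.
Proof.
unshelve eapply module_functor_ext.
  unshelve eapply functor_ext; first by [].
  move=> a b f /=; exact: (eq_trans (shift_ufunE G f) (gmap_one G f)).
move=> a u; etransitivity.
  exact: (@hcast_id MB (act (G a : MB) u) (G (act (a : MA) u))).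
apply: shift_inj; etransitivity; first exact: (somega_in (shift_ufun G) a u).
by rewrite shift_ufunE; exact: gmap_in.
Qed.

Definition shift_forward : functor (ufun_cat A B) (modfun_cat MA MB).
Proof.
refine (@Functor (ufun_cat A B) (modfun_cat MA MB) shift_modfun
  (fun F G t => shift_modnat t) _ _).
- by move=> F; apply: module_nat_ext.
- by move=> F G H s t; apply: module_nat_ext.
Defined.

Definition shift_backward : functor (modfun_cat MA MB) (ufun_cat A B).
Proof.
refine (@Functor (modfun_cat MA MB) (ufun_cat A B) shift_ufun
  (fun G H t => shift_unat t) _ _).
- by move=> G; apply: unat_ext.
- by move=> G H K s t; apply: unat_ext.
Defined.

Lemma shift_forwardK : functor_comp shift_forward shift_backward = functor_id _.
Proof.
unshelve eapply functor_ext; first exact: shift_ufunK.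
move=> F G t; apply: unat_ext => a; rewrite hcast_unat.
exact: (@hcast_id (underlying B) (F a) (G a)).
Qed.

Lemma shift_backwardK : functor_comp shift_backward shift_forward = functor_id _.
Proof.
unshelve eapply functor_ext; first exact: shift_modfunK.
move=> F G t; apply: module_nat_ext => a; rewrite hcast_module_nat.
exact: (@hcast_id MB (F a) (G a)).
Qed.
End ShiftFunctors.

Lemma shift_modfun_id (U : unitary_monoidal_category) (A : ucategory U)
    (S : forall a u, shift a u) :
  shift_modfun S S (ufunctor_id A) = module_functor_id (shift_module S).
Proof.
unshelve eapply module_functor_ext.
  unshelve eapply functor_ext; first by [].
  by move=> a b f /=; rewrite compm1.
move=> a u; etransitivity.
  exact: (@hcast_id (shift_module S) (act (a : shift_module S) u) (act (a : shift_module S) u)).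
apply: shift_inj; etransitivity; first exact: (somega_in S S (ufunctor_id A) a u).
by rewrite /= upost_id.
Qed.

(** The comparison of shifts for a composite is the composite of the comparisons, by
    uniqueness; this makes the passage to module functors strictly functorial. *)
Lemma shift_modfun_comp (U : unitary_monoidal_category) (A B C : ucategory U)
    (SA : forall (a : A) u, shift a u) (SB : forall (b : B) u, shift b u)
    (SC : forall (c : C) u, shift c u) (F : ufunctor A B) (G : ufunctor B C) :
  shift_modfun SA SC (ufunctor_comp F G)
  = module_functor_comp (shift_modfun SA SB F) (shift_modfun SB SC G).
Proof.
unshelve eapply module_functor_ext.
  unshelve eapply functor_ext; first by [].
  by move=> a b f /=; rewrite compA.
move=> a u; etransitivity.
  exact: (@hcast_id (shift_module SC) (act (G (F a) : shift_module SC) u) (G (F (SA a u)))).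
apply: shift_inj; etransitivity; first exact: (somega_in SA SC (ufunctor_comp F G) a u).
rewrite /= gpost_comp somega_in -gfun_post somega_in compA.
by [].
Qed.

Lemma shift_forward_comp (U : unitary_monoidal_category) (A B C : ucategory U)
    (SA : forall (a : A) u, shift a u) (SB : forall (b : B) u, shift b u)
    (SC : forall (c : C) u, shift c u) :
  functor_comp (ucomp2 A B C) (shift_forward SA SC)
  = functor_comp (prod_functor (shift_forward SA SB) (shift_forward SB SC))
      (modcomp2 _ _ _).
Proof.
unshelve eapply functor_ext; first by move=> [F G]; exact: shift_modfun_comp.
move=> [F G] [F' G'] [s t]; apply: module_nat_ext => a; rewrite hcast_module_nat.
exact: (@hcast_id (shift_module SC) (G (F a)) (G' (F' a))).
Qed.

(** * Graded daggers and dagger shifts *)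

Section GradedDagger.
Context (U : unitary_monoidal_category) (A : weak_dagger_ucategory U).
Notation D := (umc_dual U).
Notation r := (conj_r U).
Implicit Types a b c : A.
Implicit Types u v w : U.

Definition gdag a b u (x : hom u (uhom a b)) : hom (conj u) (uhom b a) :=
  conjm x ;; kappa b a.

Lemma gdag_nat a b u v (h : hom v u) (x : hom u (uhom a b)) :
  gdag (h ;; x) = conjm h ;; gdag x.
Proof. by rewrite /gdag conjmM compA. Qed.

(** This is the axiom on [kappa] and composition. *)
Lemma gdag_mul a b c u v (x : hom u (uhom a b)) (y : hom v (uhom b c)) :
  gdag y ⋆ gdag x = nu v u ;; gdag (x ⋆ y).
Proof.
rewrite /gdag -gcomp_nat.
have -> : kappa c b ⋆ kappa b a = nu _ _ ;; conjm (ucomp a b c) ;; kappa c a :=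
  kappa2 c b a.
rewrite (compA (_ ⊠ _)) (compA (_ ⊠ _)) nu_nat /gcomp conjmM.
by rewrite !(compA (nu _ _)).
Qed.

(** This is the axiom on [kappa] and conjugation. *)
Lemma gdagK a b u (x : hom u (uhom a b)) : phi u ;; gdag (gdag x) = x.
Proof.
rewrite /gdag conjmM 2!(compA (phi u)) phi_nat -2!(compA x).
by rewrite kappa1 compm1.
Qed.

Lemma weak_dagE a b (f : hom one (uhom a b)) : weak_dag f = r ;; gdag f.
Proof. by rewrite /weak_dag /gdag compA. Qed.

Lemma gdag_one a b (f : hom one (uhom a b)) : gdag f = conj_rV U ;; weak_dag f.
Proof. by rewrite weak_dagE compA conj_rVK comp1m. Qed.

(** An underlying morphism has degree [1], which is its own dual up to [r]. *)
Lemma gdag_post a b c u (x : hom u (uhom a b)) (f : hom one (uhom b c)) :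
  gdag (x ;; upost a f) = gdag x ;; upre a (weak_dag f).
Proof.
rewrite gpostE gdag_nat gpreE weak_dagE -gcomp_natl gdag_mul.
rewrite (compA (r ⊠ _)) nu_conj_r_l -(compA (iso_hom _)) compVKl.
by rewrite /conjm (dag_iso (run_unitary _)).
Qed.

Lemma gdag_pre a b c u (f : hom one (uhom a b)) (x : hom u (uhom b c)) :
  gdag (x ;; upre c f) = gdag x ;; upost c (weak_dag f).
Proof.
rewrite gpreE gdag_nat gpostE weak_dagE -gcomp_natr gdag_mul.
rewrite (compA (_ ⊠ r)) nu_conj_r_r -(compA (iso_hom _)) compVKl.
by rewrite /conjm (dag_iso (lun_unitary _)).
Qed.

Lemma weak_dagM a b c (f : hom one (uhom a b)) (g : hom one (uhom b c)) :
  weak_dag (ucompose f g) = ucompose (weak_dag g) (weak_dag f).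
Proof.
rewrite !ucompose_post weak_dagE gdag_post compA -weak_dagE -ucompose_pre.
by rewrite -ucompose_post.
Qed.

Lemma weak_dagK a b (f : hom one (uhom a b)) : weak_dag (weak_dag f) = f.
Proof. by rewrite [weak_dag f]weak_dagE weak_dagE gdag_nat compA -phi_one gdagK. Qed.

(** In a category, an involution that reverses composition fixes identities: the image of
    an identity is a left unit. *)
Lemma weak_dag_id a : weak_dag (uid a) = uid a.
Proof.
have := f_equal (@weak_dag _ _ _ _) (ucompose1l (weak_dag (uid a))).
by rewrite weak_dagM weak_dagK ucompose1l.
Qed.

Definition underlying_dagger : dagger (underlying A) :=
  @Dagger (underlying A) (fun a b f => weak_dag f) weak_dag_id weak_dagM weak_dagK.

Definition dagger_shift a u (s : shift a u) : Prop := gdag (sh_in s) = sh_out s.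

(** The graded dagger of the equation characterizing the comparison [s -> t]
    characterizes the inverse comparison. *)
Lemma shift_cmp_dag a u (s t : shift a u) : dagger_shift s -> dagger_shift t ->
  weak_dag (shift_cmp s t) = shift_cmp t s.
Proof.
move=> Hs Ht; apply: (shift_inj_out (s := s)).
by rewrite shift_cmp_out -Hs -gdag_post shift_cmp_in.
Qed.

Lemma shift_iso_unitary a u (s t : shift a u) : dagger_shift s -> dagger_shift t ->
  unitary underlying_dagger (shift_iso s t).
Proof.
move=> Hs Ht; rewrite /unitary /inverse /= shift_cmp_dag //.
by split; exact: shift_cmpK.
Qed.

Lemma dagger_shift_unit a : dagger_shift (shift_unit a).
Proof. by rewrite /dagger_shift /= gdag_one weak_dag_id. Qed.

Lemma dagger_shift_tens a u v (s : shift a u) (t : shift s v) :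
  dagger_shift s -> dagger_shift t -> dagger_shift (shift_tens t).
Proof.
move=> Hs Ht; rewrite /dagger_shift /= -Hs -Ht gdag_mul compA nuVK comp1m.
by [].
Qed.

Section Module.
Context (S : forall a u, shift a u) (HS : forall a u, dagger_shift (S a u)).

(** The morphism [sact f g] is characterized by its product with [η]; this is the product
    with [ζ], computed by evaluating [g] on the other side. *)
Lemma sact_out a b u v (f : hom one (uhom a b)) (g : hom u v) :
  sh_out (S b v) ;; upre b (sact S f g) = dualm D g ;; sh_out (S a u) ;; upost (S a u) f.
Proof.
apply: (shift_injl (s := S a u)).
rewrite -gcomp_mid sact_in -gcomp_pre -gcomp_natl sh_io -!gcomp_post -gcomp_natr sh_io.
rewrite (compA _ (ev D v)) (compA _ (ev D u)) dualm_spec -!(compA _ (uid _)).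
by rewrite -ucompose_pre -ucompose_post ucompose1l ucompose1r.
Qed.

Lemma sact_dag a b u v (f : hom one (uhom a b)) (g : hom u v) :
  weak_dag (sact S f g) = sact S (weak_dag f) g^†.
Proof.
apply: (shift_inj_out (s := S a u)).
rewrite sact_out -HS -gdag_post sact_in gdag_pre gdag_nat HS.
by [].
Qed.

Definition shift_dagger_modcat : dagger_modcat U.
Proof.
refine (@DaggerModcat U (shift_module S) underlying_dagger _ _ _ _).
- exact: sact_dag.
- move=> a u v.
  apply: (@shift_iso_unitary a _ (S a (u ⊗ v)) (shift_tens (S (S a u) v))) => //.
  exact: dagger_shift_tens.
- move=> a; apply: (@shift_iso_unitary a _ (S a one) (shift_unit a)) => //.
  exact: dagger_shift_unit.
- exact: shift_module_tensored.
Defined.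
End Module.
End GradedDagger.

Section DaggerFunctors.
Context (U : unitary_monoidal_category) (A B : weak_dagger_ucategory U).
Context (SA : forall (a : A) u, shift a u) (SB : forall (b : B) u, shift b u).
Context (HA : forall a u, dagger_shift (SA a u)) (HB : forall b u, dagger_shift (SB b u)).

(** Taking [x] to be an identity gives the definition back. *)
Lemma dagger_ufunctorP (F : ufunctor A B) :
  dagger_ufunctor F <->
  forall a b u (x : hom u (uhom a b)), gdag x ;; ufhom F b a = gdag (x ;; ufhom F a b).
Proof.
split=> [HF a b u x | HF a b].
- by rewrite /gdag conjmM -compA HF compA.
- have := HF b a _ (idm (uhom b a)).
  by rewrite /gdag conjm1 !comp1m.
Qed.

Lemma dagger_shift_fun (F : ufunctor A B) a u (s : shift a u) :
  dagger_ufunctor F -> dagger_shift s -> dagger_shift (shift_fun F s).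
Proof. by move=> /dagger_ufunctorP HF Hs; rewrite /dagger_shift /= -HF Hs. Qed.

Lemma shift_modfun_dagger (F : ufunctor A B) : dagger_ufunctor F ->
  dagger_module_functor (M := shift_dagger_modcat HA) (N := shift_dagger_modcat HB)
    (shift_modfun SA SB F).
Proof.
move=> HF; split=> [a b f | a u].
- have /dagger_ufunctorP H := HF.
  by rewrite /= !weak_dagE -compA H.
- apply: (@shift_iso_unitary _ B (F a) u (SB (F a) u) (shift_fun F (SA a u))) => //.
  exact: dagger_shift_fun.
Qed.

(** With [x] the product of [η] and its transpose [f], the graded dagger of [x] is the
    product of the dagger of [f] and [ζ].  The functor respects the dagger of [f] by
    hypothesis, and maps [ζ] to [ζ] up to the inverse of [omega], which is its dagger. *)
Lemma shift_ufun_dagger (G : module_functor (shift_module SA) (shift_module SB)) :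
  dagger_module_functor (M := shift_dagger_modcat HA) (N := shift_dagger_modcat HB) G ->
  dagger_ufunctor (shift_ufun G).
Proof.
move=> [HG KG]; apply/dagger_ufunctorP => b a u x.
have Hw : sh_out (SA b u) ;; ufhom (shift_ufun G) (SA b u) b =
    sh_out (SB (G b) u) ;; upre (G b : B) (weak_dag (iso_hom (omega G b u))).
  rewrite -[LHS](shift_cmp_out (SB (G b : B) u) (shift_fun (shift_ufun G) (SA b u))).
  congr (_ ;; upre _ _).
  have E : iso_hom (omega G b u) =
      shift_cmp (SB (G b : B) u) (shift_fun (shift_ufun G) (SA b u)).
    apply: (shift_inj (s := SB (G b : B) u)).
    rewrite [RHS](shift_cmp_in (SB (G b : B) u) (shift_fun (shift_ufun G) (SA b u))) /=.
    by rewrite -gmap_nat compm1 gmap_in.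
  have [K _] := KG b u.
  have {}K : ucompose (iso_hom (omega G b u)) (weak_dag (iso_hom (omega G b u)))
      = uid (sh_ob (SB (G b : B) u)) := K.
  by rewrite -[LHS]ucompose1r -K {1}E ucomposeA shift_cmpK ucompose1l.
rewrite -(shift_mateK (SA b u) x); set f := shift_mate _ x.
have Gf : f ;; ufhom (shift_ufun G) (SA b u) a = fmap (mfun G) (f : @hom (shift_module SA) _ _).
  by rewrite shift_ufunE; exact: gmap_one.
have Gfd : weak_dag f ;; ufhom (shift_ufun G) a (SA b u) =
    weak_dag (f ;; ufhom (shift_ufun G) (SA b u) a).
  rewrite shift_ufunE Gf; etransitivity; first exact: (gmap_one G (weak_dag f)).
  exact: HG.
rewrite gdag_post HA gfun_pre Hw Gfd gfun_post.
rewrite gdag_post; congr (_ ;; _).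
rewrite -HB -gdag_post; congr gdag.
by rewrite shift_ufunE gmap_in.
Qed.
End DaggerFunctors.

(** * The axioms on the tensoring of a dagger U-category *)

Section TensoredDagger.
Context (U : unitary_monoidal_category) (A : weak_dagger_ucategory U).
Notation D := (umc_dual U).
Implicit Types a b c : A.
Implicit Types u v w : U.

Section Tensoring.
Context (T : tensoring D A).
Notation S := (shifts_of_tensoring T).

Lemma tensored_rhoE a : tensored_rho T a = shift_cmp (S a one) (shift_unit a).
Proof. exact: tensored_mateE. Qed.

(** Both sides of the axiom are products of graded elements, since [T a] acts on homs by
    [ζ ⋆ η]. *)
Lemma preserves_kappaP a :
  preserves_kappa (A := self U) (@self_kappa U) (fun b c : A => kappa b c) (T a) <->
  forall u v, sh_out (S a u) ⋆ (phiV v ;; sh_in (S a v))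
              = gdag (sh_in (S a u)) ⋆ gdag (sh_out (S a v)).
Proof.
have E u v : self_kappa u v ;; ufhom (T a) u v =
    nuV u (conj v) ;; (sh_out (S a u) ⋆ (phiV v ;; sh_in (S a v))).
  by rewrite /self_kappa ladj_homE -(compA (nuV _ _)) gcomp_natr.
have E' u v : conjm (ufhom (T a) v u) ;; kappa (T a u) (T a v) =
    nuV u (conj v) ;; (gdag (sh_in (S a u)) ⋆ gdag (sh_out (S a v))).
  by rewrite gdag_mul compA nuVK comp1m /gdag ladj_homE.
split=> [H u v | H u v].
- have := H u v; rewrite E E' => /(f_equal (fun x => nu u (conj v) ;; x)).
  by rewrite !(compA (nu _ _)) nuK !comp1m.
- by rewrite E E' H.
Qed.

Lemma kappa34_of_dagger_shifts : (forall a u, dagger_shift (S a u)) ->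
  (forall a, inverse (C := underlying A) (tensored_rho T a)
      (weak_dag (tensored_rho T a))) /\
  (forall a, preserves_kappa (A := self U) (@self_kappa U)
      (fun b c : A => kappa b c) (T a)).
Proof.
move=> HS; split=> a.
- rewrite tensored_rhoE.
  apply: (@shift_iso_unitary _ A a one (S a one) (shift_unit a)) => //.
  exact: dagger_shift_unit.
- apply/preserves_kappaP => u v.
  by rewrite HS -(HS a v) -[in LHS](gdagK (sh_in (S a v))) compA phiVK comp1m.
Qed.

(** Unitarity of [rho] says that the shift by [1] is a dagger shift.  The second axiom for
    [u] and [1] then equates the products of [ζ] and of the graded dagger of [η] with the
    same invertible element. *)
Lemma dagger_shifts_of_kappa34 :
  (forall a, inverse (C := underlying A) (tensored_rho T a)
      (weak_dag (tensored_rho T a))) ->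
  (forall a, preserves_kappa (A := self U) (@self_kappa U)
      (fun b c : A => kappa b c) (T a)) ->
  forall a u, dagger_shift (S a u).
Proof.
move=> K3 K4 a u.
have R : weak_dag (shift_cmp (S a one) (shift_unit a)) = shift_cmp (shift_unit a) (S a one).
  have [K _] := K3 a; rewrite tensored_rhoE in K.
  rewrite -[LHS]ucompose1l -(shift_cmpK (shift_unit a) (S a one)) -ucomposeA.
  rewrite [ucompose _ (weak_dag _)]K ucompose1r.
  by [].
have H1 : gdag (sh_in (S a one)) = sh_out (S a one).
  have : gdag (sh_in (S a one) ;; upost a (shift_cmp (S a one) (shift_unit a)))
      = sh_out (shift_unit a).
    by rewrite shift_cmp_in; exact: dagger_shift_unit.
  rewrite gdag_post R -(shift_cmp_out (S a one) (shift_unit a)).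
  move=> /(f_equal (fun x => x ;; upre a (shift_cmp (S a one) (shift_unit a)))).
  by rewrite -!gpre_comp shift_cmpK upre_id !compm1.
have /preserves_kappaP /(_ u one) := K4 a.
rewrite -H1 -[gdag (gdag _)](comp1m) -phiVK -(compA (phiV _)) gdagK.
rewrite -(gcomp_natr _ (sh_out _)) -(gcomp_natr _ (gdag _)).
move=> /(iso_epi (i := tens_iso (idiso _) (iso_sym (Iso (phiK one) (phiVK one))))).
move=> /(f_equal (fun x => x ;; upost _ (shift_cmp (S a one) (shift_unit a)))).
rewrite !gcomp_post !shift_cmp_in !gcomp1r => /iso_epi E.
by rewrite /dagger_shift E.
Qed.
End Tensoring.
End TensoredDagger.

Section DaggerUCategoryModule.
Context (U : unitary_monoidal_category) (A : dagger_ucategory U).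

Definition du_shifts : forall (a : A) (u : U), shift a u := shifts_of_tensoring (@du_tens U A).

Definition du_dagger_shifts : forall (a : A) (u : U), dagger_shift (du_shifts a u) :=
  dagger_shifts_of_kappa34 (kappa3 (d := A)) (kappa4 (d := A)).

Definition du_modcat : dagger_modcat U := shift_dagger_modcat du_dagger_shifts.
End DaggerUCategoryModule.

Arguments du_shifts {U} A a u.
Arguments du_dagger_shifts {U} A a u.

(** * Evaluation in module categories *)

Section ModuleCoherence.
Context (V : monoidal_category) (M : module_category V).
Implicit Types m n p : M.
Implicit Types u v w : V.

Lemma actm_l m n p u v (f : hom m n) (g : hom n p) (h : hom u v) :
  actm f h ;; actm g (idm v) = actm (f ;; g) h.
Proof. by rewrite -actmM compm1. Qed.

Lemma actm_r m n u v w (f : hom m n) (g : hom u v) (h : hom v w) :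
  actm f g ;; actm (idm n) h = actm f (g ;; h).
Proof. by rewrite -actmM compm1. Qed.

Lemma actm_lr m n u v (f : hom m n) (g : hom u v) :
  actm f (idm u) ;; actm (idm n) g = actm f g.
Proof. by rewrite -actmM comp1m compm1. Qed.

Lemma actm_rl m n u v (f : hom m n) (g : hom u v) :
  actm (idm m) g ;; actm f (idm v) = actm f g.
Proof. by rewrite -actmM comp1m compm1. Qed.

Lemma act_ascV_nat m m' u u' v v' (f : hom m m') (g : hom u u') (h : hom v v') :
  actm (actm f g) h ;; (act_asc m' u' v')^-1 = (act_asc m u v)^-1 ;; actm f (g ⊠ h).
Proof.
by apply: (iso_epi (i := act_asc m u v)); rewrite compA -act_asc_nat compK compKl.
Qed.

Definition act_iso m u v (i : iso u v) : iso (act m u) (act m v).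
Proof.
refine (@Iso M (act m u) (act m v) (actm (idm m) i) (actm (idm m) (i^-1)) _ _).
- by rewrite actm_r isoK actm1.
- by rewrite actm_r isoVK actm1.
Defined.

Definition act_isol m n u (i : iso m n) : iso (act m u) (act n u).
Proof.
refine (@Iso M (act m u) (act n u) (actm i (idm u)) (actm (i^-1) (idm u)) _ _).
- by rewrite actm_l isoK actm1.
- by rewrite actm_l isoVK actm1.
Defined.

Lemma act_one_inj m n (f g : hom m n) : actm f (idm one) = actm g (idm one) -> f = g.
Proof. by move=> e; apply: (iso_epi (i := act_run m)); rewrite -!act_run_nat e. Qed.

(** As for [asc_run] in a monoidal category: acting by the unit is faithful, and after
    acting by it both sides are related by the pentagon and the triangle axiom. *)
Lemma act_asc_run m u :
  act_asc m u one ;; act_run (act m u) = actm (idm m) (run u).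
Proof.
apply: act_one_inj; apply: (iso_epi (i := act_asc m (u ⊗ one) one)).
rewrite -actm_l compA act_pentagon -compA act_triangle.
rewrite -compA -(actm1 m u) -act_asc_nat compA actm_r triangle.
by rewrite act_asc_nat.
Qed.

Definition act_ev (D : dual_choice V) m u : hom (act (act m u) (D u)) m :=
  (act_asc m u (D u))^-1 ;; actm (idm m) (ev D u) ;; act_run m.

Context (D : dual_choice V).

Lemma act_ev_dualm m u v (h : hom v u) :
  actm (actm (idm m) h) (idm (D u)) ;; act_ev D m u
  = actm (idm (act m v)) (dualm D h) ;; act_ev D m v.
Proof.
rewrite /act_ev !compA act_ascV_nat (chain2 _ (actm_r _ _ _)) -dualm_spec.
by rewrite -actm_r compA -act_ascV_nat actm1.
Qed.

Lemma act_ev_nat m n u (f : hom m n) :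
  actm (actm f (idm u)) (idm (D u)) ;; act_ev D n u = act_ev D m u ;; f.
Proof.
rewrite /act_ev !compA act_ascV_nat tensm1 (chain2 _ (actm_lr _ _)) -actm_rl.
by rewrite compA (chain2 _ (act_run_nat _)) compA.
Qed.

Lemma act_ev_evc m v y :
  act_asc m v (D v ⊗ y) ;; act_asc (act m v) (D v) y ;; actm (act_ev D m v) (idm y)
  = actm (idm m) (evc (ev D v) y).
Proof.
apply: (iso_epi (i := act_iso m (asc v (D v) y))).
rewrite /= !compA -act_pentagon (chain2 _ (actm_l _ _ _)).
rewrite /act_ev -!(compA (_^-1)) compKl -actm_l compA -act_asc_nat -compA act_triangle.
by rewrite !actm_r /evc !compA isoK comp1m.
Qed.

(** Evaluating [u ⊗ v] is evaluating [v] and then [u], by the characterization of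
    [dual_nu]. *)
Lemma act_ev_tens m u v :
  act_asc (act (act m u) v) (D v) (D u) ;;
    actm (act_ev D (act m u) v) (idm (D u)) ;; act_ev D m u
  = actm ((act_asc m u v)^-1) (dual_nu D v u) ;; act_ev D m (u ⊗ v).
Proof.
have E : actm (act_asc m u v) (idm (D v ⊗ D u)) ;;
    actm ((act_asc m u v)^-1) (dual_nu D v u) = actm (idm _) (dual_nu D v u).
  by rewrite -actmM isoK comp1m.
apply: (iso_epi (i := act_isol (D v ⊗ D u) (act_asc m u v))) => /=.
rewrite [RHS]compA E.
apply: (iso_epi (i := act_asc m (u ⊗ v) (D v ⊗ D u))).
have -> : act_asc m (u ⊗ v) (D v ⊗ D u) ;;
    (actm (idm _) (dual_nu D v u) ;; act_ev D m (u ⊗ v)) =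
  actm (idm m) (asc u v (D v ⊗ D u) ;; (idm u ⊠ evc (ev D v) (D u)) ;; ev D u) ;; act_run m.
  rewrite -dual_nu_spec -actm_r -(actm1 m (u ⊗ v)) compA -act_asc_nat /act_ev !compA.
  by rewrite compK.
rewrite !compA act_pentagon (chain3 _ (act_ev_evc _ _ _)).
rewrite -(actm1 m u) (chain2 _ (eq_sym (act_asc_nat _ _ _))) compA actm_r.
by rewrite compK actm_r.
Qed.
End ModuleCoherence.

(** * The U-category of a tensored module category *)

(** The existence of right adjoints of the functors [m <| -] is a mere property, whereas
    the hom objects of a U-category are data. *)
Record internal_hom (V : monoidal_category) (M : module_category V) := InternalHom {
  ihom :> M -> M -> V;
  mate : forall m n u, hom (act m u) n -> hom u (ihom m n);
  mateV : forall m n u, hom u (ihom m n) -> hom (act m u) n;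
  mateK : forall m n u (f : hom (act m u) n), mateV (mate f) = f;
  mateVK : forall m n u (x : hom u (ihom m n)), mate (mateV x) = x;
  mate_nat : forall m n u v (g : hom v u) (f : hom (act m u) n),
    mate (actm (idm m) g ;; f) = g ;; mate f
}.

Arguments mate {V M} i {m n u} f : rename.
Arguments mateV {V M} i {m n u} x : rename.

Lemma internal_hom_exists (V : monoidal_category) (M : module_category V) :
  (forall m : M, has_right_adjoint (act_functor m)) -> inhabited (internal_hom M).
Proof.
move=> H.
have H1 (m : M) : exists R : M -> V, exists
    (p : (forall n u, hom (act m u) n -> hom u (R n)) *
         (forall n u, hom u (R n) -> hom (act m u) n)),
    (forall n u f, snd p n u (fst p n u f) = f) /\
    (forall n u x, fst p n u (snd p n u x) = x) /\
    (forall n u v (g : hom v u) f, fst p n v (actm (idm m) g ;; f) = g ;; fst p n u f).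
  have [R [mt [mV [K [VK N]]]]] := H m.
  exists R, (fun n u f => mt u n f, fun n u x => mV u n x).
  split; first by move=> n u f /=; apply: K.
  split; first by move=> n u x /=; apply: VK.
  move=> n u v g f /=; have := N u v n n g f (idm n).
  by rewrite fmap1 !compm1.
pose R m := constructive_indefinite_description _ (H1 m).
pose p m := constructive_indefinite_description _ (proj2_sig (R m)).
split; refine (@InternalHom V M (fun m => proj1_sig (R m))
  (fun m n u => fst (proj1_sig (p m)) n u) (fun m n u => snd (proj1_sig (p m)) n u) _ _ _).
- by move=> m; case: (proj2_sig (p m)).
- by move=> m; case: (proj2_sig (p m)) => _ [].
- by move=> m; case: (proj2_sig (p m)) => _ [].
Qed.

Section EnrichedModule.
Context (V : monoidal_category) (M : module_category V) (R : internal_hom M).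
Implicit Types m n p q : M.
Implicit Types u v w : V.

Lemma mateV_nat m n u v (g : hom v u) (x : hom u (R m n)) :
  mateV R (g ;; x) = actm (idm m) g ;; mateV R x.
Proof. by rewrite -{1}(mateVK x) -mate_nat mateK. Qed.

Definition icounit m n : hom (act m (R m n)) n := mateV R (idm _).

Lemma icounit_mate m n u (f : hom (act m u) n) :
  actm (idm m) (mate R f) ;; icounit m n = f.
Proof. by rewrite -mateV_nat compm1 mateK. Qed.

Lemma mate_icounit m n : mate R (icounit m n) = idm _.
Proof. exact: mateVK. Qed.

Lemma mate_inj m n u (f g : hom (act m u) n) : mate R f = mate R g -> f = g.
Proof. by move=> e; rewrite -(mateK R f) e mateK. Qed.

Definition icomp m n p : hom (R m n ⊗ R n p) (R m p) :=
  mate R (act_asc m _ _ ;; actm (icounit m n) (idm _) ;; icounit n p).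

(** Products of graded elements correspond to consecutive actions. *)
Lemma mate_comp m n p u v (f : hom (act m u) n) (g : hom (act n v) p) :
  (mate R f ⊠ mate R g) ;; icomp m n p
  = mate R (act_asc m u v ;; actm f (idm v) ;; g).
Proof.
rewrite -mate_nat !compA act_asc_nat (chain2 _ (actm_l _ _ _)) icounit_mate.
by rewrite -actm_lr compA -(compA (_ ;; _)) icounit_mate.
Qed.

Definition enriched_module : ucategory V.
Proof.
refine (@UCategory V M R (fun m => mate R (act_run m)) icomp _ _ _).
- move=> m n; rewrite -{1}(mate_icounit m n) mate_comp act_triangle mate_nat.
  by rewrite mate_icounit compm1.
- move=> m n; rewrite -{1}(mate_icounit m n) mate_comp -(compA (act_asc _ _ _)).
  by rewrite act_run_nat compA act_asc_run mate_nat mate_icounit compm1.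
- move=> m n p q.
  rewrite -(mate_icounit p q) -(mate_icounit m n).
  rewrite [icomp m n p]/icomp [icomp n p q]/icomp mate_comp -[RHS]compA mate_comp -mate_nat.
  congr (mate R _).
  rewrite -!actm_l !compA act_pentagon.
  rewrite (chain2 _ (eq_sym (act_asc_nat _ _ _))) tensm1 !compA.
  by [].
Defined.

Notation E := enriched_module.

(** The type mentions the hom object of [E], which the lemmas on graded elements need for
    unification. *)
Definition gmate m n u (f : hom (act m u) n) : hom u (uhom (m : E) n) := mate R f.

Lemma gmate_nat m n u v (g : hom v u) (f : hom (act m u) n) :
  gmate (actm (idm m) g ;; f) = g ;; gmate f.
Proof. exact: mate_nat. Qed.

Lemma gmate_inj m n u (f g : hom (act m u) n) : gmate f = gmate g -> f = g.
Proof. exact: mate_inj. Qed.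

Lemma gcomp_gmate m n p u v (f : hom (act m u) n) (g : hom (act n v) p) :
  gmate f ⋆ gmate g = gmate (act_asc m u v ;; actm f (idm v) ;; g).
Proof. exact: mate_comp. Qed.

(** Morphisms of [M] are the underlying morphisms of [E]. *)
Definition umor m n (f : hom m n) : hom one (uhom (m : E) n) := gmate (act_run m ;; f).

Definition umorV m n (x : hom one (uhom (m : E) n)) : hom m n :=
  (act_run m)^-1 ;; mateV R x.

Lemma umorK m n (f : hom m n) : umorV (umor f) = f.
Proof. by rewrite /umorV /umor /gmate mateK compVKl. Qed.

Lemma umorVK m n (x : hom one (uhom (m : E) n)) : umor (umorV x) = x.
Proof. by rewrite /umorV /umor compKl /gmate mateVK. Qed.

Lemma umor_inj m n (f g : hom m n) : umor f = umor g -> f = g.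
Proof. by move=> e; rewrite -(umorK f) e umorK. Qed.

Lemma gmate_post m n p u (f : hom (act m u) n) (g : hom n p) :
  gmate f ;; upost (m : E) (umor g) = gmate (f ;; g).
Proof.
rewrite gpostE gcomp_gmate compA -(compA _ _ (act_run n)) act_run_nat compA act_asc_run.
by rewrite -compA gmate_nat compVKl.
Qed.

Lemma gmate_pre m n p u (f : hom m n) (g : hom (act n u) p) :
  gmate g ;; upre (p : E) (umor f) = gmate (actm f (idm u) ;; g).
Proof.
rewrite gpreE gcomp_gmate -actm_l compA act_triangle -compA gmate_nat.
by rewrite compVKl.
Qed.

Lemma umor_id m : umor (idm m) = uid (m : E).
Proof. by rewrite /umor compm1. Qed.

Lemma umor_comp m n p (f : hom m n) (g : hom n p) :
  umor (f ;; g) = ucompose (umor f) (umor g).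
Proof. by rewrite ucompose_post gmate_post /umor compA. Qed.
End EnrichedModule.

Arguments gmate {V M} R {m n u} f.
Arguments umor {V M} R {m n} f.
Arguments umorV {V M} R {m n} x.

Lemma unitary_idm (C : category) (d : dagger C) (a : C) : unitary d (idm a).
Proof. by split; rewrite dag_idm comp1m. Qed.

(** Conjugating the second equation shows that [conjm l] has a left inverse; by the first
    equation it has a right inverse too, and [k] is its inverse up to [phi]. *)
Lemma conj_iso_of_involutive (U : unitary_monoidal_category) (x y : U)
    (k : hom (conj x) y) (l : hom (conj y) x) :
  phi y ;; conjm l ;; k = idm y -> phi x ;; conjm k ;; l = idm x ->
  k ;; (phi y ;; conjm l) = idm (conj x).
Proof.
move=> ek el.
have {}ek : conjm l ;; k ;; phi y = idm _.
  have -> : conjm l ;; k = phiV y; last exact: phiVK.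
  by rewrite -[RHS]compm1 -ek -(compA (phi y)) compA phiVK comp1m.
have {}el := f_equal (@conjm U _ _) el.
rewrite (conjmM (phi x ;; _)) conjm1 in el.
move: el; set e := conjm (phi x ;; _) => el.
transitivity (e ;; conjm l ;; (k ;; (phi y ;; conjm l))); first by rewrite el comp1m.
by rewrite (compA k) -(compA e) (compA (conjm l)) (compA (conjm l) k) ek comp1m.
Qed.

Section EnrichedDagger.
Context (U : unitary_monoidal_category) (M : dagger_modcat U) (R : internal_hom M).
Notation D := (umc_dual U).
Notation dg := (dm_dag M _ _).
Notation E := (enriched_module R).
Implicit Types m n p q : M.
Implicit Types u v w : U.

(** By [gmate_post], multiplying [gmate (idm _)] by an underlying morphism is injective. *)
Definition enriched_shift (m : E) u : shift m u.
Proof.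
refine (@mk_shift U E m u (act (m : M) u) (gmate R (idm (act m u)))
  (gmate R (act_ev D (m : M) u)) _ _).
- rewrite gcomp_gmate actm1 compm1 /act_ev !compA isoK comp1m gmate_nat.
  by [].
- move=> f g; rewrite -(umorVK f) -(umorVK g) !gmate_post !comp1m.
  by move=> /(@gmate_inj U M R) ->.
Defined.

Definition act_dag m n u (f : hom (act n u) m) : hom (act m (D u)) n :=
  actm (dg f) (idm (D u)) ;; act_ev D n u.

Lemma act_dag_nat m n u v (h : hom v u) (f : hom (act n u) m) :
  act_dag (actm (idm n) h ;; f) = actm (idm m) (dualm D h^†) ;; act_dag f.
Proof.
rewrite /act_dag dag_comp dm_act dag_idm -actm_l -compA act_ev_dualm [LHS]compA actm_r.
by rewrite comp1m -actm_rl -compA.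
Qed.

(** Up to coherence the left side is the action of [phi u] followed by its dagger. *)
Lemma act_dag_act_ev n u :
  actm (idm n) (phi u) ;; act_dag (act_ev D n u) = idm (act n u).
Proof.
have Hd : dg (act_ev D n u) = (act_run n)^-1 ;; actm (idm n) (ev D u)^† ;; act_asc n u (D u).
  rewrite /act_ev !dag_comp dm_act dag_idm (unitary_dag (dm_run_unitary _)).
  by rewrite -(unitary_dag (dm_asc_unitary _ _ _)) dagK compA.
rewrite /act_dag Hd.
have H1 : actm ((act_run n)^-1) (idm (D (D u))) =
    actm (idm n) ((lun _)^-1) ;; act_asc n one (D (D u)).
  apply: (iso_mono (i := act_isol _ (act_run n))) => /=.
  rewrite actm_l isoVK -compA act_triangle actm_r isoVK.
  by [].
rewrite -!actm_l H1 -(compA (actm _ _)) -act_asc_nat.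
have H2 : act_asc n (u ⊗ D u) (D (D u)) ;; actm (act_asc n u (D u)) (idm (D (D u))) ;;
    act_ev D (act n u) (D u) =
  actm (idm n) (asc u (D u) (D (D u)) ;; (idm u ⊠ ev D (D u)) ;; run u).
  rewrite act_pentagon /act_ev !compA compK -(actm1 n u) (chain2 _ (eq_sym (act_asc_nat _ _ _))).
  by rewrite compA (chain2 _ (act_asc_run _ _)) !actm_r.
rewrite -!(compA (actm (idm n) (lun _ ^-1))) -(compA (actm _ _) (act_asc _ _ _)).
rewrite -(compA (actm _ _)) H2 !actm_r.
transitivity (actm (idm n) (phi u ;; (phi u)^†)); last by rewrite phi_dag phiK actm1.
by rewrite phi_dagE !compA.
Qed.

Lemma act_dagK m n u (f : hom (act n u) m) : actm (idm n) (phi u) ;; act_dag (act_dag f) = f.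
Proof.
rewrite {1}/act_dag {1}/act_dag dag_comp dm_act dagK dag_idm -actm_l -(compA (actm (dg _) _)).
rewrite act_ev_nat (compA (actm (dg _) _)) (compA (actm (idm n) _)).
have := act_dag_act_ev n u; rewrite /act_dag => ->.
by rewrite comp1m.
Qed.

(** Slide both daggers of morphisms to the front, by naturality of the evaluation; what is
    left is [act_ev_tens], as [act_asc] is unitary. *)
Lemma act_dag_mul m n p u v (f : hom (act m u) n) (g : hom (act n v) p) :
  act_asc p (D v) (D u) ;; actm (act_dag g) (idm (D u)) ;; act_dag f
  = actm (idm p) (nu v u) ;; act_dag (act_asc m u v ;; actm f (idm v) ;; g).
Proof.
rewrite /act_dag !dag_comp dm_act dag_idm (unitary_dag (dm_asc_unitary _ _ _)).
transitivity (actm (dg g) (idm (D v ⊗ D u)) ;; actm (actm (dg f) (idm v)) (idm _) ;;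
  (actm ((act_asc m u v)^-1) (nu v u) ;; act_ev D m (u ⊗ v))).
- rewrite -act_ev_tens -actm_l (compA _ (actm _ _) (act_ev _ _ _)).
  rewrite (compA (act_asc _ _ _)) -act_asc_nat.
  rewrite (chain2 _ (actm_l _ _ _)) -act_ev_nat -actm_l (compA (_ ;; _)).
  rewrite (chain2 _ (eq_sym (act_asc_nat _ _ _))) !tensm1.
  rewrite -!(compA (actm (dg g) _)); congr (_ ;; _).
  by rewrite -!(compA (actm (actm (dg f) _) _)).
- rewrite (compA _ (actm _ (nu v u))) (compA (actm (idm p) _)); congr (_ ;; _).
  by rewrite -!actmM !comp1m compm1 compA.
Qed.

Definition enriched_kappa m n : hom (conj (R n m)) (R m n) := mate R (act_dag (icounit R n m)).

Lemma enriched_kappaE m n u (f : hom (act n u) m) :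
  conjm (gmate R f) ;; enriched_kappa m n = mate R (act_dag f).
Proof.
rewrite -[in RHS](icounit_mate R f) act_dag_nat mate_nat.
by [].
Qed.

Lemma enriched_kappa1 m n :
  phi (R m n) ;; conjm (enriched_kappa n m) ;; enriched_kappa m n = idm (R m n).
Proof.
rewrite -compA.
rewrite [X in _ ;; X](enriched_kappaE (act_dag (icounit R m n))) -mate_nat act_dagK.
exact: mate_icounit.
Qed.

Lemma enriched_kappa2 m n p :
  (enriched_kappa m n ⊠ enriched_kappa n p) ;; icomp R m n p
  = nu (R n m) (R p n) ;; conjm (icomp R p n m) ;; enriched_kappa m p.
Proof.
have -> : nu (R n m) (R p n) ;; conjm (icomp R p n m) ;; enriched_kappa m p =
    nu (R n m) (R p n) ;; mate R (act_dag (act_asc p _ _ ;;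
      actm (icounit R p n) (idm _) ;; icounit R n m)).
  by rewrite -enriched_kappaE compA.
rewrite mate_comp act_dag_mul mate_nat.
by [].
Qed.

Lemma enriched_kappaVK m n :
  enriched_kappa m n ;; (phi (R m n) ;; conjm (enriched_kappa n m)) = idm _.
Proof.
by apply: conj_iso_of_involutive; exact: enriched_kappa1.
Qed.

Definition enriched_kappa_iso m n : iso (conj (R n m)) (R m n) :=
  Iso (enriched_kappaVK m n) (enriched_kappa1 m n).

Definition enriched_weak : weak_dagger_ucategory U :=
  @WeakDaggerUCategory U E enriched_kappa_iso enriched_kappa1 enriched_kappa2.

Lemma gdag_gmate m n u (f : hom (act n u) m) :
  gdag (A := enriched_weak) (gmate R f) = gmate R (act_dag f).
Proof. exact: enriched_kappaE. Qed.

Lemma enriched_dagger_shift (m : enriched_weak) u :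
  dagger_shift (A := enriched_weak) (enriched_shift m u).
Proof.
rewrite /dagger_shift /= gdag_gmate /act_dag dag_idm actm1 comp1m.
by [].
Qed.

(** For a morphism out of [m <| 1] this compares two expressions of the graded dagger of
    its transpose; the general case follows by precomposing with the unitary [act_run]. *)
Lemma umor_dag m n (f : hom m n) :
  umor R (dg f) = weak_dag (A := enriched_weak) (umor R f).
Proof.
have H k (g : hom (act m one) k) :
    umor R (dg g) = weak_dag (A := enriched_weak) (umor R g).
  apply: (shift_inj_out (s := enriched_shift m one)).
  have := gdag_post (A := enriched_weak) (gmate R (idm (act m one))) (umor R g).
  rewrite [X in gdag (A := enriched_weak) X = _]gmate_post comp1m gdag_gmate.
  rewrite [X in _ = X ;; _]enriched_dagger_shift => <-.
  exact: gmate_pre.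
have e := H n (act_run m ;; f).
rewrite dag_comp !umor_comp weak_dagM -[weak_dag (A := enriched_weak) (umor R (act_run m))]H in e.
have {}e := f_equal (fun x => ucompose x (umor R (act_run m))) e.
have K : dg (act_run m) ;; act_run m = idm m by case: (dm_run_unitary m).
by rewrite -!ucomposeA -umor_comp K umor_id !ucompose1r in e.
Qed.

Definition enriched_tensoring : tensoring D enriched_weak :=
  tensoring_of_shifts enriched_shift.

Notation S := (shifts_of_tensoring enriched_tensoring).

Lemma enriched_tensoring_in (m : M) u :
  sh_in (S (m : E) u) = gmate R (idm (act m u)).
Proof. exact: (tensoring_of_shifts_in enriched_shift). Qed.

Lemma enriched_tensoring_dagger (m : enriched_weak) u :
  dagger_shift (A := enriched_weak) (S m u).
Proof.
rewrite /dagger_shift (tensoring_of_shifts_out enriched_shift) -enriched_dagger_shift.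
by congr gdag; exact: enriched_tensoring_in.
Qed.

Definition enriched_dagger : dagger_ucategory U :=
  @DaggerUCategory U enriched_weak enriched_tensoring
    (proj1 (kappa34_of_dagger_shifts enriched_tensoring_dagger))
    (proj2 (kappa34_of_dagger_shifts enriched_tensoring_dagger)).

Lemma umor_act m n u v (f : hom m n) (g : hom u v) :
  umor R (actm f g) = sact S (umor R f) g.
Proof.
apply: (shift_inj (s := S (m : E) u)); rewrite sact_in !enriched_tensoring_in.
rewrite gmate_post -(compA g) [X in _ = _ ;; X]gmate_pre -gmate_nat.
by rewrite comp1m compm1 actm_rl.
Qed.

Lemma umor_asc m u v : umor R (act_asc m u v) = sasc S (m : E) u v.
Proof.
apply: (shift_inj (s := S (m : E) (u ⊗ v))); rewrite sasc_in !enriched_tensoring_in.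
by rewrite gmate_post gcomp_gmate actm1 comp1m !compm1.
Qed.

Lemma umor_run m : umor R (act_run m) = srun S (m : E).
Proof.
apply: (shift_inj (s := S (m : E) one)); rewrite srun_in !enriched_tensoring_in.
by rewrite gmate_post comp1m.
Qed.

Notation N := (shift_module S).

Definition umor_functor : functor M (underlying E) :=
  @Functor M (underlying E) (fun m => m) (fun m n f => umor R f)
    (fun m => umor_id R m) (fun m n p f g => umor_comp R f g).

Lemma umorV_id m : umorV R (uid (m : E)) = idm m.
Proof. by rewrite -umor_id umorK. Qed.

Lemma umorV_comp m n p (x : hom one (uhom (m : E) n)) (y : hom one (uhom (n : E) p)) :
  umorV R (ucompose x y) = umorV R x ;; umorV R y.
Proof. by apply: (@umor_inj U M R); rewrite umor_comp !umorVK. Qed.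

Definition umorV_functor : functor (underlying E) M :=
  @Functor (underlying E) M (fun m => m) (fun m n x => umorV R x) umorV_id umorV_comp.

Lemma umor_omega_nat m n u v (f : hom m n) (g : hom u v) :
  ucompose (sact S (umor R f) g) (uid (act n v : E))
  = ucompose (uid (act m u : E)) (umor R (actm f g)).
Proof. by rewrite ucompose1r ucompose1l umor_act. Qed.

Lemma umor_omega_asc m u v :
  ucompose (uid (act m (u ⊗ v) : E)) (umor R (act_asc m u v))
  = ucompose (ucompose (sasc S (m : E) u v) (sact S (uid (act m u : E)) (idm v)))
      (uid (act (act m u) v : E)).
Proof. by rewrite ucompose1l ucompose1r umor_asc sact_id ucompose1r. Qed.

Lemma umor_omega_run m :
  ucompose (uid (act m one : E)) (umor R (act_run m)) = srun S (m : E).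
Proof. by rewrite ucompose1l umor_run. Qed.

Definition umor_modfun : module_functor M N :=
  @ModuleFunctor U M N umor_functor (fun m u => idiso (act m u : underlying E))
    umor_omega_nat umor_omega_asc umor_omega_run.

Lemma umorV_omega_nat m n u v (x : hom one (uhom (m : E) n)) (g : hom u v) :
  actm (umorV R x) g ;; idm (act n v) = idm (act m u) ;; umorV R (sact S x g).
Proof.
rewrite comp1m compm1; apply: (@umor_inj U M R).
by rewrite umor_act !umorVK.
Qed.

Lemma umorV_omega_asc m u v :
  idm (act m (u ⊗ v)) ;; umorV R (sasc S (m : E) u v)
  = act_asc m u v ;; actm (idm (act m u)) (idm v) ;; idm (act (act m u) v).
Proof.
rewrite actm1 comp1m !compm1; apply: (@umor_inj U M R).
by rewrite umorVK umor_asc.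
Qed.

Lemma umorV_omega_run m : idm (act m one) ;; umorV R (srun S (m : E)) = act_run m.
Proof.
rewrite comp1m; apply: (@umor_inj U M R).
by rewrite umorVK umor_run.
Qed.

Definition umorV_modfun : module_functor N M :=
  @ModuleFunctor U N M umorV_functor (fun m u => idiso (act (m : M) u))
    umorV_omega_nat umorV_omega_asc umorV_omega_run.

Lemma umor_modfunK : module_functor_comp umor_modfun umorV_modfun = module_functor_id M.
Proof.
unshelve eapply module_functor_ext.
  unshelve eapply functor_ext; first by [].
  by move=> m n f /=; rewrite umorK.
move=> m u; etransitivity; first exact: (@hcast_id M (act m u) (act m u)).
by rewrite /= comp1m umorV_id.
Qed.

Lemma umorV_modfunK : module_functor_comp umorV_modfun umor_modfun = module_functor_id N.
Proof.
unshelve eapply module_functor_ext.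
  unshelve eapply functor_ext; first by [].
  by move=> m n f /=; rewrite umorVK.
move=> m u; etransitivity; first exact: (@hcast_id N (act (m : N) u) (act (m : N) u)).
etransitivity; first exact: (@comp1m N).
exact: (@umor_id U M R).
Qed.

Lemma umor_modfun_dagger :
  dagger_module_functor (M := M) (N := du_modcat enriched_dagger) umor_modfun.
Proof.
split=> [m n f | m u]; first exact: umor_dag.
exact: (unitary_idm (dm_dag (du_modcat enriched_dagger))).
Qed.

Lemma umorV_modfun_dagger :
  dagger_module_functor (M := du_modcat enriched_dagger) (N := M) umorV_modfun.
Proof.
split=> [m n f | m u].
- by apply: (@umor_inj U M R); rewrite umor_dag !umorVK.
- exact: (unitary_idm (dm_dag M)).
Qed.
End EnrichedDagger.

(** * The 2-equivalence *)

Local Ltac functor_eq :=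
  unshelve eapply functor_ext; [intros; cbn; exact eq_refl | intros; cbn; exact eq_refl].

Section FullSubcategories.
Context (C D : category) (P : C -> Prop) (Q : D -> Prop).

Definition full_restrict (F : functor C D) (PQ : forall c, P c -> Q (F c)) :
    functor (full_subcat P) (full_subcat Q) :=
  full_lift (F := functor_comp (full_incl P) F) (fun c => PQ _ (proj2_sig c)).
End FullSubcategories.

Lemma full_restrict_iso (C D : category) (P : C -> Prop) (Q : D -> Prop)
    (F : functor C D) (G : functor D C)
    (PQ : forall c, P c -> Q (F c)) (QP : forall d, Q d -> P (G d)) :
  functor_comp F G = functor_id C -> functor_comp G F = functor_id D ->
  is_iso_of_categories (full_restrict PQ).
Proof.
move=> FG GF; exists (full_restrict QP); split; apply: full_incl_mono.
- transitivity (functor_comp (full_incl P) (functor_comp F G)).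
    by functor_eq.
  by rewrite FG; unshelve eapply functor_ext.
- transitivity (functor_comp (full_incl Q) (functor_comp G F)).
    by functor_eq.
  by rewrite GF; unshelve eapply functor_ext.
Qed.

Lemma full_subcat_eq (C : category) (P : C -> Prop) (x y : full_subcat P) :
  proj1_sig x = proj1_sig y -> x = y.
Proof.
case: x y => [x px] [y py] /= e; case: y / e py => py.
by rewrite (proof_irrelevance _ px py).
Qed.

Lemma isomorphic_of_eq (C : category) (a b : C) : a = b -> isomorphic a b.
Proof. by move=> ->; split; exact: idiso. Qed.

Section TwoEquivalence.
Context (U : unitary_monoidal_category).

Definition ucat_to_modcat_cells (A B : dagger_ucategory U) :
    functor (cells (s := dagger_ucat2 U) A B)
            (cells (s := dagger_modcat2 U) (du_modcat A) (du_modcat B)) :=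
  full_restrict (F := shift_forward (du_shifts A) (du_shifts B))
    (fun F HF => shift_modfun_dagger (du_dagger_shifts A)
                                     (du_dagger_shifts B) HF).

Lemma ucat_to_modcat_cells_comp (A B C : dagger_ucategory U) :
  functor_comp (comp2 (s := dagger_ucat2 U) A B C) (ucat_to_modcat_cells A C)
  = functor_comp (prod_functor (ucat_to_modcat_cells A B) (ucat_to_modcat_cells B C))
      (comp2 (s := dagger_modcat2 U) (du_modcat A) (du_modcat B) (du_modcat C)).
Proof.
apply: full_incl_mono.
transitivity (functor_comp
  (prod_functor
    (full_incl (C := ufun_cat A B) (fun F => dagger_ufunctor (A := A) (B := B) F))
    (full_incl (C := ufun_cat B C) (fun F => dagger_ufunctor (A := B) (B := C) F)))
  (functor_comp (ucomp2 A B C)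
     (shift_forward (du_shifts A) (du_shifts C)))).
  by functor_eq.
rewrite (shift_forward_comp (du_shifts A) (du_shifts B) (du_shifts C)).
by functor_eq.
Qed.

Definition ucat_to_modcat : strict2functor (dagger_ucat2 U) (dagger_modcat2 U).
Proof.
refine (@Strict2Functor (dagger_ucat2 U) (dagger_modcat2 U)
  (@du_modcat U) ucat_to_modcat_cells _ _).
- by move=> A; apply: full_subcat_eq; exact: shift_modfun_id.
- exact: ucat_to_modcat_cells_comp.
Defined.

Lemma ucat_to_modcat_cells_iso (A B : dagger_ucategory U) :
  is_iso_of_categories (ucat_to_modcat_cells A B).
Proof.
apply: (full_restrict_iso (G := shift_backward (du_shifts A) (du_shifts B))).
- by move=> G HG; apply: (shift_ufun_dagger (HA := du_dagger_shifts A)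
    (HB := du_dagger_shifts B)).
- exact: shift_forwardK.
- exact: shift_backwardK.
Qed.

Definition dagger_modcell (M N : dagger_modcat U) (F : module_functor M N)
    (HF : dagger_module_functor (M := M) (N := N) F) :
    cells (s := dagger_modcat2 U) M N :=
  exist _ F HF.

Lemma ucat_to_modcat_essentially_surjective (M : dagger_modcat2 U) :
  exists A : dagger_ucat2 U, equivalent_cells M (ucat_to_modcat A).
Proof.
have [R] := internal_hom_exists (dm_tensored (d := M)).
exists (enriched_dagger R).
exists (dagger_modcell (umor_modfun_dagger R)).
exists (dagger_modcell (umorV_modfun_dagger R)).
split; apply: isomorphic_of_eq; apply: full_subcat_eq.
- exact: umor_modfunK.
- exact: umorV_modfunK.
Qed.
End TwoEquivalence.

Theorem theorem1 (U : unitary_monoidal_category) :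
  exists F : strict2functor (dagger_ucat2 U) (dagger_modcat2 U),
    is_strict_locally_isomorphic_2equivalence F.
Proof.
exists (ucat_to_modcat U); split; first exact: ucat_to_modcat_essentially_surjective.
exact: ucat_to_modcat_cells_iso.
Qed.
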